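(* Let $p,q\ge 1$ be fixed integers and suppose that $Y_n(t)=\int_0^1\Psi(s,t)X_n(s)\,ds+\epsilon_n(t)$ for all $n$, with the same nonrandom kernel $\Psi\in L^2([0,1]^2)$ for every $n$. Assume: (i) $X_n(t)=a(\boldsymbol\eta_n(t),\boldsymbol\eta_{n-1}(t),\dots)$ and $\epsilon_n(t)=b(\boldsymbol\eta_n(t),\boldsymbol\eta_{n-1}(t),\dots)$ for some functionals $a,b$, where $\{\boldsymbol\eta_k,\,-\infty<k<\infty\}$ are iid vector-valued random functions; (ii) $E X_n(t)=0$, $E\epsilon_n(t)=0$, $\int_0^1 E X_n^4(t)\,dt<\infty$ and $\int_0^1 E\epsilon_n^4(t)\,dt<\infty$; (iii) $E X_n(t)\epsilon_n(s)=0$ for all $0\le t,s\le 1$; (iv) $\sum_{k\ge1}\left(E\int_0^1(X_n(t)-X_n^{(k)}(t))^4dt\right)^{1/4}<\infty$ and $\sum_{k\ge1}\left(E\int_0^1(\epsilon_n(t)-\epsilon_n^{(k)}(t))^4dt\right)^{1/4}<\infty$; (v) $\int_0^1\int_0^1\Psi^4(s,t)\,dt\,ds<\infty$; (vi) $K:\mathbb R\to\mathbb R$ satisfies $K(0)=1$, $K$ is symmetric and Lipschitz, $K$ has bounded support, and its Fourier transform $\hat K$ is Lipschitz and integrable; (vii) $B_N\to\infty$ and $B_N/N\to0$ as $N\to\infty$. Then $\tilde{\boldsymbol\Sigma}_N\to\boldsymbol\Sigma$ in probability as $N\to\infty$, where $$\tilde{\boldsymbol\Sigma}_N=\sum_{k=-(N-1)}^{N-1}K(k/B_N)\,\boldsymbol\phi_{k,N},\qquad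 \boldsymbol\phi_{k,N}=\frac1N\sum_{\ell=\max(1,1-k)}^{\min(N,N-k)}\boldsymbol\gamma_\ell\boldsymbol\gamma_{\ell+k}^T.$$
   Context: Write $\langle f,g\rangle=\int_0^1 f(t)g(t)\,dt$. $\hat K(u)=\frac1{2\pi}\int_{-\infty}^\infty K(s)e^{-isu}ds$. Coupled processes: $X_n^{(k)}(t)=a(\boldsymbol\eta_n(t),\dots,\boldsymbol\eta_{n-k+1}(t),\boldsymbol\eta^{(k)}_{n,n-k}(t),\boldsymbol\eta^{(k)}_{n,n-k-1}(t),\dots)$ and $\epsilon_n^{(k)}(t)=b(\boldsymbol\eta_n(t),\dots,\boldsymbol\eta_{n-k+1}(t),\boldsymbol\eta^{(k)}_{n,n-k}(t),\boldsymbol\eta^{(k)}_{n,n-k-1}(t),\dots)$, where $\{\boldsymbol\eta_{n,\ell}^{(k)},\,-\infty<k,\ell,n<\infty\}$ are iid copies of $\boldsymbol\eta_0$, independent of $\{\boldsymbol\eta_k\}$. Eigenelements: $C(s,t)=\mathrm{cov}(X_n(t),X_n(s))$ and $D(s,t)=\mathrm{cov}(Y_n(t),Y_n(s))$. $\lambda_1\ge\lambda_2\ge\cdots$ and $\tau_1\ge\tau_2\ge\cdots$ are the eigenvalues of the integral operators with kernels $C$ and $D$, with corresponding eigenfunctions $v_1,v_2,\dots$ and $w_1,w_2,\dots$, each family being an orthonormal basis of $L^2[0,1]$. Expand $\Psi(s,t)=\sum_{i,j\ge1}\psi_{i,j}v_j(s)w_i(t)$. Long-run covariance: $u_i(s)=\sum_{r=p+1}^\infty\psi_{i,r}v_r(s)$,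 $\gamma_\ell(i,j)=\langle X_\ell,v_j\rangle\langle\epsilon_\ell,w_i\rangle+\langle X_\ell,v_j\rangle\langle X_\ell,u_i\rangle$, and $\boldsymbol\gamma_\ell\in\mathbb R^{pq}$ is the column vector whose $((i-1)p+j)$th entry is $\gamma_\ell(i,j)$, $1\le i\le q$, $1\le j\le p$. $\boldsymbol\Sigma=E\boldsymbol\gamma_0\boldsymbol\gamma_0^T+\sum_{\ell=1}^\infty E\boldsymbol\gamma_0\boldsymbol\gamma_\ell^T+\sum_{\ell=1}^\infty E\boldsymbol\gamma_\ell\boldsymbol\gamma_0^T$. *)

(* Defs.v *)
From HB Require Import structures.
From mathcomp Require Import all_boot all_order all_algebra.
From mathcomp Require Import finmap.
From mathcomp Require Import complex.
From mathcomp Require Import all_classical all_reals all_analysis.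

Set Implicit Arguments.
Unset Strict Implicit.
Unset Printing Implicit Defensive.

Import Order.TTheory GRing.Theory Num.Theory.
Import numFieldNormedType.Exports.

Local Open Scope classical_set_scope.
Local Open Scope ring_scope.

Section random_functions.
Context {d : measure_display} {T : measurableType d} {R : realType}.
Variable P : probability T R.

Definition jointly_measurable {d' : measure_display} {E : measurableType d'}
    (f : T -> R -> E) : Prop :=
  measurable_fun ([set: T] `*` `[(0 : R)%R, 1%R] : set (T * measurableTypeR R))
    (fun x => f x.1 x.2).

(* sigma-algebra on U -> E generated by the evaluations at the points of D *)
Definition cylinder {U : Type} {d' : measure_display} {E : measurableType d'}
    (D : set U) : set (set (U -> E)) :=
  <<s [set A | exists2 t, D t &
        exists2 B, measurable B & A = [set f : U -> E | B (f t)]] >>.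

(* The law of a random function is its law on the cylinder sigma-algebra of
   functions on [0, 1], i.e. its family of finite-dimensional distributions;
   values at times outside [0, 1] are irrelevant. *)
Definition iid_random_functions {I : choiceType} {d' : measure_display}
    {E : measurableType d'} (xi : I -> T -> R -> E) : Prop :=
  [/\ forall i, jointly_measurable (xi i),
      forall i j (A : set (R -> E)), cylinder `[0, 1] A ->
        P (xi i @^-1` A) = P (xi j @^-1` A)
    & forall (J : {fset I}) (A : I -> set (R -> E)),
        (forall j, j \in J -> cylinder `[0, 1] (A j)) ->
        P (\bigcap_(j in [set` J]) xi j @^-1` A j) =
        (\prod_(j <- J) P (xi j @^-1` A j))%E].

(* eta together with the coupling copies: [inl n] is eta_n and
   [inr (k, n, l)] is eta^(k)_{n,l}. *)
Definition with_copies {E : Type} (eta : int -> T -> R -> E)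
    (etac : int -> int -> int -> T -> R -> E)
    (i : int + int * int * int) : T -> R -> E :=
  match i with
  | inl n => eta n
  | inr (k, n, l) => etac k n l
  end.

Definition bernoulli_shift {E : Type} (a : (nat -> E) -> R)
    (eta : int -> T -> R -> E) (n : int) (w : T) (t : R) : R :=
  a (fun j => eta (n - j%:Z) w t).

Definition coupled {E : Type} (a : (nat -> E) -> R)
    (eta : int -> T -> R -> E) (etac : int -> int -> int -> T -> R -> E)
    (k : nat) (n : int) (w : T) (t : R) : R :=
  a (fun j => if (j < k)%N then eta (n - j%:Z) w t
              else etac k%:Z n (n - j%:Z) w t).

Definition cov_kernel (X : T -> R -> R) (t s : R) : R :=
  fine (covariance P (fun w => X w t) (fun w => X w s)).

Definition expectation_mx {m n : nat} (M : T -> 'M[R]_(m, n)) : 'M[R]_(m, n) :=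
  \matrix_(i, j) fine 'E_P[fun w => M w i j].

Definition cvg_in_probability {m n : nat} (M : nat -> T -> 'M[R]_(m, n))
    (L : 'M[R]_(m, n)) : Prop :=
  forall e : R, 0 < e -> P [set w | e < `|M N w - L|] @[N --> \oo] --> 0%E.

End random_functions.

Section L2.
Context {R : realType}.
Local Notation mu := (@lebesgue_measure R).

Definition inner (f g : R -> R) : R := \int[mu]_(t in `[0, 1]) (f t * g t).

Definition inL2 (f : R -> R) : Prop :=
  measurable_fun `[(0 : R)%R, 1%R] f /\
  (\int[mu]_(t in `[(0 : R)%R, 1%R]) (f t ^+ 2)%:E < +oo)%E.

Definition cvgL2 (g : nat -> R -> R) (f : R -> R) : Prop :=
  (\int[mu]_(t in `[(0 : R)%R, 1%R]) ((g n t - f t) ^+ 2)%:E)%E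
    @[n --> \oo] --> 0%E.

Definition measurable_on_square (Psi : R -> R -> R) : Prop :=
  measurable_fun
    (`[(0 : R)%R, 1%R] `*` `[(0 : R)%R, 1%R] : set (measurableTypeR R * measurableTypeR R))
    (fun x => Psi x.1 x.2).

Definition kernel_integral (Psi : R -> R -> R) : \bar R :=
  (\int[mu]_(s in `[(0 : R)%R, 1%R]) \int[mu]_(t in `[(0 : R)%R, 1%R])
     (Psi s t)%:E)%E.

Definition orthonormal_basis (v : nat -> R -> R) : Prop :=
  [/\ forall i, inL2 (v i),
      forall i j, inner (v i) (v j) = (i == j)%:R
    & forall f, inL2 f ->
        cvgL2 (fun n t => \sum_(i < n) inner f (v i) * v i t) f].

Definition eigensystem (C : R -> R -> R) (lambda : nat -> R)
    (v : nat -> R -> R) : Prop :=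
  [/\ forall i j, (i <= j)%N -> lambda j <= lambda i,
      orthonormal_basis v
    & forall i, {ae mu, forall t, t \in `[0, 1] ->
        \int[mu]_(s in `[0, 1]) (C t s * v i s) = lambda i * v i t}].

(* Psi(s,t) = sum_(i,j) psi_(i,j) v_j(s) w_i(t) in L^2([0,1]^2); the family
   being orthonormal, this determines psi. *)
Definition kernel_expansion (Psi : R -> R -> R) (v w : nat -> R -> R)
    (psi : nat -> nat -> R) : Prop :=
  kernel_integral (fun s t =>
    ((\sum_(i < n) \sum_(j < n) psi i j * v j s * w i t) - Psi s t) ^+ 2)
  @[n --> \oo] --> 0%E.

(* (1 / 2pi) int K(s) e^(-isu) ds, split into real and imaginary parts *)
Definition fourier (K : R -> R) (u : R) : R[i] :=
  Complex ((2 * pi)^-1 * \int[mu]_s (K s * cos (s * u)))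
          (- ((2 * pi)^-1 * \int[mu]_s (K s * sin (s * u)))).

End L2.

Definition int_range (a b : int) : seq int :=
  if a <= b then [seq a + k%:Z | k <- iota 0 `|(b - a + 1)%R|%N] else [::].

Section long_run_covariance.
Context {d : measure_display} {T : measurableType d} {R : realType}.
Variable P : probability T R.
Variables (p q : nat) (X eps : int -> T -> R -> R) (v w u : nat -> R -> R).

(* Basis functions are indexed from 0 instead of 1: [v j] is v_{j+1}, etc. *)
Definition gamma_entry (l : int) (o : T) (i j : nat) : R :=
  inner (X l o) (v j) * inner (eps l o) (w i) +
  inner (X l o) (v j) * inner (X l o) (u i).

Definition gamma (l : int) (o : T) : 'cV[R]_(p * q) :=
  \col_(m < p * q) gamma_entry l o (m %/ p) (m %% p).

(* E gamma_k gamma_l^T *)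
Definition gamma_cov (k l : int) : 'M[R]_(p * q) :=
  expectation_mx P (fun o => gamma k o *m (gamma l o)^T).

Definition long_run_cov : 'M[R]_(p * q) :=
  gamma_cov 0 0
  + limn (fun n => \sum_(1 <= l < n) gamma_cov 0 l%:Z)
  + limn (fun n => \sum_(1 <= l < n) gamma_cov l%:Z 0).

Definition phi (k : int) (N : nat) (o : T) : 'M[R]_(p * q) :=
  N%:R^-1 *: \sum_(l <- int_range (Num.max 1 (1 - k)) (Num.min N%:Z (N%:Z - k)))
               (gamma l o *m (gamma (l + k) o)^T).

Definition kernel_estimator (K : R -> R) (B : nat -> R) (N : nat) (o : T) :
    'M[R]_(p * q) :=
  \sum_(k <- int_range (- (N%:Z - 1)) (N%:Z - 1)) K (k%:~R / B N) *: phi k N o.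

End long_run_covariance.

(* Main.v *)
Require Import Defs.
From HB Require Import structures.
From mathcomp Require Import all_boot all_order all_algebra.
From mathcomp Require Import finmap.
From mathcomp Require Import complex.
From mathcomp Require Import all_classical all_reals all_analysis.
From mathcomp Require Import measurable_realfun.
From mathcomp Require Import ring lra zify.

Set Implicit Arguments.
Unset Strict Implicit.
Unset Printing Implicit Defensive.

Import Order.TTheory GRing.Theory Num.Theory.
Import numFieldNormedType.Exports.

Local Open Scope classical_set_scope.
Local Open Scope ring_scope.

(** Every entry of [gamma] is a score: a sum of two products of linear
    statistics of the regressor and the noise.  By Cauchy-Schwarz, in time and
    then over the sample space, a score is square integrable, and its distance
    to its coupled version is controlled by fourth moments ([score_diff_nrm]),
    so that the coupling errors are summable.  Scores are centred: the noise is
    uncorrelated with the regressor, and [v j], an eigenfunction of the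
    covariance operator, is orthogonal to [u i] for [j < p] ([Ex_score0]).  The
    coupled score of order [k] at time [n] is independent of everything up to
    time [n - k]; hence covariances at lag [h] are bounded by a constant times
    the coupling error of order [h].  This makes the series that define the
    long-run covariance converge, and gives the property on which the rest of
    the proof runs: the scores are quasi-orthogonal, that is, E (sum w_l x_l)^2
    is at most C^2 (sum w_l^2) for all weights ([score_quasi_orthogonal]).

    An entry of the estimator is N^-1 times the quadratic form
    sum K((j - l) / B) x_l y_j in two sequences of scores.  Since K is Lipschitz
    with bounded support, Abel summation over blocks of indices of length about
    B turns the form into a sum of products of linear combinations, and
    quasi-orthogonality bounds its mean absolute value by a constant times N,
    uniformly for 1 <= B <= N ([Ex_lag_quadratic_form]).  The scores may therefore be
    replaced by quasi-orthogonally close sequences: coupling makes them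
    m-dependent, clipping and recentring makes them bounded
    ([score_approximable]).  For bounded m-dependent sequences the variance of
    the form is of order N B ([centred_form_nrm]), which is negligible against
    N^2 because B / N tends to 0.  The mean of the form, divided by N, is an
    average of weighted partial sums of the covariances, whose weights tend to 1
    because B tends to infinity ([weighted_average_cvg]).  Together these give
    convergence in mean ([lag_estimator_L1]), hence in probability.

    The laws of the random functions are known on the cylinder sigma-algebra
    only, whereas a score integrates over time and so depends on uncountably
    many path values.  Stationarity and independence of scores are obtained by
    comparing two families of random paths with the same law: a score computed
    in one and its counterpart in the other are almost surely the same
    measurable functional of the paths ([transfers]), because a time integral is
    an almost sure limit of Monte-Carlo averages at deterministic times that
    serve both families ([transfers_bounded_integral]).  For independence the
    second family lives on a product space, where Fubini's theorem applies
    ([independent_Ex]). *)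

(** * Square-integrable functions on a probability space *)

Section L2_toolkit.
Context {d : measure_display} {T : measurableType d} {R : realType}.
Variable P : probability T R.
Implicit Types F G H : T -> R.

Definition Ex F : R := \int[P]_o F o.
Definition L1 F := P.-integrable setT (EFin \o F).
Definition L2 F := measurable_fun setT F /\ L1 (fun o => F o ^+ 2).
Definition nrm F : R := Num.sqrt (Ex (fun o => F o ^+ 2)).

Lemma L1_meas F : L1 F -> measurable_fun setT F.
Proof. by move=> /measurable_int /measurable_EFinP. Qed.

Lemma eq_Ex F G : (forall o, F o = G o) -> Ex F = Ex G.
Proof. by move=> /funext ->. Qed.

Lemma eq_L1 F G : (forall o, F o = G o) -> L1 F = L1 G.
Proof. by move=> /funext ->. Qed.

Lemma eq_L2 F G : (forall o, F o = G o) -> L2 F = L2 G.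
Proof. by move=> /funext ->. Qed.

Lemma eq_nrm F G : (forall o, F o = G o) -> nrm F = nrm G.
Proof. by move=> /funext ->. Qed.

Lemma L1_dom F G : measurable_fun setT F -> L1 G ->
  (forall o, `|F o| <= G o) -> L1 F.
Proof.
move=> mF iG FG; apply: (le_integrable measurableT _ _ iG).
  exact/measurable_EFinP.
by move=> o _ /=; rewrite lee_fin (le_trans (FG o))// ler_norm.
Qed.

Lemma L1D F G : L1 F -> L1 G -> L1 (fun o => F o + G o).
Proof. by move=> iF iG; exact: (integrableD measurableT iF iG). Qed.

Lemma L1Z c F : L1 F -> L1 (fun o => c * F o).
Proof. by move=> iF; exact: (integrableZl measurableT c iF). Qed.

Lemma L1B F G : L1 F -> L1 G -> L1 (fun o => F o - G o).
Proof. by move=> iF iG; exact: (integrableB measurableT iF iG). Qed.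

Lemma L1cst c : L1 (fun=> c).
Proof. exact: finite_measure_integrable_cst. Qed.

Lemma L1_bounded F c : measurable_fun setT F -> (forall o, `|F o| <= c) -> L1 F.
Proof. by move=> mF Fc; apply: (L1_dom mF (L1cst c)). Qed.

Lemma L1_abs F : L1 F -> L1 (fun o => `|F o|).
Proof. by move=> iF; exact: (integrable_norm iF). Qed.

Lemma L1sum I (s : seq I) (p : pred I) (F : I -> T -> R) :
  (forall i, p i -> L1 (F i)) -> L1 (fun o => \sum_(i <- s | p i) F i o).
Proof.
move=> iF; elim: s => [|i s IH].
  by under eq_L1 do rewrite big_nil; exact: L1cst.
have [pi|pi] := boolP (p i).
  under eq_L1 do rewrite big_cons pi.
  by apply: L1D => //; exact: iF.
by under eq_L1 do rewrite big_cons (negbTE pi).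
Qed.

Lemma ExD F G : L1 F -> L1 G -> Ex (fun o => F o + G o) = Ex F + Ex G.
Proof. by move=> iF iG; exact: RintegralD. Qed.

Lemma ExB F G : L1 F -> L1 G -> Ex (fun o => F o - G o) = Ex F - Ex G.
Proof. by move=> iF iG; exact: RintegralB. Qed.

Lemma ExZ c F : L1 F -> Ex (fun o => c * F o) = c * Ex F.
Proof. by move=> iF; exact: RintegralZl. Qed.

Lemma Excst c : Ex (fun=> c) = c.
Proof.
rewrite /Ex Rintegral_cst// -[RHS]mulr1; congr (_ * _).
by rewrite -[RHS]/(fine 1%E); congr fine; exact: (probability_setT P).
Qed.

Lemma Exsum I (s : seq I) (p : pred I) (F : I -> T -> R) :
  (forall i, p i -> L1 (F i)) ->
  Ex (fun o => \sum_(i <- s | p i) F i o) = \sum_(i <- s | p i) Ex (F i).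
Proof.
move=> iF; elim: s => [|i s IH].
  by under eq_Ex do rewrite big_nil; rewrite Excst big_nil.
rewrite big_cons; have [pi|pi] := boolP (p i).
  under eq_Ex do rewrite big_cons pi.
  by rewrite ExD ?IH//; [exact: iF|exact: L1sum].
by under eq_Ex do rewrite big_cons (negbTE pi).
Qed.

Lemma Ex_ge0 F : (forall o, 0 <= F o) -> 0 <= Ex F.
Proof. by move=> F0; apply: Rintegral_ge0. Qed.

Lemma Ex_le F G : L1 F -> L1 G -> (forall o, F o <= G o) -> Ex F <= Ex G.
Proof. by move=> iF iG FG; apply: le_Rintegral. Qed.

Lemma Ex_abs F : L1 F -> `|Ex F| <= Ex (fun o => `|F o|).
Proof. by move=> iF; exact: le_normr_Rintegral. Qed.

Lemma sqr_normr (a : R) : `|a| ^+ 2 = a ^+ 2.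
Proof. by rewrite -normrX ger0_norm ?sqr_ge0. Qed.

Lemma sqr_le_norm (x a : R) : `|x| <= a -> x ^+ 2 <= a ^+ 2.
Proof. by move=> xa; rewrite -(sqr_normr x); have := normr_ge0 x; nra. Qed.

Lemma mulr_le_sqr (a b : R) : `|a * b| <= a ^+ 2 + b ^+ 2.
Proof.
rewrite normrM -(sqr_normr a) -(sqr_normr b).
have := sqr_ge0 (`|a| - `|b|); have := normr_ge0 a; have := normr_ge0 b; nra.
Qed.

Lemma L2_meas F : L2 F -> measurable_fun setT F. Proof. by case. Qed.

Lemma L2M F G : L2 F -> L2 G -> L1 (fun o => F o * G o).
Proof.
move=> [mF iF] [mG iG]; apply: (L1_dom _ (L1D iF iG)).
  exact: measurable_funM.
by move=> o; exact: mulr_le_sqr.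
Qed.

Lemma L2_L1 F : L2 F -> L1 F.
Proof.
move=> [mF iF]; apply: (L1_dom mF (L1D (L1cst 1) iF)) => o.
by have := mulr_le_sqr 1 (F o); rewrite mul1r expr1n.
Qed.

Lemma L2D F G : L2 F -> L2 G -> L2 (fun o => F o + G o).
Proof.
move=> lF lG; have [mF iF] := lF; have [mG iG] := lG; split.
  exact: measurable_funD.
under eq_L1 do rewrite sqrrD.
apply: L1D => //; apply: L1D => //.
under eq_L1 do rewrite -mulr_natl.
by apply: L1Z; exact: L2M.
Qed.

Lemma L2Z c F : L2 F -> L2 (fun o => c * F o).
Proof.
move=> [mF iF]; split; first exact: measurable_funM.
by under eq_L1 do rewrite exprMn; exact: L1Z.
Qed.

Lemma L2N F : L2 F -> L2 (fun o => - F o).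
Proof. by move=> /(L2Z (-1)); under eq_L2 do rewrite mulN1r. Qed.

Lemma L2B F G : L2 F -> L2 G -> L2 (fun o => F o - G o).
Proof. by move=> lF /L2N lG; exact: L2D. Qed.

Lemma L2_bounded F c : measurable_fun setT F -> (forall o, `|F o| <= c) -> L2 F.
Proof.
move=> mF Fc; split => //; apply: (@L1_bounded _ (c ^+ 2)).
  exact: measurable_funX.
move=> o; rewrite normrX.
have := Fc o; have := normr_ge0 (F o); nra.
Qed.

Lemma L2cst c : L2 (fun=> c).
Proof. exact: (@L2_bounded _ `|c|). Qed.

Lemma L2sum I (s : seq I) (p : pred I) (F : I -> T -> R) :
  (forall i, p i -> L2 (F i)) -> L2 (fun o => \sum_(i <- s | p i) F i o).
Proof.
move=> iF; elim: s => [|i s IH].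
  by under eq_L2 do rewrite big_nil; exact: L2cst.
have [pi|pi] := boolP (p i).
  under eq_L2 do rewrite big_cons pi.
  by apply: L2D => //; exact: iF.
by under eq_L2 do rewrite big_cons (negbTE pi).
Qed.

Lemma nrm_ge0 F : 0 <= nrm F. Proof. exact: sqrtr_ge0. Qed.

Lemma nrm_sqr F : nrm F ^+ 2 = Ex (fun o => F o ^+ 2).
Proof. by rewrite sqr_sqrtr// Ex_ge0// => o; exact: sqr_ge0. Qed.

(** Cauchy-Schwarz: the quadratic [x |-> E (x F + G)^2] has no sign change. *)
Lemma cauchy_schwarz F G : L2 F -> L2 G ->
  Ex (fun o => `|F o * G o|) <= nrm F * nrm G.
Proof.
move=> lF lG.
pose F' o := `|F o|; pose G' o := `|G o|.
have mabs H : L2 H -> L2 (fun o => `|H o|).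
  move=> [mH iH]; split; first exact: measurableT_comp.
  by under eq_L1 do rewrite sqr_normr.
have lF' := mabs _ lF; have lG' := mabs _ lG.
have q x y : 0 <= x ^+ 2 * nrm F ^+ 2 + 2 * (x * y) * Ex (fun o => F' o * G' o)
    + y ^+ 2 * nrm G ^+ 2.
  have e : Ex (fun o => (x * F' o + y * G' o) ^+ 2) =
      x ^+ 2 * nrm F ^+ 2 + 2 * (x * y) * Ex (fun o => F' o * G' o)
    + y ^+ 2 * nrm G ^+ 2.
    rewrite !nrm_sqr -!ExZ; [|exact: (lG.2)|exact: L2M|exact: lF.2].
    rewrite -!ExD; first last.
    - by apply: L1Z; exact: L2M.
    - by apply: L1Z; exact: lF.2.
    - by apply: L1Z; exact: lG.2.
    - by apply: L1D; apply: L1Z; [exact: lF.2|exact: L2M].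
    apply: eq_Ex => o; rewrite /F' /G' -(sqr_normr (F o)) -(sqr_normr (G o)).
    by ring.
  by rewrite -e; apply: Ex_ge0 => o; exact: sqr_ge0.
under eq_Ex do rewrite normrM.
rewrite -/(Ex (fun o => F' o * G' o)).
set e := Ex _ in q *.
have F0 := nrm_ge0 F; have G0 := nrm_ge0 G.
have e0 : 0 <= e by apply: Ex_ge0 => o; apply: mulr_ge0; exact: normr_ge0.
have [FG0|FGn0] := eqVneq (nrm F * nrm G) 0; last first.
  have q1 := q (nrm G) (- nrm F).
  have FG : 0 < nrm F * nrm G by rewrite lt_neqAle eq_sym FGn0 mulr_ge0.
  have : 0 <= 2 * (nrm F * nrm G) * (nrm F * nrm G - e) by nra.
  by rewrite pmulr_rge0 ?subr_ge0// mulr_gt0.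
(* a null norm forces e = 0: let the other coefficient tend to infinity *)
rewrite FG0 leNgt; apply/negP => ep.
move/eqP : FG0; rewrite mulf_eq0 => /orP[]/eqP z.
  have := q (- (nrm G ^+ 2 + 1) / e) 1; rewrite z.
  rewrite (_ : 2 * _ * e = - 2 * (nrm G ^+ 2 + 1)); last by field; lra.
  by nra.
have := q 1 (- (nrm F ^+ 2 + 1) / e); rewrite z.
rewrite (_ : 2 * _ * e = - 2 * (nrm F ^+ 2 + 1)); last by field; lra.
by nra.
Qed.

Lemma cauchy_schwarz_Ex F G : L2 F -> L2 G ->
  `|Ex (fun o => F o * G o)| <= nrm F * nrm G.
Proof.
move=> lF lG; apply: le_trans (cauchy_schwarz lF lG).
exact: (Ex_abs (L2M lF lG)).
Qed.

Lemma nrmD F G : L2 F -> L2 G -> nrm (fun o => F o + G o) <= nrm F + nrm G.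
Proof.
move=> lF lG; rewrite -(@ler_pXn2r _ 2)// ?nnegrE ?nrm_ge0 ?addr_ge0 ?nrm_ge0//.
rewrite sqrrD !nrm_sqr -mulr_natl.
rewrite (_ : Ex _ = Ex (fun o => F o ^+ 2) + 2 * Ex (fun o => F o * G o)
   + Ex (fun o => G o ^+ 2)); last first.
  rewrite -ExZ; last exact: L2M.
  have l := L1Z 2 (L2M lF lG).
  rewrite -ExD//; last exact: lF.2.
  rewrite -ExD//; [|exact: L1D lF.2 l|exact: lG.2].
  by apply: eq_Ex => o; ring.
have := cauchy_schwarz_Ex lF lG; have := ler_norm (Ex (fun o => F o * G o)).
lra.
Qed.

Lemma nrmN F : nrm (fun o => - F o) = nrm F.
Proof. by rewrite /nrm; congr Num.sqrt; apply: eq_Ex => o; rewrite sqrrN. Qed.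

Lemma nrm_le F c : 0 <= c -> Ex (fun o => F o ^+ 2) <= c ^+ 2 -> nrm F <= c.
Proof. by move=> c0 /ler_wsqrtr; rewrite sqrtr_sqr ger0_norm. Qed.

Lemma Ex_abs_le_nrm F : L2 F -> Ex (fun o => `|F o|) <= nrm F.
Proof.
move=> lF; have := cauchy_schwarz lF (L2cst 1).
rewrite {2}/nrm; under [Ex (fun=> 1 ^+ 2)]eq_Ex do rewrite expr1n.
rewrite Excst sqrtr1 mulr1; apply: le_trans.
by under [leRHS]eq_Ex do rewrite mulr1.
Qed.

Lemma Ex_sqr_le (F G : T -> R) c : measurable_fun setT F -> L2 G ->
  (forall o, `|F o| <= c * `|G o|) -> L2 F.
Proof.
move=> mF [mG iG] h; split => //; apply: (L1_dom _ (L1Z (c ^+ 2) iG)).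
  exact: measurable_funX.
move=> o; rewrite normrX -(sqr_normr (G o)) -exprMn.
have := h o; have := normr_ge0 (F o); nra.
Qed.

Lemma L1_integralE F : L1 F -> (\int[P]_o (F o)%:E)%E = (Ex F)%:E.
Proof.
move=> iF; rewrite /Ex /Rintegral fineK//.
exact: (integrable_fin_num measurableT iF).
Qed.

Lemma ge0_L1 F : measurable_fun setT F -> (forall o, 0 <= F o) ->
  (\int[P]_o (F o)%:E < +oo)%E -> L1 F.
Proof.
move=> mF F0 iF; apply/integrableP; split; first exact/measurable_EFinP.
by under eq_integral => o _ do rewrite /= ger0_norm//.
Qed.

Lemma ge0_L1_le F c : measurable_fun setT F -> (forall o, 0 <= F o) ->
  (\int[P]_o (F o)%:E <= c%:E)%E -> L1 F /\ Ex F <= c.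
Proof.
move=> mF F0 iF; have lF : L1 F by apply: ge0_L1 => //; exact: le_lt_trans iF (ltry _).
by split => //; rewrite -lee_fin -L1_integralE.
Qed.

Lemma Ex_dominated_cvg (F : (T -> R)^nat) G H :
  (forall n, measurable_fun setT (F n)) ->
  measurable_fun setT G -> L1 H ->
  (forall o, F n o @[n --> \oo] --> G o) ->
  (forall n o, `|F n o| <= H o) ->
  Ex (F n) @[n --> \oo] --> Ex G.
Proof.
move=> mF mG iH FG FH.
have FGE : {ae P, forall o, setT o ->
    (fun n => (EFin \o F n) o) @ \oo --> (EFin \o G) o}.
  by apply: aeW => o _; apply: cvg_EFin; [exact: nearW|exact: FG].
have [iG _ c] := @dominated_convergence _ T R P setT measurableT
  (fun n => EFin \o F n) (EFin \o G) (EFin \o H)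
  (fun n => (measurable_EFinP _ _).2 (mF n)) ((measurable_EFinP _ _).2 mG)
  FGE iH
  (aeW _ (fun o n _ => FH n o)).
apply: (@fine_cvg _ _ _ _ (fun n => \int[P]_o (F n o)%:E)%E).
by rewrite -L1_integralE.
Qed.

(** Summable second moments force almost sure convergence to zero, because
    the sum of the squares is integrable. *)
Lemma ae_cvg0_summable_nrm (D : (T -> R)^nat) c :
  (forall n, L2 (D n)) ->
  (forall n, \sum_(i < n) Ex (fun o => D i o ^+ 2) <= c) ->
  {ae P, forall o, D n o @[n --> \oo] --> 0}.
Proof.
move=> lD Dc.
have m2 n : measurable_fun setT (fun o => ((D n o) ^+ 2)%:E).
  by apply/measurable_EFinP; apply: measurable_funX; case: (lD n).
have p2 n o : (0 <= ((D n o) ^+ 2)%:E)%E by rewrite lee_fin sqr_ge0.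
have := @integral_nneseries _ T R P setT measurableT (fun n o => ((D n o) ^+ 2)%:E)
  (fun n => m2 n) (fun n o _ => p2 n o).
set S := fun o => _ => intS.
have S0 o : (0 <= S o)%E by apply: nneseries_ge0 => n _ _; exact: p2.
have mS : measurable_fun setT S.
  by apply: ge0_emeasurable_sum => // n o _ _; exact: p2.
have iS : P.-integrable setT S.
  apply/integrableP; split => //.
  under eq_integral => o _ do rewrite gee0_abs//.
  rewrite intS; apply: (@le_lt_trans _ _ c%:E); last exact: ltry.
  apply: lime_le.
    by apply: is_cvg_nneseries => n _ _; apply: integral_ge0 => o _; exact: p2.
  apply: nearW => n; rewrite big_mkord.
  under eq_bigr => i _ do rewrite L1_integralE ?(lD i).2//.
  by rewrite sumEFin lee_fin.
have := integrable_ae measurableT iS.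
apply: filterS => o /(_ Logic.I) So.
have cD : (fun n => D n o ^+ 2) @ \oo --> 0.
  apply: cvg_series_cvg_0; apply: nondecreasing_is_cvgn.
    by apply/nondecreasing_seqP => n; rewrite /series/= big_nat_recr//= lerDl sqr_ge0.
  exists (fine (S o)) => _ [n _ <-]; rewrite -lee_fin fineK// /series/= -sumEFin.
  exact: nneseries_lim_ge.
apply/cvgr0Pnorm_lt => e e0.
have e2 : 0 < e ^+ 2 by rewrite exprn_gt0.
move/cvgr0Pnorm_lt : cD => /(_ _ e2); apply: filterS => n.
by rewrite normrX ltr_pXn2r// nnegrE// ltW.
Qed.

End L2_toolkit.

(** * Quasi-orthogonal sequences and quadratic forms *)

Definition gap (l k : nat) : nat := ((l - k) + (k - l))%N.

Lemma gapC l k : gap l k = gap k l.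
Proof. by rewrite /gap addnC. Qed.

Lemma sum_gap_le {R : realType} (c : nat -> R) (S : R) l n :
  (forall h, 0 <= c h) -> (forall h, \sum_(i < h) c i <= S) ->
  \sum_(k < n) c (gap l k) <= 2 * S.
Proof.
move=> c0 cS.
have lo m : (m <= l.+1)%N -> \sum_(k < m) c (gap l k) <= S.
  move=> ml; apply: le_trans (cS l.+1).
  apply: (@le_trans _ _ (\sum_(k < l.+1) c (gap l k))).
    rewrite -(big_mkord xpredT (fun k => c (gap l k))).
    rewrite -[leRHS](big_mkord xpredT (fun k => c (gap l k))).
    by rewrite [leRHS](big_cat_nat _ (n := m))//= lerDl sumr_ge0.
  rewrite (reindex_inj rev_ord_inj) /=; apply: ler_sum => i _.
  by rewrite /gap subSS subKn ?(leq_ord i)// (eqP (leq_subr _ _)) addn0.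
have [nl|ln] := leqP n l.+1.
  have S0 : 0 <= S by have := cS 0%N; rewrite big_ord0.
  by apply: le_trans (lo _ nl) _; lra.
rewrite -(big_mkord xpredT (fun k => c (gap l k))).
rewrite (big_cat_nat _ (n := l.+1))//=; last exact: ltnW.
rewrite big_mkord mulr_natl mulr2n lerD ?lo//.
rewrite -{1}(add0n l.+1) big_addn big_mkord.
apply: le_trans (cS (n - l.+1).+1); rewrite big_ord_recl /= -[leLHS]add0r lerD//.
apply: ler_sum => i _.
by rewrite (_ : gap l (i + l.+1) = bump 0 i)// /gap /bump /=; lia.
Qed.

Lemma sum_ord_ltn (h M : nat) : (\sum_(i < h) (i < M) = minn h M)%N.
Proof.
elim: h => [|h IH]; first by rewrite big_ord0 min0n.
by rewrite big_ord_recr /= IH; case: ltnP; lia.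
Qed.

Lemma count_gap_lt {R : realType} n i M :
  \sum_(l < n) ((gap i l < M)%N)%:R <= 2 * M%:R :> R.
Proof.
apply: (@sum_gap_le _ (fun h => ((h < M)%N)%:R)) => [h|h]; first exact: ler0n.
by rewrite -natr_sum sum_ord_ltn ler_nat geq_minr.
Qed.

Section quadratic_forms.
Context {R : realType} {d} {T : measurableType d} (P : probability T R).
Implicit Types x y : nat -> T -> R.

(** Quantifies to what extent a sequence behaves as an orthogonal one: every
    linear combination has second moment at most [C ^+ 2] times what it would
    have for an orthonormal sequence. *)
Definition quasi_orthogonal x (C : R) : Prop :=
  [/\ 0 <= C, forall l, L2 P (x l) &
   forall n (w : nat -> R), nrm P (fun o => \sum_(l < n) w l * x l o) <=
     C * Num.sqrt (\sum_(l < n) w l ^+ 2)].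

Lemma Ex_sqr_sum n (x : nat -> T -> R) : (forall l, L2 P (x l)) ->
  Ex P (fun o => (\sum_(l < n) x l o) ^+ 2) =
  \sum_(l < n) \sum_(k < n) Ex P (fun o => x l o * x k o).
Proof.
move=> lx; under eq_Ex => o.
  rewrite expr2 mulr_suml; under eq_bigr => i _ do rewrite mulr_sumr.
  over.
rewrite Exsum; last by move=> l _; apply: L1sum => k _; exact: L2M.
by apply: eq_bigr => l _; rewrite Exsum// => k _; exact: L2M.
Qed.

(** Schur's test: products of weights are bounded by half the sum of their
    squares, and every row of the matrix of covariances has bounded absolute sum. *)
Lemma Ex_sqr_sum_gap_le n x (w c : nat -> R) (S : R) :
  (forall h, 0 <= c h) -> (forall h, \sum_(i < h) c i <= S) ->
  (forall l, L2 P (x l)) ->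
  (forall l k, (l < n)%N -> (k < n)%N ->
     `|Ex P (fun o => x l o * x k o)| <= c (gap l k)) ->
  Ex P (fun o => (\sum_(l < n) w l * x l o) ^+ 2) <=
    2 * S * \sum_(l < n) w l ^+ 2.
Proof.
move=> c0 cS lx xc.
rewrite (Ex_sqr_sum n (x := fun l o => w l * x l o)); last by move=> l; exact: L2Z.
apply: (@le_trans _ _ (\sum_(l < n) \sum_(k < n)
    (2^-1 * (w l ^+ 2 * c (gap l k)) + 2^-1 * (w k ^+ 2 * c (gap k l))))).
  apply: ler_sum => l _; apply: ler_sum => k _.
  under eq_Ex do rewrite mulrACA.
  rewrite ExZ; last exact: L2M.
  apply: le_trans (ler_norm _) _; rewrite normrM (gapC k).
  have := xc _ _ (ltn_ord l) (ltn_ord k); have := c0 (gap l k).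
  set e := `|Ex _ _|; set q := c _ => q0 eq.
  have e0 : 0 <= e by exact: normr_ge0.
  apply: (@le_trans _ _ (`|w l * w k| * q)); first exact: ler_wpM2l.
  rewrite normrM -(sqr_normr (w l)) -(sqr_normr (w k)).
  have := sqr_ge0 (`|w l| - `|w k|); nra.
under eq_bigr do rewrite big_split.
rewrite big_split /= [X in _ + X]exchange_big /= -big_split /=.
rewrite mulr_sumr; apply: ler_sum => l _.
rewrite -!mulr_sumr; have := sum_gap_le l n c0 cS; have := sqr_ge0 (w l).
set q := \sum_(k < n) _; nra.
Qed.

Lemma quasi_orthogonal_gap x (c : nat -> R) (C : R) : 0 <= C ->
  (forall h, 0 <= c h) -> (forall h, \sum_(i < h) c i <= C ^+ 2 / 2) ->
  (forall l, L2 P (x l)) ->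
  (forall l k, `|Ex P (fun o => x l o * x k o)| <= c (gap l k)) ->
  quasi_orthogonal x C.
Proof.
move=> C0 c0 cC lx xc; split => // n w; apply: nrm_le.
  by rewrite mulr_ge0// sqrtr_ge0.
rewrite exprMn sqr_sqrtr ?sumr_ge0//; last by move=> *; exact: sqr_ge0.
rewrite (_ : C ^+ 2 = 2 * (C ^+ 2 / 2)); last by field.
by apply: (@Ex_sqr_sum_gap_le n x w c).
Qed.

Lemma quasi_orthogonalD x y C D : quasi_orthogonal x C -> quasi_orthogonal y D ->
  quasi_orthogonal (fun l o => x l o + y l o) (C + D).
Proof.
move=> [C0 lx xC] [D0 ly yD]; split; first exact: addr_ge0.
  by move=> l; exact: L2D.
move=> n w; rewrite mulrDl.
apply: le_trans (lerD (xC n w) (yD n w)).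
rewrite (@eq_nrm _ _ _ P _ (fun o => \sum_(l < n) w l * x l o + \sum_(l < n) w l * y l o)).
  by apply: nrmD; apply: L2sum => l _; exact: L2Z.
by move=> o; rewrite -big_split; apply: eq_bigr => l _; rewrite mulrDr.
Qed.

Lemma quasi_orthogonal_le x (C D : R) : C <= D ->
  quasi_orthogonal x C -> quasi_orthogonal x D.
Proof.
move=> CD [C0 lx h]; split => //; first exact: le_trans CD.
by move=> n w; apply: le_trans (h n w) _; rewrite ler_wpM2r ?sqrtr_ge0.
Qed.

Lemma quasi_orthogonal_ext x y (C : R) : (forall l o, x l o = y l o) ->
  quasi_orthogonal x C -> quasi_orthogonal y C.
Proof.
by move=> xy; have -> : x = y by apply/funext => l; apply/funext => o.
Qed.

Lemma quasi_orthogonalN x C : quasi_orthogonal x C ->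
  quasi_orthogonal (fun l o => - x l o) C.
Proof.
move=> [C0 lx xC]; split => //; first by move=> l; exact: L2N.
move=> n w; apply: le_trans (xC n w); rewrite -nrmN.
rewrite le_eqVlt; apply/orP; left; apply/eqP/eq_nrm => o.
by rewrite -sumrN; apply: eq_bigr => l _; rewrite mulrN opprK.
Qed.

(** A kernel that is banded and has small increments is, on each block of [s]
    consecutive values of its first argument, a sum of products by Abel
    summation; every factor is then a linear combination controlled by
    quasi-orthogonality. *)
Section abel.
Variables (k : nat -> nat -> R) (a delta : R) (L s : nat).
Hypotheses (a0 : 0 <= a) (delta0 : 0 <= delta) (s0 : (0 < s)%N).
Hypothesis ka : forall l j, `|k l j| <= a.
Hypothesis kdelta : forall l j, `|k l.+1 j - k l j| <= delta.
Hypothesis kband : forall l j, (L < gap l j)%N -> k l j = 0.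

(* [Z i] is the increment of row [i], or the whole row if a block starts there;
   [W i l] tells whether [i] lies in the block of [l] and not after [l]. *)
Let Z i j := if (s %| i)%N then k i j else k i j - k i.-1 j.
Let W i l := ((l %/ s * s <= i) && (i <= l))%N.

Lemma abel_block n l j : (l < n)%N -> k l j = \sum_(i < n) (W i l)%:R * Z i j.
Proof.
move=> ln.
have -> : \sum_(i < n) (W i l)%:R * Z i j =
    \sum_((l %/ s * s)%N <= i < l.+1) Z i j.
  rewrite -(big_mkord xpredT (fun i => (W i l)%:R * Z i j)).
  rewrite [RHS](big_nat_widen _ _ n)//.
  rewrite [RHS](big_nat_widenl _ 0%N)// [RHS]big_mkcond /=.
  apply: eq_bigr => i _; rewrite /W ltnS andbC.
  by case: ifP; rewrite ?mul1r ?mul0r.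
elim: l {ln} => [|l IH]; first by rewrite div0n big_nat1 /Z dvdn0.
have [sl|sl] := boolP (s %| l.+1)%N.
  by rewrite divnK// big_nat1 /Z sl.
have e : (l.+1 %/ s = l %/ s)%N.
  by rewrite divnS // (negbTE sl) add0n.
rewrite e big_nat_recr /=; last by rewrite (leq_trans (leq_divM _ _))//.
by rewrite -IH /Z (negbTE sl) /= addrC subrK.
Qed.

Lemma abel_row_sqr n i :
  \sum_(l < n) (W i l)%:R ^+ 2 <= 2 * s%:R :> R.
Proof.
apply: (@le_trans _ _ (\sum_(l < n) ((gap i l < s)%N)%:R)).
  apply: ler_sum => l _; rewrite /W.
  have [/andP[h1 h2]|_] := boolP (_ && _); last by rewrite expr0n.
  rewrite expr1n (_ : (_ < s)%N = true)//.
  have := ltn_ceil l s0; rewrite /gap; lia.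
exact: count_gap_lt.
Qed.

Lemma abel_col_sqr n i : \sum_(j < n) Z i j ^+ 2 <=
  2 * (L + 2)%:R * (if (s %| i)%N then a else delta) ^+ 2.
Proof.
set q := if _ then _ else _.
apply: (@le_trans _ _ (\sum_(j < n) q ^+ 2 * ((gap i j < L + 2)%N)%:R)); last first.
  by rewrite -mulr_sumr mulrC ler_wpM2r ?sqr_ge0// count_gap_lt.
apply: ler_sum => j _.
have [_|gL] := ltnP; last first.
  rewrite mulr0 /Z !kband; first by rewrite subrr if_same expr0n.
    by move: gL; rewrite /gap; lia.
  by move: gL; rewrite /gap; lia.
rewrite mulr1 -sqr_normr; apply: (@lerXn2r _ 2); rewrite ?nnegrE //.
  by rewrite /q; case: ifP.
rewrite /Z /q; have [si|si] := boolP (s %| i)%N; first exact: ka.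
case: i si {q} => [|i] si; first by rewrite dvdn0 in si.
exact: kdelta.
Qed.

Lemma sum_dvdn_le n : \sum_(i < n) (if (s %| i)%N then a else delta) <=
  (n%:R / s%:R + 1) * a + n%:R * delta.
Proof.
apply: (@le_trans _ _ (\sum_(i < n) (((s %| i)%N)%:R * a + delta))).
  by apply: ler_sum => i _; case: ifP => _; rewrite ?mul1r ?mul0r ?add0r// lerDl.
rewrite big_split /= -mulr_suml sumr_const card_ord -[delta *+ n]mulr_natl lerD2r.
apply: ler_wpM2r => //.
have h : (\sum_(i < n) (s %| i) <= n.-1 %/ s + (0 < n))%N.
  elim: n => [|n IH]; first by rewrite big_ord0.
  rewrite big_ord_recr /=; case: n IH => [|n] IH.
    by rewrite big_ord0 dvdn0 div0n.
  rewrite /= divnS//; move: IH; rewrite /=.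
  by set b := nat_of_bool (s %| n.+1)%N; set q := (n %/ s)%N; lia.
rewrite -natr_sum; apply: (@le_trans _ _ (n.-1 %/ s + (0 < n))%:R).
  by rewrite ler_nat.
rewrite natrD lerD//; last by rewrite lern1; case: (0 < n)%N.
rewrite ler_pdivlMr ?ltr0n// -natrM ler_nat.
by rewrite (leq_trans (leq_divM _ _))// leq_pred.
Qed.

(** After Abel summation the form is a sum over [i] of products of two linear
    combinations, each of which quasi-orthogonality bounds through its weights;
    rows that start a block contribute [a], the other ones only [delta]. *)
Lemma Ex_quadratic_form n x y Cx Cy :
  quasi_orthogonal x Cx -> quasi_orthogonal y Cy ->
  Ex P (fun o => `|\sum_(l < n) \sum_(j < n) k l j * (x l o * y j o)|) <=
  Cx * Cy * Num.sqrt (2 * s%:R) * Num.sqrt (2 * (L + 2)%:R) *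
    ((n%:R / s%:R + 1) * a + n%:R * delta).
Proof.
move=> [Cx0 lx xC] [Cy0 ly yC].
pose X i o := \sum_(l < n) (W i l)%:R * x l o.
pose Y i o := \sum_(j < n) Z i j * y j o.
have lX i : L2 P (X i) by apply: L2sum => l _; exact: L2Z.
have lY i : L2 P (Y i) by apply: L2sum => l _; exact: L2Z.
have e o : \sum_(l < n) \sum_(j < n) k l j * (x l o * y j o) =
    \sum_(i < n) X i o * Y i o.
  under eq_bigr => l _ do under eq_bigr => j _ do
    rewrite (abel_block j (ltn_ord l)) mulr_suml.
  under eq_bigr => l _ do rewrite exchange_big /=.
  rewrite exchange_big /=; apply: eq_bigr => i _.
  rewrite mulr_suml; apply: eq_bigr => l _; rewrite mulr_sumr.
  by apply: eq_bigr => j _; rewrite mulrACA.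
under eq_Ex do rewrite e.
have lXY i : L1 P (fun o => X i o * Y i o) by exact: L2M.
apply: (@le_trans _ _ (Ex P (fun o => \sum_(i < n) `|X i o * Y i o|))).
  apply: Ex_le.
  - by apply: L1_abs; apply: L1sum => i _.
  - by apply: L1sum => i _; exact: L1_abs.
  by move=> o; exact: ler_norm_sum.
rewrite Exsum; last by move=> i _; exact: L1_abs.
apply: (@le_trans _ _ (\sum_(i < n) Cx * Cy * Num.sqrt (2 * s%:R) *
  Num.sqrt (2 * (L + 2)%:R) * (if (s %| i)%N then a else delta))); last first.
  rewrite -mulr_sumr; apply: ler_wpM2l; last exact: sum_dvdn_le.
  by rewrite !mulr_ge0// sqrtr_ge0.
apply: ler_sum => i _; apply: le_trans (cauchy_schwarz (lX i) (lY i)) _.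
have hX : nrm P (X i) <= Cx * Num.sqrt (2 * s%:R).
  apply: le_trans (xC n (fun l => (W i l)%:R)) _.
  by rewrite ler_wpM2l// ler_wsqrtr// abel_row_sqr.
have hY : nrm P (Y i) <= Cy * (Num.sqrt (2 * (L + 2)%:R) * (if (s %| i)%N then a else delta)).
  apply: le_trans (yC n (Z i)) _; rewrite ler_wpM2l//.
  apply: le_trans (ler_wsqrtr (abel_col_sqr n i)) _.
  have q0 : 0 <= (if (s %| i)%N then a else delta) by case: ifP.
  have L0 : 0 <= 2 * (L + 2)%:R :> R by rewrite mulr_ge0.
  by rewrite (sqrtrM _ L0) sqrtr_sqr ger0_norm.
apply: le_trans (ler_pM (nrm_ge0 _ _) (nrm_ge0 _ _) hX hY) _.
rewrite le_eqVlt; apply/orP; left; apply/eqP; ring.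
Qed.

End abel.
End quadratic_forms.

(** * Bounded sequences of finite range *)

Section finite_range.
Context {R : realType} {d} {T : measurableType d} (P : probability T R).

(** Up to products of four variables, members whose indices differ by at least
    [m] behave as independent centred ones. *)
Record finite_range (m : nat) (D : R) (z : bool -> nat -> T -> R) : Prop := {
  finite_range_gt0 : (0 < m)%N;
  finite_range_meas : forall b l, measurable_fun setT (z b l);
  finite_range_bounded : forall b l o, `|z b l o| <= D;
  finite_range_uncorrelated : forall b b' l l', (l + m <= l')%N ->
    Ex P (fun o => z b l o * z b' l' o) = 0;
  finite_range_last : forall b1 b2 b3 b4 l1 l2 l3 l4,
    (l1 + m <= l4)%N -> (l2 + m <= l4)%N -> (l3 + m <= l4)%N ->
    Ex P (fun o => (z b1 l1 o * z b2 l2 o) * (z b3 l3 o * z b4 l4 o)) = 0;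
  finite_range_pairs : forall b1 b2 b3 b4 l1 l2 l3 l4,
    (l1 + m <= l3)%N -> (l1 + m <= l4)%N -> (l2 + m <= l3)%N -> (l2 + m <= l4)%N ->
    Ex P (fun o => (z b1 l1 o * z b2 l2 o) * (z b3 l3 o * z b4 l4 o)) =
    Ex P (fun o => z b1 l1 o * z b2 l2 o) * Ex P (fun o => z b3 l3 o * z b4 l4 o) }.

Variables (m : nat) (D : R) (z : bool -> nat -> T -> R).
Hypothesis frz : finite_range m D z.

Let m0 := finite_range_gt0 frz.
Let mz := finite_range_meas frz.
Let zD := finite_range_bounded frz.

Let T0 : exists o : T, True.
Proof.
apply: contrapT => no.
have : (P setT = P set0)%E.
  by congr (P _); apply/seteqP; split => // o _; apply: no; exists o.
by rewrite measure0 probability_setT => /eqP; rewrite eqe oner_eq0.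
Qed.

Let D0 : 0 <= D.
Proof. by have [x _] := T0; exact: le_trans (normr_ge0 _) (zD true 0%N x). Qed.

Let L2z b l : L2 P (z b l).
Proof. by apply: (@L2_bounded _ _ _ P _ D); [exact: mz|exact: zD]. Qed.

Let zzD b l b' l' o : `|z b l o * z b' l' o| <= D ^+ 2.
Proof. by rewrite normrM expr2 ler_pM. Qed.

Let mzz b l b' l' : measurable_fun setT (fun o => z b l o * z b' l' o).
Proof. by apply: measurable_funM; exact: mz. Qed.

Let L2zz b l b' l' : L2 P (fun o => z b l o * z b' l' o).
Proof. exact: (L2_bounded P (mzz _ _ _ _) (zzD _ _ _ _)). Qed.

Section far.
Variables (k : nat -> nat -> R) (a C : R) (L n : nat) (b b' : bool).
Hypotheses (a0 : 0 <= a) (ka : forall l j, `|k l j| <= a).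
Hypothesis kband : forall l j, (L < gap l j)%N -> k l j = 0.
Hypothesis qz : quasi_orthogonal P (z b) C.

Let w j l := (l + m <= j)%N%:R * k l j.
Let V j o := \sum_(l < n) w j l * z b l o.

Let nrmV j : nrm P (V j) <= C * (Num.sqrt (2 * L.+1%:R) * a).
Proof.
have [C0 _ qC] := qz; apply: le_trans (qC n (w j)) _; rewrite ler_wpM2l//.
have -> : Num.sqrt (2 * L.+1%:R) * a = Num.sqrt (2 * L.+1%:R * a ^+ 2) :> R.
  have L0 : 0 <= 2 * L.+1%:R :> R by rewrite mulr_ge0.
  by rewrite (sqrtrM _ L0) sqrtr_sqr ger0_norm.
apply: ler_wsqrtr.
apply: (@le_trans _ _ (\sum_(l < n) ((gap j l < L.+1)%N)%:R * a ^+ 2)).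
  apply: ler_sum => l _; rewrite /w.
  have [gL|gL] := ltnP; last first.
    by rewrite kband ?mulr0 ?expr0n ?mul0r// gapC.
  rewrite mul1r exprMn -[leRHS]mul1r ler_pM ?sqr_ge0//.
    by case: (_ <= _)%N; rewrite ?expr1n ?expr0n.
  exact: sqr_le_norm.
by rewrite -mulr_suml ler_wpM2r ?sqr_ge0// count_gap_lt.
Qed.

Let L2V j : L2 P (V j).
Proof. by apply: L2sum => l _; apply: L2Z. Qed.

Let mV j : measurable_fun setT (V j). Proof. exact: L2_meas (L2V j). Qed.

Let L2c j : L2 P (fun o => z b' j o * V j o).
Proof.
apply: (Ex_sqr_le (c := D) _ (L2V j)); first exact: measurable_funM.
by move=> o; rewrite normrM ler_wpM2r.
Qed.

Let nrmc j : nrm P (fun o => z b' j o * V j o) <=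
  D * (C * (Num.sqrt (2 * L.+1%:R) * a)).
Proof.
have C0 : 0 <= C by case: qz.
apply: (@le_trans _ _ (D * nrm P (V j))); last by rewrite ler_wpM2l.
apply: nrm_le; first by rewrite mulr_ge0// nrm_ge0.
rewrite exprMn nrm_sqr -ExZ; last exact: (L2V j).2.
apply: Ex_le; [exact: (L2c j).2|exact: L1Z (L2V j).2|] => o.
by rewrite exprMn ler_wpM2r ?sqr_ge0//; exact: sqr_le_norm.
Qed.

Let c_ortho j j' : (j + m <= j')%N ->
  Ex P (fun o => (z b' j o * V j o) * (z b' j' o * V j' o)) = 0.
Proof.
move=> jj'.
rewrite (@eq_Ex _ _ _ P _ (fun o => \sum_(l1 < n) \sum_(l2 < n)
    w j l1 * w j' l2 * ((z b' j o * z b l1 o) * (z b l2 o * z b' j' o)))); last first.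
  move=> o; rewrite mulrACA /V mulr_suml mulr_sumr; apply: eq_bigr => l1 _.
  by rewrite 2!mulr_sumr; apply: eq_bigr => l2 _; ring.
have l4 l1 l2 : L1 P (fun o => (z b' j o * z b l1 o) * (z b l2 o * z b' j' o)).
  exact: L2M.
rewrite Exsum; last by move=> l1 _; apply: L1sum => l2 _; apply: L1Z.
rewrite big1// => l1 _; rewrite Exsum; last by move=> l2 _; apply: L1Z.
rewrite big1// => l2 _; rewrite ExZ// /w.
have [h1|_] := boolP (l1 + m <= j)%N; last by rewrite !mul0r.
have [h2|_] := boolP (l2 + m <= j')%N; last by rewrite mul0r mulr0 mul0r.
rewrite (finite_range_last frz) ?mulr0//.
by rewrite (leq_trans h1)// (leq_trans _ jj')// leq_addr.
Qed.

(** Products of a variable with its distant past are orthogonal as soon as the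
    later factor lies [m] steps after everything else, as for martingale
    differences. *)
Lemma far_part_sqr :
  Ex P (fun o => (\sum_(j < n) \sum_(l < n)
    (l + m <= j)%N%:R * k l j * (z b l o * z b' j o)) ^+ 2) <=
  2 * (m%:R * (D * (C * (Num.sqrt (2 * L.+1%:R) * a))) ^+ 2) * n%:R.
Proof.
set Q := D * _.
have C0 : 0 <= C by case: qz.
have Q0 : 0 <= Q by rewrite !mulr_ge0// sqrtr_ge0.
have -> : (n%:R : R) = \sum_(j < n) 1 ^+ 2.
  by under eq_bigr do rewrite expr1n; rewrite sumr_const card_ord.
under eq_Ex => o.
  under eq_bigr => j _.
    rewrite (_ : \sum_(l < n) _ = 1 * (z b' j o * V j o)); last first.
      by rewrite mul1r /V mulr_sumr; apply: eq_bigr => l _; rewrite /w; ring.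
    over.
  over.
apply: (@Ex_sqr_sum_gap_le _ _ _ P n (fun j o => z b' j o * V j o) (fun=> 1)
  (fun h => ((h < m)%N)%:R * Q ^+ 2)) => //.
- by move=> h; rewrite mulr_ge0 ?sqr_ge0.
- move=> h; rewrite -mulr_suml ler_wpM2r ?sqr_ge0//.
  by rewrite -natr_sum sum_ord_ltn ler_nat geq_minr.
move=> i j _ _; have [_|gm] := ltnP.
  rewrite mul1r; apply: le_trans (cauchy_schwarz_Ex (L2c i) (L2c j)) _.
  by rewrite expr2 ler_pM ?nrm_ge0//; exact: nrmc.
have [ij|ji] := leqP i j.
  by rewrite c_ortho ?normr0 ?mul0r//; move: gm; rewrite /gap; lia.
under eq_Ex do rewrite mulrC.
by rewrite c_ortho ?normr0 ?mul0r//; move: gm; rewrite /gap; lia.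
Qed.

End far.

Section near.
Variables (k : nat -> nat -> R) (a : R) (n : nat) (b b' : bool).
Hypotheses (a0 : 0 <= a) (ka : forall l j, `|k l j| <= a).

Let cz l j o := z b l o * z b' j o - Ex P (fun o => z b l o * z b' j o).
Let V j o := \sum_(l < n) ((gap j l < m)%N)%:R * k l j * cz l j o.

Let czD l j o : `|cz l j o| <= 2 * D ^+ 2.
Proof.
apply: le_trans (ler_normB _ _) _; rewrite mulr_natl mulr2n lerD//.
apply: le_trans (Ex_abs (L2_L1 (L2zz _ _ _ _))) _.
rewrite -[leRHS](Excst P); apply: Ex_le => //; last exact: L1cst.
by apply: L1_abs; exact: L2_L1.
Qed.

Let L2cz l j : L2 P (cz l j).
Proof. by apply: L2B => //; exact: L2cst. Qed.

Let VD j o : `|V j o| <= 2 * m%:R * (a * (2 * D ^+ 2)).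
Proof.
apply: (@le_trans _ _ (\sum_(l < n) ((gap j l < m)%N)%:R * (a * (2 * D ^+ 2)))).
  apply: le_trans (ler_norm_sum _ _ _) _; apply: ler_sum => l _.
  rewrite -mulrA normrM ger0_norm// ler_wpM2l// normrM ler_pM//.
by rewrite -mulr_suml ler_wpM2r ?count_gap_lt// !mulr_ge0// sqr_ge0.
Qed.

Let L2V j : L2 P (V j).
Proof. by apply: L2sum => l _; apply: L2Z. Qed.

Let V_ortho j j' : (j + 3 * m <= j')%N -> Ex P (fun o => V j o * V j' o) = 0.
Proof.
move=> jj'.
rewrite (@eq_Ex _ _ _ P _ (fun o => \sum_(l1 < n) \sum_(l2 < n)
    (((gap j l1 < m)%N)%:R * k l1 j * (((gap j' l2 < m)%N)%:R * k l2 j')) *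
    (cz l1 j o * cz l2 j' o))); last first.
  move=> o; rewrite /V mulr_suml; apply: eq_bigr => l1 _.
  by rewrite mulr_sumr; apply: eq_bigr => l2 _; ring.
have l4 l1 l2 : L1 P (fun o => cz l1 j o * cz l2 j' o) by exact: L2M.
rewrite Exsum; last by move=> l1 _; apply: L1sum => l2 _; apply: L1Z.
rewrite big1// => l1 _; rewrite Exsum; last by move=> l2 _; apply: L1Z.
rewrite big1// => l2 _; rewrite ExZ//.
have [h1|_] := boolP (gap j l1 < m)%N; last by rewrite !mul0r.
have [h2|_] := boolP (gap j' l2 < m)%N; last by rewrite mul0r mulr0 mul0r.
have -> : Ex P (fun o => cz l1 j o * cz l2 j' o) = 0; last by rewrite mulr0.
pose e1 := Ex P (fun o => z b l1 o * z b' j o).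
pose e2 := Ex P (fun o => z b l2 o * z b' j' o).
rewrite (@eq_Ex _ _ _ P _ (fun o => (z b l1 o * z b' j o) * (z b l2 o * z b' j' o) -
    (e2 * (z b l1 o * z b' j o) + e1 * (z b l2 o * z b' j' o - e2)))); last first.
  by move=> o; rewrite /cz -/e1 -/e2; ring.
have le2 : L1 P (fun o => z b l2 o * z b' j' o - e2).
  by apply: L1B; [exact: L2_L1|exact: L1cst].
rewrite ExB; first last.
- by apply: L1D; apply: L1Z => //; exact: L2_L1.
- exact: L2M.
rewrite ExD; first last.
- exact: L1Z.
- by apply: L1Z; exact: L2_L1.
rewrite !ExZ//; last exact: L2_L1.
rewrite ExB; first last.
- exact: L1cst.
- exact: L2_L1.
rewrite Excst subrr mulr0 addr0 (finite_range_pairs frz) ?[e2 * _]mulrC ?subrr//;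
by move: h1 h2 jj'; rewrite /gap; lia.
Qed.

(** [V j] is centred and depends only on the members within [m] of [j], so that
    it is uncorrelated with [V j'] for [j'] at distance at least [3 * m]. *)
Lemma near_part_sqr :
  Ex P (fun o => (\sum_(j < n) V j o) ^+ 2) <=
  2 * ((3 * m)%:R * (2 * m%:R * (a * (2 * D ^+ 2))) ^+ 2) * n%:R.
Proof.
set Q := 2 * m%:R * _.
have Q0 : 0 <= Q by rewrite !mulr_ge0// sqr_ge0.
have -> : (n%:R : R) = \sum_(j < n) 1 ^+ 2.
  by under eq_bigr do rewrite expr1n; rewrite sumr_const card_ord.
under eq_Ex => o.
  under eq_bigr => j _ do rewrite -[V j o]mul1r.
  over.
have nV j : nrm P (V j) <= Q.
  apply: nrm_le => //; rewrite -[leRHS](Excst P).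
  apply: Ex_le; [exact: (L2V j).2|exact: L1cst|] => o.
  exact: sqr_le_norm.
apply: (@Ex_sqr_sum_gap_le _ _ _ P n V (fun=> 1)
  (fun h => ((h < 3 * m)%N)%:R * Q ^+ 2)) => //.
- by move=> h; rewrite mulr_ge0 ?sqr_ge0.
- move=> h; rewrite -mulr_suml ler_wpM2r ?sqr_ge0//.
  by rewrite -natr_sum sum_ord_ltn ler_nat geq_minr.
move=> i j _ _; have [_|gm] := ltnP.
  rewrite mul1r; apply: le_trans (cauchy_schwarz_Ex (L2V i) (L2V j)) _.
  by rewrite expr2 ler_pM ?nrm_ge0.
have [ij|ji] := leqP i j.
  by rewrite V_ortho ?normr0 ?mul0r//; move: gm; rewrite /gap; lia.
under eq_Ex do rewrite mulrC.
by rewrite V_ortho ?normr0 ?mul0r//; move: gm; rewrite /gap; lia.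
Qed.

End near.

End finite_range.

Section centred_form.
Context {R : realType} {d} {T : measurableType d} (P : probability T R).
Variables (m : nat) (D C a : R) (z : bool -> nat -> T -> R).
Hypotheses (frz : finite_range P m D z) (qz : forall b, quasi_orthogonal P (z b) C).
Variables (k : nat -> nat -> R) (L n : nat).
Hypotheses (a0 : 0 <= a) (ka : forall l j, `|k l j| <= a).
Hypothesis kband : forall l j, (L < gap l j)%N -> k l j = 0.

Definition centred_form_bound : R :=
  2 * Num.sqrt (4 * m%:R * (D * C * a) ^+ 2) +
  Num.sqrt (2 * (3 * m)%:R * (2 * m%:R * (a * (2 * D ^+ 2))) ^+ 2).

Let form o := \sum_(l < n) \sum_(j < n) k l j * (z true l o * z false j o).

Let L2z b l : L2 P (z b l). Proof. by case: (qz b) => _ lz _; exact: lz. Qed.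

Let L1zz b l b' j : L1 P (fun o => z b l o * z b' j o). Proof. exact: L2M. Qed.

Let L2zz b l b' j : L2 P (fun o => z b l o * z b' j o).
Proof.
apply: (Ex_sqr_le (c := D) _ (L2z b' j)).
  by apply: measurable_funM; exact: (L2_meas (L2z _ _)).
by move=> o; rewrite normrM ler_wpM2r// (finite_range_bounded frz).
Qed.

Lemma L2_form : L2 P form.
Proof. by apply: L2sum => l _; apply: L2sum => j _; apply: L2Z. Qed.

Lemma Ex_form : Ex P form = \sum_(l < n) \sum_(j < n)
  k l j * Ex P (fun o => z true l o * z false j o).
Proof.
rewrite Exsum; last by move=> l _; apply: L1sum => j _; apply: L1Z.
apply: eq_bigr => l _; rewrite Exsum; last by move=> j _; apply: L1Z.
by apply: eq_bigr => j _; rewrite ExZ.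
Qed.

(** The variance of a banded quadratic form grows like the number of its
    nonzero coefficients, not like the square of the band width. *)
Lemma centred_form_nrm : nrm P (fun o => form o - Ex P form) <=
  centred_form_bound * Num.sqrt (L.+1%:R * n%:R).
Proof.
(* [F1] and [F2] collect the pairs of indices at distance at least [m], whose
   products are centred, on either side of the diagonal; [F3] is the rest. *)
pose F1 o := \sum_(j < n) \sum_(l < n)
  (l + m <= j)%N%:R * k l j * (z true l o * z false j o).
pose F2 o := \sum_(l < n) \sum_(j < n)
  (j + m <= l)%N%:R * k l j * (z false j o * z true l o).
pose F3 o := \sum_(j < n) \sum_(l < n) ((gap j l < m)%N)%:R * k l j *
  (z true l o * z false j o - Ex P (fun o => z true l o * z false j o)).
have e o : form o - Ex P form = F1 o + F2 o + F3 o.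
  have -> : F1 o = \sum_(l < n) \sum_(j < n)
      (l + m <= j)%N%:R * k l j * (z true l o * z false j o) by exact: exchange_big.
  have -> : F3 o = \sum_(l < n) \sum_(j < n) ((gap j l < m)%N)%:R * k l j *
      (z true l o * z false j o - Ex P (fun o => z true l o * z false j o)).
    exact: exchange_big.
  rewrite Ex_form.
  rewrite -!big_split -sumrB; apply: eq_bigr => l _.
  rewrite -!big_split -sumrB; apply: eq_bigr => j _ /=.
  have m0 := finite_range_gt0 frz; have unc := finite_range_uncorrelated frz.
  have [lj|lj] := boolP (l + m <= j)%N.
    have -> : (gap j l < m)%N = false by rewrite /gap; lia.
    have -> : (j + m <= l)%N = false by lia.
    by rewrite unc// /= ?mulr0n ?mulr1n; ring.
  have [jl|jl] := boolP (j + m <= l)%N.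
    have -> : (gap j l < m)%N = false by rewrite /gap; lia.
    have -> : Ex P (fun o => z true l o * z false j o) = 0.
      by under eq_Ex do rewrite mulrC; exact: unc.
    by rewrite /= ?mulr0n ?mulr1n; ring.
  have -> : (gap j l < m)%N = true by rewrite /gap; lia.
  by rewrite /= ?mulr0n ?mulr1n; ring.
rewrite (eq_nrm P e).
have lF1 : L2 P F1 by apply: L2sum => j _; apply: L2sum => l _; apply: L2Z.
have lF2 : L2 P F2 by apply: L2sum => j _; apply: L2sum => l _; apply: L2Z.
have lF3 : L2 P F3.
  apply: L2sum => j _; apply: L2sum => l _; apply: L2Z.
  by apply: L2B => //; exact: L2cst.
apply: le_trans (nrmD (L2D lF1 lF2) lF3) _.
apply: le_trans (lerD (nrmD lF1 lF2) (lexx _)) _.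
have C0 : 0 <= C by case: (qz true).
have L0 : 0 <= 2 * L.+1%:R :> R by rewrite mulr_ge0.
have far_le : Num.sqrt (2 * (m%:R * (D * (C * (Num.sqrt (2 * L.+1%:R) * a))) ^+ 2) * n%:R)
    = Num.sqrt (4 * m%:R * (D * C * a) ^+ 2) * Num.sqrt (L.+1%:R * n%:R) :> R.
  rewrite -sqrtrM; last by apply: mulr_ge0; [exact: mulr_ge0|exact: sqr_ge0].
  congr Num.sqrt; rewrite !exprMn sqr_sqrtr//; ring.
have near_le : Num.sqrt (2 * ((3 * m)%:R * (2 * m%:R * (a * (2 * D ^+ 2))) ^+ 2) * n%:R)
    <= Num.sqrt (2 * (3 * m)%:R * (2 * m%:R * (a * (2 * D ^+ 2))) ^+ 2) *
       Num.sqrt (L.+1%:R * n%:R) :> R.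
  have p0 : 0 <= 2 * (3 * m)%:R * (2 * m%:R * (a * (2 * D ^+ 2))) ^+ 2 :> R.
    by apply: mulr_ge0; [exact: mulr_ge0|exact: sqr_ge0].
  rewrite -(sqrtrM _ p0); apply: ler_wsqrtr; rewrite !mulrA in p0 *.
  apply: ler_wpM2r => //; rewrite -[leLHS]mulr1 ler_wpM2l//.
  by rewrite ler1n.
rewrite /centred_form_bound mulrDl; apply: lerD.
  have dbl (A B : R) : 2 * A * B = A * B + A * B by ring.
  rewrite dbl; apply: lerD; rewrite -far_le; apply: ler_wsqrtr.
    exact: (far_part_sqr frz n false a0 ka kband (qz true)).
  apply: (@far_part_sqr _ _ _ P _ _ _ frz (fun l j => k j l)) => //.
  by move=> l j; rewrite gapC; exact: kband.
apply: le_trans near_le; apply: ler_wsqrtr.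
exact: (near_part_sqr frz n true false a0 ka).
Qed.

End centred_form.

(** * Forms weighted by a smoothing kernel *)

Section smoothing_kernel.
Context {R : realType}.
Variables (K : R -> R) (Lam a M : R).
Hypotheses (Lam0 : 0 <= Lam) (a0 : 0 <= a) (M0 : 0 <= M).
Hypothesis KLam : forall x y, `|K x - K y| <= Lam * `|x - y|.
Hypothesis Ka : forall x, `|K x| <= a.
Hypothesis KM : forall x, M < `|x| -> K x = 0.

Definition lag_weight (beta : R) (l j : nat) : R := K ((j%:R - l%:R) / beta).

Lemma norm_gap (l j : nat) : `|j%:R - l%:R| = (gap l j)%:R :> R.
Proof.
rewrite /gap; have [lj|jl] := leqP l j.
  by rewrite (eqP lj) add0n -natrB// ger0_norm.
have -> : (j - l = 0)%N by lia.
by rewrite addn0 distrC -natrB ?(ltnW jl)// ger0_norm.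
Qed.

Section one_bandwidth.
Variable beta : R.
Hypothesis beta1 : 1 <= beta.

Let beta0 : 0 < beta. Proof. exact: lt_le_trans beta1. Qed.

Lemma lag_weight_band l j : (Num.truncn (M * beta) < gap l j)%N ->
  lag_weight beta l j = 0.
Proof.
move=> h; apply: KM; rewrite normrM normfV (gtr0_norm beta0) norm_gap.
rewrite ltr_pdivlMr//; apply: (lt_le_trans (truncnS_gt _)).
by rewrite ler_nat.
Qed.

Lemma lag_weight_increment l j :
  `|lag_weight beta l.+1 j - lag_weight beta l j| <= Lam / beta.
Proof.
apply: le_trans (KLam _ _) _; rewrite -mulrBl normrM normfV (gtr0_norm beta0).
rewrite (_ : `|_ - _| = 1) ?mul1r//.
by rewrite -natr1 (_ : _ - _ = -1) ?normrN1//; ring.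
Qed.

Definition quadratic_constant : R := Num.sqrt (8 * (M + 2)) * (2 * a + Lam).

(** Blocks as long as the bandwidth make the bandwidth cancel out: there are
    about [n / beta] of them, and within a block the weights vary by at most
    [Lam / beta] from one index to the next. *)
Lemma Ex_lag_quadratic_form d (T : measurableType d) (P : probability T R) n x y Cx Cy :
  quasi_orthogonal P x Cx -> quasi_orthogonal P y Cy -> beta <= n%:R ->
  Ex P (fun o => `|\sum_(l < n) \sum_(j < n) lag_weight beta l j * (x l o * y j o)|) <=
  n%:R * (quadratic_constant * Cx * Cy).
Proof.
move=> qx qy bn.
have C0 : 0 <= Cx * Cy by case: qx; case: qy => ? _ _ ? _ _; exact: mulr_ge0.
set s := (Num.truncn beta).+1; set L := Num.truncn (M * beta).
have n0 : 0 < n%:R :> R by exact: lt_le_trans bn.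
have sb : beta <= s%:R by rewrite ltW// truncnS_gt.
have s2 : s%:R <= 2 * beta.
  have : (Num.truncn beta)%:R <= beta by rewrite truncn_le ltW.
  by rewrite /s -natr1; move: beta1; lra.
have L2 : (L + 2)%:R <= (M + 2) * beta.
  have : L%:R <= M * beta by rewrite /L truncn_le mulr_ge0// ltW.
  by rewrite natrD mulrDl; move: beta1; lra.
have := @Ex_quadratic_form _ _ _ P (lag_weight beta) a (Lam / beta) L s a0
  (divr_ge0 Lam0 (ltW beta0)) isT (fun l j => Ka _) lag_weight_increment lag_weight_band
  n x y Cx Cy qx qy.
move=> /le_trans; apply.
have h1 : Num.sqrt (2 * s%:R) * Num.sqrt (2 * (L + 2)%:R) <=
    beta * Num.sqrt (8 * (M + 2)).
  rewrite -sqrtrM ?mulr_ge0//.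
  have -> : beta * Num.sqrt (8 * (M + 2)) = Num.sqrt (beta ^+ 2 * (8 * (M + 2))).
    by rewrite [RHS]sqrtrM ?sqr_ge0// sqrtr_sqr gtr0_norm.
  apply: ler_wsqrtr.
  have : s%:R * (L + 2)%:R <= 2 * beta * ((M + 2) * beta) by apply: ler_pM.
  by move=> h; nra.
have h2 : (n%:R / s%:R + 1) * a + n%:R * (Lam / beta) <= n%:R / beta * (2 * a + Lam).
  have i1 : n%:R / s%:R <= n%:R / beta.
    apply: ler_wpM2l; first exact: ltW.
    by rewrite lef_pV2 ?posrE// (lt_le_trans beta0).
  have i2 : 1 <= n%:R / beta by rewrite ler_pdivlMr// mul1r.
  rewrite (_ : n%:R * (Lam / beta) = n%:R / beta * Lam); last by ring.
  rewrite mulrDr lerD2r (_ : _ * (2 * a) = (n%:R / beta + n%:R / beta) * a); last by ring.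
  by rewrite ler_wpM2r// lerD.
have := ler_pM (mulr_ge0 (sqrtr_ge0 _) (sqrtr_ge0 _)) _ h1 h2.
have pos : 0 <= (n%:R / s%:R + 1) * a + n%:R * (Lam / beta).
  by rewrite addr_ge0 ?mulr_ge0 ?addr_ge0 ?invr_ge0 ?ler0n// ltW.
move=> /(_ pos) h.
have -> : n%:R * (quadratic_constant * Cx * Cy) = Cx * Cy *
   (beta * Num.sqrt (8 * (M + 2)) * (n%:R / beta * (2 * a + Lam))).
  by rewrite /quadratic_constant; field; rewrite gt_eqF.
rewrite -mulrA -mulrA; apply: le_trans (ler_wpM2l C0 h).
by rewrite !mulrA.
Qed.

End one_bandwidth.
End smoothing_kernel.

(** * Weighted averages of partial sums *)

Section weighted_sums.
Context {R : realType}.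
Variables (r : nat -> R) (S sigma : R).
Hypothesis rS : forall n, \sum_(h < n) `|r h| <= S.
Hypothesis rsigma : \sum_(h < n) r h @[n --> \oo] --> sigma.

Let S0 : 0 <= S. Proof. by have := rS 0%N; rewrite big_ord0. Qed.

Lemma summable_tail e : 0 < e -> exists H, forall n,
  \sum_(h < n) ((H <= h)%N)%:R * `|r h| <= e.
Proof.
move=> e0; pose s n := \sum_(h < n) `|r h|.
have s_nd : {homo s : m n / (m <= n)%N >-> m <= n}.
  apply/nondecreasing_seqP => n.
  by rewrite /s big_ord_recr /= lerDl.
have s_ub : has_ubound (range s) by exists S => _ [n _ <-]; exact: rS.
have sl := nondecreasing_cvgn s_nd s_ub.
have [H _ Hs] := (@cvgrPdist_le _ _ _ _ _ _ _).1 sl e e0.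
exists H => n; have [nH|Hn] := leqP n H.
  rewrite big1 ?ltW// => h _.
  by rewrite leqNgt (leq_trans (ltn_ord h) nH) mul0r.
have -> : \sum_(h < n) ((H <= h)%N)%:R * `|r h| = s n - s H.
  rewrite /s -(big_mkord xpredT (fun h => ((H <= h)%N)%:R * `|r h|)).
  rewrite -!(big_mkord xpredT (fun h => `|r h|)).
  rewrite !(@big_cat_nat _ _ _ H 0 n)//= ?(ltnW Hn)//.
  rewrite big_nat big1 => [|h /andP[_ hH]]; last by rewrite leqNgt hH mul0r.
  rewrite add0r [RHS]addrAC subrr add0r [LHS]big_nat [RHS]big_nat.
  by apply: eq_bigr => h /andP[-> _]; rewrite mul1r.
have := Hs H (leqnn H); have := Hs n (ltnW Hn) => /=.
have sup n' : s n' <= sup (range s) by apply: ub_le_sup => //; exists n'.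
have := sup H; have := sup n.
move=> h1 h2; rewrite !ger0_norm ?subr_ge0// => h3 h4; lra.
Qed.

Lemma partial_sum_bounded n : `|\sum_(h < n) r h - sigma| <= 2 * S.
Proof.
have sS n' : `|\sum_(h < n') r h| <= S by apply: le_trans (ler_norm_sum _ _ _) (rS n').
have h : `|sigma| <= S.
  by apply: (cvgr_to_le (cvg_norm rsigma)); apply: nearW => n'; exact: sS.
by apply: le_trans (ler_normB _ _) _; have := sS n; lra.
Qed.

Variables (Lam a : R) (B : nat -> R) (w : nat -> nat -> R).
Hypotheses (Lam0 : 0 <= Lam) (a0 : 0 <= a).
Hypothesis wa : forall N h, `|w N h - 1| <= a.
Hypothesis wLam : forall N h, 0 < B N -> `|w N h - 1| <= Lam * h%:R / B N.
Hypothesis B_oo : B N @[N --> \oo] --> +oo.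

Let p N n := \sum_(h < n) w N h * r h.

Lemma row_sum_reindex N :
  \sum_(l < N) \sum_(j < N) (l <= j)%N%:R * (w N (j - l) * r (j - l)%N) =
  \sum_(n < N) p N n.+1.
Proof.
rewrite [RHS](reindex_inj rev_ord_inj) /=; apply: eq_bigr => l _.
rewrite subnSK// /p.
rewrite -(big_mkord xpredT (fun j => (l <= j)%N%:R * (w N (j - l) * r (j - l)%N))).
rewrite (@big_cat_nat _ _ _ l)//= ?(ltnW (ltn_ord l))//.
rewrite big_nat big1 ?add0r => [|j /andP[_ jl]]; last by rewrite leqNgt jl mul0r.
rewrite -{1}(add0n (l : nat)) big_addn big_mkord; apply: eq_bigr => i _.
by rewrite leq_addl mul1r addnK.
Qed.

(** Averaging the weighted partial sums is harmless twice over: the weights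
    tend to 1 on every initial segment, and the averages are Cesaro means. *)
Lemma weighted_average_cvg e : 0 < e -> \forall N \near \oo,
  `|N%:R^-1 * (\sum_(l < N) \sum_(j < N)
      (l <= j)%N%:R * (w N (j - l) * r (j - l)%N)) - sigma| <= e.
Proof.
move=> e0; pose e1 := e / (a + 3).
have e10 : 0 < e1 by rewrite divr_gt0// ltr_wpDl.
(* The weights have to be close to 1 only at the lags below [H]; the partial
   sums with fewer than [H'] terms are negligible in the average. *)
have [H hH] := summable_tail e10.
have [H' _ hH'] := (@cvgrPdist_le _ _ _ _ _ _ _).1 rsigma e1 e10.
near=> N.
have BN : Lam * H%:R * S / e1 + 1 <= B N.
  by near: N; move/cvgryPge : B_oo; exact.
have N0 : (0 < N)%N by near: N; exists 1%N.
have NN : 2 * S * H'%:R / e1 <= N%:R by near: N; exact: nbhs_infty_ger.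
have B0 : 0 < B N.
  by apply: lt_le_trans BN; rewrite ltr_wpDl// !mulr_ge0// invr_ge0 ltW.
have N0R : 0 < N%:R :> R by rewrite ltr0n.
have pn n : `|p N n - sigma| <= (a + 2) * e1 + 2 * S * ((n < H')%N)%:R.
  have -> : p N n - sigma = \sum_(h < n) (w N h - 1) * r h + (\sum_(h < n) r h - sigma).
    rewrite addrA; congr (_ - _); rewrite -big_split; apply: eq_bigr => h _ /=.
    by ring.
  apply: le_trans (ler_normD _ _) _.
  rewrite (_ : _ * e1 + _ = (a + 1) * e1 + (e1 + 2 * S * ((n < H')%N)%:R)); last by ring.
  apply: lerD; last first.
    have [nH'|nH'] := ltnP n H'.
      by rewrite mulr1; have := partial_sum_bounded n; lra.
    by rewrite mulr0 addr0 distrC; exact: hH'.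
  apply: le_trans (ler_norm_sum _ _ _) _.
  apply: (@le_trans _ _ (\sum_(h < n) (Lam * H%:R / B N * `|r h| +
     a * (((H <= h)%N)%:R * `|r h|)))).
    apply: ler_sum => h _; rewrite normrM.
    have LB0 : 0 <= Lam * H%:R / B N by rewrite !mulr_ge0// invr_ge0 ltW.
    have [Hh|hH0] := leqP H h.
      rewrite mul1r -[leLHS]add0r; apply: lerD; first exact: mulr_ge0.
      exact: ler_wpM2r.
    rewrite mul0r mulr0 addr0 ler_wpM2r//; apply: le_trans (wLam _ B0) _.
    apply: ler_wpM2r; first by rewrite invr_ge0 ltW.
    by apply: ler_wpM2l => //; rewrite ler_nat ltnW.
  rewrite big_split /= -!mulr_sumr mulrDl mul1r addrC; apply: lerD.
    by apply: ler_wpM2l => //; exact: hH.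
  apply: (@le_trans _ _ (Lam * H%:R / B N * S)).
    apply: ler_wpM2l; last exact: rS.
    by rewrite !mulr_ge0// invr_ge0 ltW.
  rewrite mulrAC ler_pdivrMr// [leRHS]mulrC -ler_pdivrMr//.
  by apply: le_trans BN; rewrite lerDl.
rewrite row_sum_reindex.
have -> : N%:R^-1 * \sum_(n < N) p N n.+1 - sigma =
    N%:R^-1 * \sum_(n < N) (p N n.+1 - sigma).
  rewrite sumrB mulrBr; congr (_ - _); rewrite sumr_const card_ord.
  by rewrite -[sigma *+ N]mulr_natl mulrA mulVf ?mul1r// gt_eqF.
rewrite normrM (@ger0_norm _ N%:R^-1) ?invr_ge0 ?ler0n//.
rewrite ler_pdivrMl//; apply: le_trans (ler_norm_sum _ _ _) _.
apply: (@le_trans _ _ (\sum_(n < N) ((a + 2) * e1 + 2 * S * ((n < H')%N)%:R))).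
  apply: ler_sum => n _; apply: le_trans (pn _) _.
  apply: lerD => //; apply: ler_wpM2l; first exact: mulr_ge0.
  rewrite ler_nat; case: (ltnP n.+1 H') => // h.
  by rewrite (ltn_trans _ h).
rewrite big_split /= sumr_const card_ord -mulr_sumr.
have : \sum_(n < N) ((n < H')%N)%:R <= H'%:R :> R.
  by rewrite -natr_sum sum_ord_ltn ler_nat geq_minr.
move=> hs; rewrite -[_ *+ N]mulr_natl.
have -> : N%:R * e = N%:R * ((a + 2) * e1) + N%:R * e1.
  by rewrite /e1; field; rewrite gt_eqF// ltr_wpDl.
rewrite lerD2l; move: NN; rewrite ler_pdivrMr//; apply: le_trans.
by apply: ler_wpM2l => //; exact: mulr_ge0.
Unshelve. all: by end_near.
Qed.

End weighted_sums.

(** * Consistency in mean for quasi-orthogonal sequences *)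

Section consistency.
Context {R : realType} {d} {T : measurableType d} (P : probability T R).
Variables (K : R -> R) (Lam a M : R).
Hypotheses (Lam0 : 0 <= Lam) (a0 : 0 <= a) (M0 : 0 <= M).
Hypothesis KLam : forall x y, `|K x - K y| <= Lam * `|x - y|.
Hypothesis Ka : forall x, `|K x| <= a.
Hypothesis KM : forall x, M < `|x| -> K x = 0.
Hypothesis K1 : K 0 = 1.
Variable B : nat -> R.
Hypothesis B_oo : B N @[N --> \oo] --> +oo.
Hypothesis BN0 : B N / N%:R @[N --> \oo] --> 0.

Definition lag_form (N : nat) (x y : nat -> T -> R) (o : T) : R :=
  \sum_(l < N) \sum_(j < N) lag_weight K (B N) l j * (x l o * y j o).

Lemma L1_lag_form N x y : (forall l, L2 P (x l)) -> (forall l, L2 P (y l)) ->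
  L1 P (lag_form N x y).
Proof.
by move=> lx ly; apply: L1sum => l _; apply: L1sum => j _; apply: L1Z; exact: L2M.
Qed.

Lemma lag_form_diff N (x y x' y' : nat -> T -> R) o :
  lag_form N x y o - lag_form N x' y' o =
  lag_form N (fun l o => x l o - x' l o) y o +
  lag_form N x' (fun l o => y l o - y' l o) o.
Proof.
rewrite /lag_form -sumrB -big_split /=; apply: eq_bigr => l _.
by rewrite -sumrB -big_split /=; apply: eq_bigr => j _; ring.
Qed.

Let A := quadratic_constant Lam a M.

Let A0 : 0 <= A.
Proof. by rewrite /A /quadratic_constant mulr_ge0 ?sqrtr_ge0// addr_ge0 ?mulr_ge0. Qed.

(** The difference is the sum of two forms, each with one factor that is small in
    the sense of quasi-orthogonality, so that the bound is uniform in the sample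
    size. *)
Lemma Ex_lag_form_diff N (x y x' y' : nat -> T -> R) C eta :
  quasi_orthogonal P x' C -> quasi_orthogonal P y C ->
  quasi_orthogonal P (fun l o => x l o - x' l o) eta ->
  quasi_orthogonal P (fun l o => y l o - y' l o) eta ->
  1 <= B N -> B N <= N%:R ->
  Ex P (fun o => `|lag_form N x y o - lag_form N x' y' o|) <=
  N%:R * (2 * A * C * eta).
Proof.
move=> qx' qy qdx qdy B1 BN.
have [_ lx' _] := qx'; have [_ ly _] := qy; have [_ ldx _] := qdx; have [_ ldy _] := qdy.
under eq_Ex do rewrite lag_form_diff.
have l1 := L1_lag_form N ldx ly; have l2 := L1_lag_form N lx' ldy.
apply: (@le_trans _ _ (Ex P (fun o => `|lag_form N (fun l o => x l o - x' l o) y o| +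
  `|lag_form N x' (fun l o => y l o - y' l o) o|))).
  apply: Ex_le.
  - by apply: L1_abs; exact: L1D.
  - by apply: L1D; exact: L1_abs.
  by move=> o; exact: ler_normD.
rewrite ExD; [|exact: L1_abs|exact: L1_abs].
have := Ex_lag_quadratic_form Lam0 a0 M0 KLam Ka KM B1 qdx qy BN.
have := Ex_lag_quadratic_form Lam0 a0 M0 KLam Ka KM B1 qx' qdy BN.
rewrite -/A => h2 h1; apply: le_trans (lerD h1 h2) _.
by rewrite le_eqVlt; apply/orP; left; apply/eqP; ring.
Qed.

Variables (x y : nat -> T -> R) (C : R) (rp rn : nat -> R) (S sp sn : R).
Hypotheses (qx : quasi_orthogonal P x C) (qy : quasi_orthogonal P y C).
Hypothesis cov_ge : forall l j, (l <= j)%N -> Ex P (fun o => x l o * y j o) = rp (j - l)%N.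
Hypothesis cov_lt : forall l j, (j < l)%N -> Ex P (fun o => x l o * y j o) = rn (l - j)%N.
(* Lag 0 is counted once, in [rp]. *)
Hypothesis rn0 : rn 0 = 0.
Hypothesis rpS : forall n, \sum_(h < n) `|rp h| <= S.
Hypothesis rnS : forall n, \sum_(h < n) `|rn h| <= S.
Hypothesis rpsp : \sum_(h < n) rp h @[n --> \oo] --> sp.
Hypothesis rnsn : \sum_(h < n) rn h @[n --> \oo] --> sn.
Hypothesis approx : forall eta, 0 < eta -> exists m D z,
  [/\ finite_range P m D z,
      quasi_orthogonal P (fun l o => x l o - z true l o) eta &
      quasi_orthogonal P (fun l o => y l o - z false l o) eta].

Let lx : forall l, L2 P (x l). Proof. by case: qx. Qed.
Let ly : forall l, L2 P (y l). Proof. by case: qy. Qed.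

Lemma Ex_lag_form_split N : Ex P (lag_form N x y) =
  \sum_(l < N) \sum_(j < N) (l <= j)%N%:R * (K ((j - l)%:R / B N) * rp (j - l)%N) +
  \sum_(l < N) \sum_(j < N) (l <= j)%N%:R * (K (- ((j - l)%:R / B N)) * rn (j - l)%N).
Proof.
have l1 l j : L1 P (fun o => x l o * y j o) by exact: L2M.
rewrite [X in _ = _ + X]exchange_big -big_split /= Exsum; last first.
  by move=> l _; apply: L1sum => j _; exact: L1Z.
apply: eq_bigr => l _; rewrite Exsum; last by move=> j _; exact: L1Z.
rewrite -big_split; apply: eq_bigr => j _; rewrite /= ExZ// /lag_weight.
have [lj|jl|lj] := ltngtP l j.
- by rewrite cov_ge ?(ltnW lj)// (natrB _ (ltnW lj)) /= ?mulr1n ?mulr0n; ring.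
- by rewrite cov_lt// (natrB _ (ltnW jl)) -mulNr opprB /= ?mulr1n ?mulr0n; ring.
by rewrite cov_ge ?lj// subnn rn0 subrr /= ?mulr1n; ring.
Qed.

Lemma mean_lag_form_cvg e : 0 < e -> \forall N \near \oo,
  `|N%:R^-1 * Ex P (lag_form N x y) - (sp + sn)| <= e.
Proof.
move=> e0; have e2 : 0 < e / 2 by rewrite divr_gt0.
have w1 (s : R) N h : `|K (s * (h%:R / B N)) - 1| <= a + 1.
  by apply: le_trans (ler_normB _ _) _; rewrite normr1 lerD2r.
have w2 (s : R) N h : `|s| = 1 -> 0 < B N ->
    `|K (s * (h%:R / B N)) - 1| <= Lam * h%:R / B N.
  move=> s1 B0; rewrite -[X in _ - X]K1; apply: le_trans (KLam _ _) _.
  rewrite subr0 normrM s1 mul1r -mulrA normrM normfV (gtr0_norm B0).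
  by rewrite ger0_norm.
have a10 : 0 <= a + 1 by rewrite addr_ge0.
have cp := weighted_average_cvg rpS rpsp Lam0 a10 (w1 1)
  (fun N h B0 => w2 1 N h (normr1 _) B0) B_oo e2.
have cn := weighted_average_cvg rnS rnsn Lam0 a10 (w1 (-1))
  (fun N h B0 => w2 (-1) N h (normrN1 _) B0) B_oo e2.
apply: filterS2 cp cn => N hp hn.
rewrite Ex_lag_form_split mulrDr opprD addrACA.
apply: le_trans (ler_normD _ _) _; rewrite [leRHS]splitr; apply: lerD.
  by under eq_bigr => l _ do under eq_bigr => j _ do rewrite -[_ / B N]mul1r.
by under eq_bigr => l _ do under eq_bigr => j _ do rewrite -mulN1r.
Qed.

(** Up to a small multiple of [N], the form may be computed on a bounded sequence
    of finite range, where its standard deviation is of the order of the square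
    root of [B N * N]; the mean needs no approximation. *)
Lemma lag_estimator_L1 e : 0 < e -> \forall N \near \oo,
  Ex P (fun o => `|N%:R^-1 * lag_form N x y o - (sp + sn)|) <= e.
Proof.
move=> e0.
have C0 : 0 <= C by case: qx.
pose C1 := C + 1.
have C10 : 0 <= C1 by rewrite addr_ge0.
pose eta := Num.min 1 (e / 6 / (2 * A * C1 + 1)).
have AC0 : 0 <= 2 * A * C1 by apply: mulr_ge0 => //; exact: mulr_ge0.
have q0 : 0 < 2 * A * C1 + 1 by apply: ltr_wpDl.
have eta0 : 0 < eta.
  by rewrite lt_min ltr01 /=; apply: divr_gt0 => //; exact: divr_gt0.
have eta1 : eta <= 1 by rewrite ge_min lexx.
have etae : 2 * A * C1 * eta <= e / 6.
  have : eta <= e / 6 / (2 * A * C1 + 1) by rewrite ge_min lexx orbT.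
  rewrite ler_pdivlMr// => h.
  nra.
have [m [D [z [frz qdx qdy]]]] := approx eta0.
have sub (x' z' : nat -> T -> R) : quasi_orthogonal P x' C ->
    quasi_orthogonal P (fun l o => x' l o - z' l o) eta -> quasi_orthogonal P z' C1.
  move=> q' /quasi_orthogonalN /(quasi_orthogonalD q') h.
  apply: (@quasi_orthogonal_le _ _ _ P _ (C + eta)); first by rewrite lerD2l.
  by apply: quasi_orthogonal_ext h => l o; ring.
have qzt := sub _ _ qx qdx; have qzf := sub _ _ qy qdy.
have qz b : quasi_orthogonal P (z b) C1 by case: b.
have qy1 : quasi_orthogonal P y C1 by apply: quasi_orthogonal_le qy; rewrite lerDl.
have lz b l : L2 P (z b l) by case: (qz b).
pose G := centred_form_bound m D C1 a.
have G0 : 0 <= G by rewrite addr_ge0 ?mulr_ge0 ?sqrtr_ge0.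
have e3 : 0 < e / 3 by rewrite divr_gt0.
(* The ratio of bandwidth to sample size below which the standard deviation of
   the form is at most [N * (e / 3)]. *)
pose kappa := (e / 3 / (G + 1)) ^+ 2 / (M + 1).
have G1 : 0 < G + 1 by rewrite ltr_wpDl.
have M1 : 0 < M + 1 by rewrite ltr_wpDl.
have kappa0 : 0 < kappa by rewrite divr_gt0// exprn_gt0// !divr_gt0.
have kappa1 : 0 < Num.min kappa 1 by rewrite lt_min kappa0 ltr01.
near=> N.
have N0 : (0 < N)%N by near: N; exists 1%N.
have N0R : 0 < N%:R :> R by rewrite ltr0n.
have B1 : 1 <= B N by near: N; move/cvgryPge : B_oo; exact.
have Bk : B N / N%:R <= Num.min kappa 1.
  by apply: le_trans (ler_norm _) _; near: N; move/cvgr0Pnorm_le : BN0; exact.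
have BN : B N <= N%:R.
  by move: Bk; rewrite le_min => /andP[_]; rewrite ler_pdivrMr// mul1r.
have mean : `|N%:R^-1 * Ex P (lag_form N x y) - (sp + sn)| <= e / 3.
  by near: N; exact: mean_lag_form_cvg.
have lxy := L1_lag_form N lx ly.
have lzz := L1_lag_form N (lz true) (lz false).
have diff := Ex_lag_form_diff qzt qy1 qdx qdy B1 BN.
have dEx : `|Ex P (lag_form N (z true) (z false)) - Ex P (lag_form N x y)| <=
    N%:R * (2 * A * C1 * eta).
  rewrite distrC -ExB//; apply: le_trans diff; apply: Ex_abs; exact: L1B.
have band l j : (Num.truncn (M * B N) < gap l j)%N -> lag_weight K (B N) l j = 0.
  exact: lag_weight_band.
have var := centred_form_nrm frz qz N a0 (fun l j => Ka _) band.
have lf : L2 P (lag_form N (z true) (z false)).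
  by have := L2_form (P := P) frz qz (lag_weight K (B N)) N.
have var1 : Ex P (fun o => `|lag_form N (z true) (z false) o -
    Ex P (lag_form N (z true) (z false))|) <= N%:R * (e / 3).
  apply: le_trans (Ex_abs_le_nrm (L2B lf (L2cst P _))) _.
  apply: le_trans var _; rewrite -/G.
  have Lb : (Num.truncn (M * B N)).+1%:R <= (M + 1) * B N.
    have : (Num.truncn (M * B N))%:R <= M * B N.
      by rewrite truncn_le mulr_ge0// (le_trans ler01).
    by rewrite -natr1 mulrDl mul1r => h; apply: lerD.
  have Bk' : B N <= kappa * N%:R.
    by move: Bk; rewrite le_min => /andP[+ _]; rewrite ler_pdivrMr.
  have : (Num.truncn (M * B N)).+1%:R * N%:R <= (N%:R * (e / 3 / (G + 1))) ^+ 2.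
    apply: (@le_trans _ _ ((M + 1) * (kappa * N%:R) * N%:R)).
      apply: ler_wpM2r => //; apply: le_trans Lb _.
      by apply: ler_wpM2l => //; exact: ltW.
    by rewrite le_eqVlt; apply/orP; left; apply/eqP; rewrite /kappa; field;
      rewrite !gt_eqF.
  move=> /ler_wsqrtr; rewrite sqrtr_sqr ger0_norm; last first.
    by rewrite mulr_ge0// divr_ge0// ltW.
  move=> /(ler_wpM2l G0) /le_trans; apply.
  rewrite mulrCA ler_wpM2l// mulrA ler_pdivrMr// mulrDr mulr1 mulrC lerDl.
  exact: ltW.
set s := sp + sn in mean *.
pose U1 o := `|lag_form N x y o - lag_form N (z true) (z false) o|.
pose U2 o := `|lag_form N (z true) (z false) o - Ex P (lag_form N (z true) (z false))|.
pose u := N%:R * (2 * A * C1 * eta) + N%:R * (e / 3).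
have lU1 : L1 P U1 by apply: L1_abs; exact: L1B.
have lU2 : L1 P U2 by apply: L1_abs; apply: L1B => //; exact: L1cst.
have lU := L1D lU1 lU2.
apply: (@le_trans _ _ (Ex P (fun o => N%:R^-1 * (U1 o + U2 o) +
    (2 * A * C1 * eta + e / 3)))).
  apply: Ex_le.
  - by apply: L1_abs; apply: L1B; [exact: L1Z|exact: L1cst].
  - by apply: L1D; [exact: L1Z|exact: L1cst].
  move=> o.
  have -> : N%:R^-1 * lag_form N x y o - s = N%:R^-1 * (
      (lag_form N x y o - lag_form N (z true) (z false) o) +
      (lag_form N (z true) (z false) o - Ex P (lag_form N (z true) (z false)))) +
      (N%:R^-1 * (Ex P (lag_form N (z true) (z false)) - Ex P (lag_form N x y)) +
      (N%:R^-1 * Ex P (lag_form N x y) - s)) by ring.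
  have N1 : 0 <= N%:R^-1 :> R by rewrite invr_ge0.
  apply: le_trans (ler_normD _ _) _; apply: lerD.
    by rewrite normrM ger0_norm//; apply: ler_wpM2l => //; exact: ler_normD.
  apply: le_trans (ler_normD _ _) _; apply: lerD => //.
  rewrite normrM ger0_norm// ler_pdivrMl//.
rewrite ExD; [|exact: L1Z|exact: L1cst].
rewrite Excst ExZ// ExD//.
have : N%:R^-1 * (Ex P U1 + Ex P U2) <= 2 * A * C1 * eta + e / 3.
  by rewrite ler_pdivrMl// mulrDr; apply: lerD.
lra.
Unshelve. all: by end_near.
Qed.

End consistency.

(** * Laws of families of random paths *)

Lemma measurable_preimage_cylinder {d} {T : measurableType d} {V : Type}
    {dE} {E : measurableType dE} (D : set V) (h : T -> V -> E) :
  (forall t, D t -> measurable_fun setT (h ^~ t)) ->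
  forall A, cylinder D A -> measurable (h @^-1` A).
Proof.
move=> mh; apply: smallest_sub; first split => /=.
- by rewrite preimage_set0; exact: measurable0.
- move=> A mA; rewrite setTD preimage_setC; exact: measurableC.
- move=> F mF; rewrite preimage_bigcup; exact: bigcupT_measurable.
move=> _ [t Dt [B mB ->]] /=.
by have := mh t Dt measurableT B mB; rewrite setTI.
Qed.

(** The limit superior is a measurable functional of a sequence even where the
    sequence does not converge. *)
Lemma fine_limn_esup {R : realType} (u : R^nat) (l : R) :
  u @ \oo --> l -> l = fine (limn_esup (fun n => (u n)%:E)).
Proof.
move=> ul; have ul' : (fun n => (u n)%:E) @ \oo --> l%:E by apply: cvg_EFin => //; exact: nearW.
rewrite is_cvg_limn_esupE; last by apply/cvg_ex; exists l%:E.
by rewrite (cvg_lim _ ul').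
Qed.

Section paths.
Context {R : realType}.
Context {dU : measure_display} {U : measurableType dU}.
Context {dE : measure_display} {E : measurableType dE}.
Context {I : choiceType}.

Definition total_cylinder : set (set (U -> E)) := cylinder [set: U].

(** The time set is a whole measurable space, so that no restriction to a set of
    times has to be carried along. *)
Definition iid_paths {d} {T : measurableType d} (P : probability T R)
    (xi : I -> T -> U -> E) : Prop :=
  [/\ forall i, measurable_fun setT (fun x : T * U => xi i x.1 x.2),
      forall i j A, total_cylinder A -> P (xi i @^-1` A) = P (xi j @^-1` A)
    & forall (J : {fset I}) (A : I -> set (U -> E)),
        (forall j, total_cylinder (A j)) ->
        P (\bigcap_(j in [set` J]) xi j @^-1` A j) =
        (\prod_(j <- J) P (xi j @^-1` A j))%E].

Definition box : set (set (I -> U -> E)) :=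
  [set A | exists J : {fset I}, exists B : I -> set (U -> E),
    (forall j, total_cylinder (B j)) /\
    A = \bigcap_(j in [set` J]) (fun x : I -> U -> E => x j) @^-1` B j].

Definition paths := g_sigma_algebraType box.

Definition upath := g_sigma_algebraType [set A | exists2 t, [set: U] t &
        exists2 B, measurable B & A = [set f : U -> E | B (f t)]].

Lemma total_cylinderE (A : set (U -> E)) :
  total_cylinder A = measurable (A : set upath).
Proof. by []. Qed.

Lemma boxI : setI_closed box.
Proof.
move=> _ _ [J1 [B1 [c1 ->]]] [J2 [B2 [c2 ->]]].
exists (J1 `|` J2)%fset.
exists (fun j => (if j \in J1 then B1 j else setT) `&`
                 (if j \in J2 then B2 j else setT)); split.
  move=> j; rewrite total_cylinderE; apply: measurableI.
    by case: ifP => _; [exact: c1|exact: measurableT].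
  by case: ifP => _; [exact: c2|exact: measurableT].
apply/seteqP; split => x /=.
  move=> [x1 x2] j /= jJ; split.
    by case: ifPn => // jJ1; exact: x1.
  by case: ifPn => // jJ2; exact: x2.
move=> xB; split => j /= jJ.
  by have := xB j; rewrite /= in_fsetU jJ /= => /(_ isT)[].
by have := xB j; rewrite /= in_fsetU jJ /= orbT => /(_ isT)[].
Qed.

Lemma boxT : box setT.
Proof.
exists fset0, (fun=> setT); split.
  by move=> j; rewrite total_cylinderE; exact: measurableT.
by apply/seteqP; split.
Qed.

Lemma measurable_eval (i : I) (t : U) :
  measurable_fun setT (fun x : paths => x i t).
Proof.
move=> _ B mB; rewrite setTI; apply: sub_sigma_algebra.
exists [fset i]%fset, (fun j => [set f : U -> E | B (f t)]); split.
  by move=> j; apply: sub_sigma_algebra; exists t => //; exists B.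
apply/seteqP; split => x /=; first by move=> Bx j /=; rewrite inE => /eqP ->.
by apply; rewrite /= inE.
Qed.

Section one.
Context {d} {T : measurableType d} (P : probability T R) (xi : I -> T -> U -> E).
Hypothesis iidxi : iid_paths P xi.

Definition path_of (o : T) : paths := fun i => xi i o.

Lemma measurable_at i t : measurable_fun setT (fun o => xi i o t).
Proof.
have [m _ _] := iidxi.
exact: (measurableT_comp (m i) (measurable_pair2 _)).
Qed.

Lemma measurable_path_event i A : total_cylinder A -> measurable (xi i @^-1` A).
Proof. by apply: measurable_preimage_cylinder => t _; exact: measurable_at. Qed.

Lemma measurable_path_of : measurable_fun setT path_of.
Proof.
apply: (@measurability _ _ T paths setT path_of box) => // _ [_ [J [B [cB ->]]] <-].
rewrite setTI preimage_bigcap; apply: fin_bigcap_measurable => // j _.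
exact: measurable_path_event.
Qed.

End one.

Section two.
Context {d} {T : measurableType d} (P : probability T R) (xi : I -> T -> U -> E).
Context {d'} {T' : measurableType d'} (P' : probability T' R)
  (xi' : I -> T' -> U -> E).
Hypothesis iidxi : iid_paths P xi.
Hypothesis iidxi' : iid_paths P' xi'.
Hypothesis same_marginals : forall i A, total_cylinder A ->
  P (xi i @^-1` A) = P' (xi' i @^-1` A).

(** Boxes are stable under intersection and generate the sigma-algebra, and by
    independence both laws give a box the same product. *)
Lemma path_law_eq (A : set paths) : measurable A ->
  pushforward P (path_of xi) A = pushforward P' (path_of xi') A.
Proof.
move=> mA.
have mp := measurable_path_of iidxi; have mp' := measurable_path_of iidxi'.
apply: (@measure_unique _ R paths box (fun=> setT) _ _ _ _
  (pushforward P (path_of xi)) (pushforward P' (path_of xi'))) => //.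
- exact: boxI.
- by move=> _; exact: boxT.
- by rewrite bigcup_const//; exists 0%N.
- move=> _ [J [B [cB ->]]].
  have pre d0 (T0 : measurableType d0) (x : I -> T0 -> U -> E) :
      path_of x @^-1` (\bigcap_(j in [set` J])
        (fun x : I -> U -> E => x j) @^-1` B j) =
      \bigcap_(j in [set` J]) x j @^-1` B j by rewrite preimage_bigcap.
  rewrite -[LHS]/(P (path_of xi @^-1` _)) -[RHS]/(P' (path_of xi' @^-1` _)) !pre.
  have [_ _ prod] := iidxi; have [_ _ prod'] := iidxi'.
  rewrite [LHS](prod J B cB) [RHS](prod' J B cB).
  by apply: eq_bigr => j _; exact: same_marginals.
move=> _; rewrite -[ltLHS]/(P (path_of xi @^-1` _)) preimage_setT.
by rewrite probability_setT ltry.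
Qed.

Lemma ge0_integral_path (f : paths -> \bar R) : measurable_fun setT f ->
  (forall x, 0 <= f x)%E ->
  (\int[P]_o f (path_of xi o) = \int[P']_o f (path_of xi' o))%E.
Proof.
move=> mf f0.
have mp := measurable_path_of iidxi; have mp' := measurable_path_of iidxi'.
rewrite -[LHS](@ge0_integral_pushforward _ _ _ _ _ _ mp P setT f)//.
rewrite -[RHS](@ge0_integral_pushforward _ _ _ _ _ _ mp' P' setT f)//.
by apply: eq_measure_integral => A mA _; exact: path_law_eq.
Qed.

(** [F] and [F'] are, almost surely, the same measurable functional of the two
    families of paths; any joint law of such [F]s is therefore that of the
    corresponding [F']s. *)
Definition transfers (F : T -> R) (F' : T' -> R) : Prop :=
  [/\ measurable_fun setT F, measurable_fun setT F' &
   exists Phi : paths -> R, [/\ measurable_fun setT Phi,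
     {ae P, forall o, F o = Phi (path_of xi o)} &
     {ae P', forall o, F' o = Phi (path_of xi' o)}]].

Lemma transfers_integral F F' : transfers F F' ->
  (\int[P]_o (F o)%:E = \int[P']_o (F' o)%:E)%E.
Proof.
move=> [mF mF' [Phi [mPhi PF PF']]].
have mp := measurable_path_of iidxi; have mp' := measurable_path_of iidxi'.
rewrite (ae_eq_integral (fun o => (Phi (path_of xi o))%:E))//; last 3 first.
- exact/measurable_EFinP.
- by apply/measurable_EFinP; exact: (measurableT_comp mPhi mp).
- by apply: filterS PF => o -> _.
rewrite [RHS](ae_eq_integral (fun o => (Phi (path_of xi' o))%:E))//; last 3 first.
- exact/measurable_EFinP.
- by apply/measurable_EFinP; exact: (measurableT_comp mPhi mp').
- by apply: filterS PF' => o -> _.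
have mE : measurable_fun setT (EFin \o Phi) by exact/measurable_EFinP.
have ep (T0 : Type) (h : T0 -> paths) : (fun o => (Phi (h o))%:E)^\+%E =
    (fun o => (EFin \o Phi)^\+%E (h o)) := funepos_comp _ _.
have en (T0 : Type) (h : T0 -> paths) : (fun o => (Phi (h o))%:E)^\-%E =
    (fun o => (EFin \o Phi)^\-%E (h o)) := funeneg_comp _ _.
rewrite integralE [RHS]integralE !ep !en; congr (_ - _)%E.
  apply: ge0_integral_path => [|x]; last exact: funepos_ge0.
  exact: measurable_funepos.
apply: ge0_integral_path => [|x]; last exact: funeneg_ge0.
exact: measurable_funeneg.
Qed.

Lemma transfers_Ex F F' : transfers F F' -> Ex P F = Ex P' F'.
Proof. by move=> FF'; rewrite /Ex /Rintegral (transfers_integral FF'). Qed.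

Lemma transfers_comp (g : R -> R) F F' : measurable_fun setT g ->
  transfers F F' -> transfers (fun o => g (F o)) (fun o => g (F' o)).
Proof.
move=> mg [mF mF' [Phi [mPhi PF PF']]]; split.
- exact: (measurableT_comp mg mF).
- exact: (measurableT_comp mg mF').
exists (g \o Phi); split; first exact: (measurableT_comp mg mPhi).
  by apply: filterS PF => o /= ->.
by apply: filterS PF' => o /= ->.
Qed.

Lemma transfers_cst c : transfers (fun=> c) (fun=> c).
Proof. by split => //; exists (fun=> c); split => //; exact: aeW. Qed.

Lemma transfersM F F' G G' : transfers F F' -> transfers G G' ->
  transfers (fun o => F o * G o) (fun o => F' o * G' o).
Proof.
move=> [mF mF' [Phi [mPhi PF PF']]] [mG mG' [Psi [mPsi PG PG']]]; split.
- exact: measurable_funM.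
- exact: measurable_funM.
exists (fun x => Phi x * Psi x); split; first exact: measurable_funM.
  by apply: filterS2 PF PG => o -> ->.
by apply: filterS2 PF' PG' => o -> ->.
Qed.

Lemma transfersD F F' G G' : transfers F F' -> transfers G G' ->
  transfers (fun o => F o + G o) (fun o => F' o + G' o).
Proof.
move=> [mF mF' [Phi [mPhi PF PF']]] [mG mG' [Psi [mPsi PG PG']]]; split.
- exact: measurable_funD.
- exact: measurable_funD.
exists (fun x => Phi x + Psi x); split; first exact: measurable_funD.
  by apply: filterS2 PF PG => o -> ->.
by apply: filterS2 PF' PG' => o -> ->.
Qed.

Lemma transfersB F F' G G' : transfers F F' -> transfers G G' ->
  transfers (fun o => F o - G o) (fun o => F' o - G' o).
Proof.
move=> tF tG; apply: (transfersD tF); exact: (transfers_comp (g := -%R)).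
Qed.

Lemma transfers_sqr F F' : transfers F F' ->
  transfers (fun o => F o ^+ 2) (fun o => F' o ^+ 2).
Proof.
by move=> tF; apply: (transfers_comp (g := fun x => x ^+ 2)); first exact: exprn_measurable.
Qed.

Lemma transfers_nrm F F' : transfers F F' -> nrm P F = nrm P' F'.
Proof.
move=> tF; rewrite /nrm; congr Num.sqrt.
exact: (transfers_Ex (transfers_sqr tF)).
Qed.

Lemma transfers_lim (F : (T -> R)^nat) (F' : (T' -> R)^nat)
    (G : T -> R) (G' : T' -> R) :
  measurable_fun setT G -> measurable_fun setT G' ->
  (forall n, transfers (F n) (F' n)) ->
  {ae P, forall o, F n o @[n --> \oo] --> G o} ->
  {ae P', forall o, F' n o @[n --> \oo] --> G' o} ->
  transfers G G'.
Proof.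
move=> mG mG' tF FG FG'; split => //.
have /choice[Phi hPhi] : forall n, exists Phi : paths -> R,
    [/\ measurable_fun setT Phi,
     {ae P, forall o, F n o = Phi (path_of xi o)} &
     {ae P', forall o, F' n o = Phi (path_of xi' o)}].
  by move=> n; case: (tF n).
exists (fun x => fine (limn_esup (fun n => (Phi n x)%:E))); split.
- apply: (measurableT_comp (@fine_measurable R setT measurableT)) => //.
  apply: (measurable_fun_limn_esup (f := fun n x => (Phi n x)%:E)) => n.
  by apply/measurable_EFinP; case: (hPhi n).
- have a n : {ae P, forall o, F n o = Phi n (path_of xi o)} by case: (hPhi n).
  have := ae_foralln a; apply: filterS2 FG => o c e.
  apply: fine_limn_esup; apply: cvg_trans c.
  by apply: near_eq_cvg; apply: nearW => n; rewrite e.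
have a n : {ae P', forall o, F' n o = Phi n (path_of xi' o)} by case: (hPhi n).
have := ae_foralln a; apply: filterS2 FG' => o c e.
apply: fine_limn_esup; apply: cvg_trans c.
by apply: near_eq_cvg; apply: nearW => n; rewrite e.
Qed.

End two.
End paths.

(** * Integration over time *)

Definition clip {R : realType} (M x : R) : R := Num.max (- M) (Num.min x M).

Lemma measurable_clip {R : realType} (M : R) : measurable_fun setT (clip M).
Proof.
apply: measurable_maxr; first exact: measurable_cst.
by apply: measurable_minr; [exact: measurable_id|exact: measurable_cst].
Qed.

Lemma clip_le {R : realType} (M x : R) : 0 <= M -> `|clip M x| <= M.
Proof.
move=> M0; rewrite ler_norml /clip le_max lexx /= ge_max ge_min lexx orbT andbT.
by rewrite (le_trans _ M0)// oppr_le0.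
Qed.

Lemma clip_le_abs {R : realType} (M x : R) : 0 <= M -> `|clip M x| <= `|x|.
Proof.
move=> M0; have := ler_norm x; have := ler_norm (- x).
rewrite normrN => h1 h2; rewrite ler_norml /clip maxEle minEle.
case: (leP x M) => xM; case: (leP (- M) _) => h; apply/andP; split; lra.
Qed.

Lemma clip_id {R : realType} (M x : R) : `|x| <= M -> clip M x = x.
Proof.
by rewrite ler_norml => /andP[Mx xM]; rewrite /clip (min_idPl xM) (max_idPr Mx).
Qed.

Lemma clip_cvg {R : realType} (x : R) : clip n%:R x @[n --> \oo] --> x.
Proof.
apply: cvg_near_cst; exists (Num.truncn `|x|).+1 => // n /= xn.
apply: clip_id; apply/ltW; apply: (lt_le_trans (truncnS_gt _)).
by rewrite ler_nat.
Qed.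

Section time_integral.
Context {R : realType}.
Context {dU : measure_display} {U : measurableType dU} (nu : probability U R).
Context {d : measure_display} {T : measurableType d} (P : probability T R).
Implicit Types Z W : T -> U -> R.

Definition jmeas Z := measurable_fun setT (fun x : T * U => Z x.1 x.2).

Lemma jmeas_fst Z t : jmeas Z -> measurable_fun setT (Z ^~ t).
Proof. by move=> mZ; exact: (measurableT_comp mZ (measurable_pair2 _)). Qed.

Lemma jmeas_snd Z o : jmeas Z -> measurable_fun setT (Z o).
Proof. by move=> mZ; exact: (measurableT_comp mZ (measurable_pair1 _)). Qed.

Lemma jmeas_time (v : U -> R) : measurable_fun setT v -> jmeas (fun=> v).
Proof. by move=> mv; exact: (measurableT_comp mv measurable_snd). Qed.

Lemma jmeas_space (F : T -> R) : measurable_fun setT F -> jmeas (fun o _ => F o).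
Proof. by move=> mF; exact: (measurableT_comp mF measurable_fst). Qed.

Lemma measurable_tint Z : jmeas Z -> measurable_fun setT (fun o => Ex nu (Z o)).
Proof.
move=> mZ; apply: (measurableT_comp (@fine_measurable R setT measurableT)) => //.
pose f (x : T * U) := (Z x.1 x.2)%:E.
have mf : measurable_fun setT f by exact/measurable_EFinP.
rewrite (_ : (fun o => _) = (fun o => \int[nu]_t f^\+ (o, t) - \int[nu]_t f^\- (o, t))%E).
  apply: emeasurable_funB.
    apply: (measurable_fun_fubini_tonelli_F f^\+%E) => //.
    exact: measurable_funepos.
  apply: (measurable_fun_fubini_tonelli_F f^\-%E) => //.
  exact: measurable_funeneg.
apply/funext => o; rewrite integralE.
have -> : (fun t => (Z o t)%:E)^\+%E = (fun t => f^\+%E (o, t)).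
  exact: (funepos_comp f (fun t => (o, t))).
have -> // : (fun t => (Z o t)%:E)^\-%E = (fun t => f^\-%E (o, t)).
exact: (funeneg_comp f (fun t => (o, t))).
Qed.

Lemma tonelli Z : jmeas Z -> (forall o t, 0 <= Z o t) ->
  (\int[nu]_t \int[P]_o (Z o t)%:E = \int[P]_o \int[nu]_t (Z o t)%:E)%E.
Proof.
move=> mZ Z0.
symmetry; apply: (fubini_tonelli (fun x : T * U => (Z x.1 x.2)%:E)).
  exact/measurable_EFinP.
by move=> x; rewrite lee_fin.
Qed.

Lemma measurable_moment Z : jmeas Z -> (forall o t, 0 <= Z o t) ->
  measurable_fun setT (fun t => \int[P]_o (Z o t)%:E)%E.
Proof.
move=> mZ Z0.
apply: (measurable_fun_fubini_tonelli_G (fun x : T * U => (Z x.1 x.2)%:E)).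
  exact/measurable_EFinP.
by move=> x; rewrite lee_fin.
Qed.

(** One more sample time drawn from [nu] adds, on average, only the variance
    of a single sample to the mean squared error of the running sum, because
    the sampling error has mean zero given everything else. *)
Lemma average_sampling_step Z (v : U -> R) M (S : T -> R) :
  jmeas Z -> L2 nu v -> 0 <= M -> (forall o t, `|Z o t| <= M) -> L2 P S ->
  (\int[nu]_t \int[P]_o
     ((S o + (Z o t * v t - Ex nu (fun s => Z o s * v s))) ^+ 2)%:E
   <= (Ex P (fun o => S o ^+ 2) + M ^+ 2 * Ex nu (fun t => v t ^+ 2))%:E)%E.
Proof.
move=> mZ lv M0 ZM lS.
have mW : jmeas (fun o t => Z o t * v t).
  by apply: measurable_funM => //; apply: jmeas_time; exact: L2_meas lv.
have mA := measurable_tint mW.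
have mS := L2_meas lS.
rewrite tonelli; last 2 first.
- apply: (measurable_funX (f := fun x : T * U => _)); apply: measurable_funD.
    exact: (jmeas_space mS).
  by apply: measurable_funB => //; exact: (jmeas_space mA).
- by move=> o t; exact: sqr_ge0.
have lW o : L2 nu (fun t => Z o t * v t).
  apply: (Ex_sqr_le (c := M) _ lv); first exact: (jmeas_snd o mW).
  by move=> t; rewrite normrM ler_wpM2r.
rewrite -[leRHS](_ : \int[P]_o (S o ^+ 2 + M ^+ 2 * Ex nu (fun t => v t ^+ 2))%:E = _)%E; last first.
  have lc := L1D lS.2 (L1cst P (M ^+ 2 * Ex nu (fun t => v t ^+ 2))).
  by rewrite (L1_integralE lc) ExD ?Excst//; [exact: lS.2|exact: L1cst].
apply: ge0_le_integral => //.
- by move=> o _; apply: integral_ge0 => t _; rewrite lee_fin sqr_ge0.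
- apply: (measurable_fun_fubini_tonelli_F (fun x : T * U => ((S x.1 +
    (Z x.1 x.2 * v x.2 - Ex nu (fun s => Z x.1 s * v s))) ^+ 2)%:E)).
  + apply/measurable_EFinP; apply: measurable_funX; apply: measurable_funD.
      exact: (jmeas_space mS).
    by apply: measurable_funB => //; exact: (jmeas_space mA).
  + by move=> x; rewrite lee_fin sqr_ge0.
- apply/measurable_EFinP; apply: measurable_funD => //; exact: measurable_funX.
move=> o _; set A := Ex nu (fun s => Z o s * v s).
have l1 : L1 nu (fun t => Z o t * v t) by exact: L2_L1.
have e : Ex nu (fun t => (S o + (Z o t * v t - A)) ^+ 2) =
    (S o - A) ^+ 2 + 2 * (S o - A) * A + Ex nu (fun t => (Z o t * v t) ^+ 2).
  transitivity (Ex nu (fun t => (S o - A) ^+ 2 +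
      2 * (S o - A) * (Z o t * v t) + (Z o t * v t) ^+ 2)).
    by apply: eq_Ex => t; ring.
  have l2 := L1Z (2 * (S o - A)) l1.
  rewrite ExD; [|exact: L1D (L1cst _ _) l2|exact: (lW o).2].
  by rewrite ExD ?ExZ ?Excst//; exact: L1cst.
rewrite L1_integralE; last first.
  have := L2D (L2D (L2cst nu (S o)) (lW o)) (L2cst nu (- A)).
  by case=> _; rewrite (_ : (fun t => _) = (fun t => (S o + (Z o t * v t - A)) ^+ 2))//;
    apply/funext => t; rewrite addrA.
rewrite lee_fin e.
have : Ex nu (fun t => (Z o t * v t) ^+ 2) <= M ^+ 2 * Ex nu (fun t => v t ^+ 2).
  rewrite -ExZ ?lv.2//; apply: Ex_le; [exact: (lW o).2|exact: L1Z lv.2|] => t.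
  rewrite exprMn ler_wpM2r ?sqr_ge0// -sqr_normr.
  by rewrite ler_pXn2r ?nnegrE.
have := sqr_ge0 A; nra.
Qed.

End time_integral.

(** * Transfer of time integrals by Monte-Carlo sampling *)

Section functionals.
Context {R : realType}.
Context {dE : measure_display} {E : measurableType dE}.

Definition measurable_functional (g : (nat -> E) -> R) : Prop :=
  forall A : set R, measurable A -> cylinder [set: nat] (g @^-1` A).

Definition process {T U I : Type} (g : (nat -> E) -> R) (f : nat -> I)
    (xi : I -> T -> U -> E) (o : T) (t : U) : R := g (fun j => xi (f j) o t).

Lemma measurable_functional_comp {d} {T : measurableType d}
    (g : (nat -> E) -> R) (h : T -> nat -> E) :
  measurable_functional g -> (forall j, measurable_fun setT (h ^~ j)) ->
  measurable_fun setT (fun o => g (h o)).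
Proof.
move=> mg mh _ A mA; rewrite setTI.
exact: (@measurable_preimage_cylinder _ _ _ _ _ setT h (fun j _ => mh j) _ (mg A mA)).
Qed.

Lemma measurable_functional_clip (g : (nat -> E) -> R) M :
  measurable_functional g -> measurable_functional (clip M \o g).
Proof.
move=> mg A mA; apply: (mg (clip M @^-1` A)).
by rewrite -[X in measurable X]setTI; exact: measurable_clip.
Qed.

End functionals.

Section sampling.
Context {R : realType}.
Context {dU : measure_display} {U : measurableType dU} (nu : probability U R).
Context {dE : measure_display} {E : measurableType dE}.
Context {I : choiceType}.
Context {d} {T : measurableType d} (P : probability T R) (xi : I -> T -> U -> E).
Hypothesis iidxi : iid_paths P xi.

Lemma jmeas_process (g : (nat -> E) -> R) f :
  measurable_functional g -> jmeas (process g f xi).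
Proof.
move=> mg; apply: (measurable_functional_comp
  (h := fun (x : T * U) j => xi (f j) x.1 x.2)) => // j.
by have [m _ _] := iidxi; exact: m.
Qed.

Context {d'} {T' : measurableType d'} (P' : probability T' R)
  (xi' : I -> T' -> U -> E).
Hypothesis iidxi' : iid_paths P' xi'.

Lemma transfers_process (g : (nat -> E) -> R) f t : measurable_functional g ->
  transfers P xi P' xi' (process g f xi ^~ t) (process g f xi' ^~ t).
Proof.
move=> mg; split.
- apply: (measurable_functional_comp (h := fun o j => xi (f j) o t)) => // j.
  exact: measurable_at iidxi _ _.
- apply: (measurable_functional_comp (h := fun o j => xi' (f j) o t)) => // j.
  exact: measurable_at iidxi' _ _.
exists (fun x => g (fun j => x (f j) t)); split; [|exact: aeW|exact: aeW].
apply: (measurable_functional_comp (h := fun (x : paths) j => x (f j) t)) => // j.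
exact: measurable_eval.
Qed.

End sampling.

Definition sampling_error {R : realType} {dU} {U : measurableType dU}
    (nu : probability U R) {T : Type} (Z : T -> U -> R) (v : U -> R) (o : T) (t : U) : R :=
  Z o t * v t - Ex nu (fun s => Z o s * v s).

Lemma L2_sampling_error {R : realType}
    {dU : measure_display} {U : measurableType dU} (nu : probability U R)
    {d} {T : measurableType d} (P : probability T R) (Z : T -> U -> R) v M t :
  jmeas Z -> L2 nu v -> 0 <= M -> (forall o t, `|Z o t| <= M) ->
  L2 P (sampling_error nu Z v ^~ t).
Proof.
move=> mZ lv M0 ZM.
have mW : jmeas (fun o t => Z o t * v t).
  by apply: measurable_funM => //; apply: jmeas_time; exact: L2_meas lv.
apply: (@L2_bounded _ _ _ P _ (M * `|v t| + M * Ex nu (fun s => `|v s|))).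
  by apply: measurable_funB; [exact: (jmeas_fst t mW)|exact: measurable_tint].
move=> o; rewrite (le_trans (ler_normB _ _))// lerD//.
  by rewrite normrM ler_wpM2r.
have lW : L1 nu (fun s => Z o s * v s).
  apply: (L1_dom (jmeas_snd o mW) (L1Z M (L1_abs (L2_L1 lv)))) => s.
  by rewrite normrM ler_wpM2r.
rewrite -ExZ; last exact: L1_abs (L2_L1 lv).
apply: le_trans (Ex_abs lW) _; apply: Ex_le; first exact: L1_abs.
  exact: L1Z (L1_abs (L2_L1 lv)).
by move=> s; rewrite normrM ler_wpM2r.
Qed.

Section simultaneous_sampling.
Context {R : realType}.
Context {dU : measure_display} {U : measurableType dU} (nu : probability U R).
Context {d} {T : measurableType d} (P : probability T R).
Context {d'} {T' : measurableType d'} (P' : probability T' R).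
Variables (Z : T -> U -> R) (Z' : T' -> U -> R) (v : U -> R) (M : R).
Hypotheses (mZ : jmeas Z) (mZ' : jmeas Z') (lv : L2 nu v) (M0 : 0 <= M)
  (ZM : forall o t, `|Z o t| <= M) (ZM' : forall o t, `|Z' o t| <= M).

Let c := 2 * (M ^+ 2 * Ex nu (fun t => v t ^+ 2)) + 1.

(** A time doing no worse than the average can be chosen for both spaces at
    once; the slack 1 in [c] replaces attainment of the average. *)
Lemma good_sampling_time (S : T -> R) (S' : T' -> R) : L2 P S -> L2 P' S' ->
  exists t, Ex P (fun o => (S o + sampling_error nu Z v o t) ^+ 2) +
            Ex P' (fun o => (S' o + sampling_error nu Z' v o t) ^+ 2) <=
    Ex P (fun o => S o ^+ 2) + Ex P' (fun o => S' o ^+ 2) + c.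
Proof.
move=> lS lS'; set K := Ex P _ + Ex P' _ + c.
apply: contrapT => /forallNP no.
have h1 := average_sampling_step mZ lv M0 ZM lS.
have h2 := average_sampling_step mZ' lv M0 ZM' lS'.
have js (d0 : measure_display) (T0 : measurableType d0) (P0 : probability T0 R)
    (Z0 : T0 -> U -> R) (S0 : T0 -> R) : jmeas Z0 -> L2 P0 S0 ->
    jmeas (fun o t => (S0 o + sampling_error nu Z0 v o t) ^+ 2).
  move=> mZ0 lS0.
  have mW : jmeas (fun o t => Z0 o t * v t).
    by apply: measurable_funM => //; apply: jmeas_time; exact: L2_meas lv.
  apply: measurable_funX; apply: measurable_funD.
    exact: (jmeas_space (L2_meas lS0)).
  by apply: measurable_funB => //; exact: (jmeas_space (measurable_tint nu mW)).
have l (d0 : measure_display) (T0 : measurableType d0) (P0 : probability T0 R)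
    (Z0 : T0 -> U -> R) (S0 : T0 -> R) t : jmeas Z0 -> (forall o t, `|Z0 o t| <= M) ->
    L2 P0 S0 -> L1 P0 (fun o => (S0 o + sampling_error nu Z0 v o t) ^+ 2).
  by move=> mZ0 Z0M lS0; apply: (L2D lS0 (L2_sampling_error P0 t mZ0 lv M0 Z0M)).2.
have : (K%:E <= (Ex P (fun o => S o ^+ 2) + M ^+ 2 * Ex nu (fun t => v t ^+ 2))%:E +
   (Ex P' (fun o => S' o ^+ 2) + M ^+ 2 * Ex nu (fun t => v t ^+ 2))%:E)%E.
  apply: le_trans (leeD h1 h2).
  rewrite -ge0_integralD//; last 4 first.
  - by move=> t _; apply: integral_ge0 => o _; rewrite lee_fin sqr_ge0.
  - by apply: (measurable_moment P (js _ _ P _ _ mZ lS)) => o t; exact: sqr_ge0.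
  - by move=> t _; apply: integral_ge0 => o _; rewrite lee_fin sqr_ge0.
  - by apply: (measurable_moment P' (js _ _ P' _ _ mZ' lS')) => o t; exact: sqr_ge0.
  have -> : (K%:E = \int[nu]_t K%:E)%E.
    by rewrite (L1_integralE (L1cst nu K)) Excst.
  have cM : 0 <= M ^+ 2 * Ex nu (fun t => v t ^+ 2).
    by rewrite mulr_ge0 ?sqr_ge0// Ex_ge0// => t; exact: sqr_ge0.
  apply: ge0_le_integral => //.
  - move=> t _; rewrite lee_fin /K /c; have := nrm_sqr P S; have := nrm_sqr P' S'.
    by have := sqr_ge0 (nrm P S); have := sqr_ge0 (nrm P' S'); lra.
  - apply: emeasurable_funD.
      by apply: (measurable_moment P (js _ _ P _ _ mZ lS)) => o t; exact: sqr_ge0.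
    by apply: (measurable_moment P' (js _ _ P' _ _ mZ' lS')) => o t; exact: sqr_ge0.
  move=> t _; have := no t => /negP; rewrite -ltNge => /ltW.
  rewrite -lee_fin [in X in (_ <= X)%E -> _]EFinD.
  rewrite -(L1_integralE (l _ _ P _ _ t mZ ZM lS)).
  by rewrite -(L1_integralE (l _ _ P' _ _ t mZ' ZM' lS')).
by rewrite -EFinD lee_fin /K /c; lra.
Qed.

Lemma good_sampling_times n : exists ts : seq U, size ts = n /\
  Ex P (fun o => (\sum_(t <- ts) sampling_error nu Z v o t) ^+ 2) +
  Ex P' (fun o => (\sum_(t <- ts) sampling_error nu Z' v o t) ^+ 2) <= n%:R * c.
Proof.
elim: n => [|n [ts [<- IH]]].
  exists [::]; split => //; rewrite mul0r.
  under eq_Ex do rewrite big_nil expr0n.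
  by under [X in _ + X]eq_Ex do rewrite big_nil expr0n; rewrite !Excst addr0.
have lS : L2 P (fun o => \sum_(t <- ts) sampling_error nu Z v o t).
  by apply: L2sum => t _; exact: L2_sampling_error ZM.
have lS' : L2 P' (fun o => \sum_(t <- ts) sampling_error nu Z' v o t).
  by apply: L2sum => t _; exact: L2_sampling_error ZM'.
have [t ht] := good_sampling_time lS lS'.
exists (t :: ts); split => //.
under eq_Ex do rewrite big_cons addrC.
under [X in _ + X]eq_Ex do rewrite big_cons addrC.
by apply: le_trans ht _; rewrite /= -natr1 mulrDl mul1r lerD2r.
Qed.

End simultaneous_sampling.

Section transfer_of_time_integrals.
Context {R : realType}.
Context {dU : measure_display} {U : measurableType dU} (nu : probability U R).
Context {dE : measure_display} {E : measurableType dE}.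
Context {I : choiceType}.
Context {d} {T : measurableType d} (P : probability T R) (xi : I -> T -> U -> E).
Hypothesis iidxi : iid_paths P xi.
Context {d'} {T' : measurableType d'} (P' : probability T' R)
  (xi' : I -> T' -> U -> E).
Hypothesis iidxi' : iid_paths P' xi'.

Lemma measurable_process_integral d0 (T0 : measurableType d0) (P0 : probability T0 R)
    (xi0 : I -> T0 -> U -> E) (g : (nat -> E) -> R) f v : iid_paths P0 xi0 ->
  measurable_functional g -> L2 nu v ->
  measurable_fun setT (fun o => Ex nu (fun t => process g f xi0 o t * v t)).
Proof.
move=> iid0 mg lv; apply: (measurable_tint nu (Z := fun o t => process g f xi0 o t * v t)).
apply: measurable_funM; first exact: (jmeas_process iid0 f mg).
by apply: jmeas_time; exact: L2_meas lv.
Qed.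

(** The time integral is not a function of finitely many path values, but it is
    the almost sure limit of Monte-Carlo averages over deterministic times that
    serve both spaces. *)
Lemma transfers_bounded_integral (g : (nat -> E) -> R) f (v : U -> R) (M : R) :
  measurable_functional g -> 0 <= M -> (forall x, `|g x| <= M) -> L2 nu v ->
  transfers P xi P' xi' (fun o => Ex nu (fun t => process g f xi o t * v t))
    (fun o => Ex nu (fun t => process g f xi' o t * v t)).
Proof.
move=> mg M0 gM lv.
have mZ := jmeas_process iidxi f mg; have mZ' := jmeas_process iidxi' f mg.
pose c := 2 * (M ^+ 2 * Ex nu (fun t => v t ^+ 2)) + 1.
have c0 : 0 <= c.
  by rewrite addr_ge0// !mulr_ge0 ?sqr_ge0// Ex_ge0// => t; exact: sqr_ge0.
(* The sample sizes grow geometrically, for the mean squared errors to be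
   summable. *)
have /choice[ts hts] k := good_sampling_times P P' mZ mZ' lv M0
  (fun o t => gM _) (fun o t => gM _) (2 ^ k)%N.
pose mean (T0 : Type) (Z0 : T0 -> U -> R) k o :=
  (2 ^ k)%:R^-1 * \sum_(t <- ts k) Z0 o t * v t.
have n0 k : 0 < (2 ^ k)%:R :> R by rewrite ltr0n expn_gt0.
have meanE (T0 : Type) (Z0 : T0 -> U -> R) k o :
    mean T0 Z0 k o - Ex nu (fun t => Z0 o t * v t) =
    (2 ^ k)%:R^-1 * \sum_(t <- ts k) sampling_error nu Z0 v o t.
  rewrite /mean /sampling_error sumrB mulrBr; congr (_ - _).
  rewrite big_const_seq count_predT (hts k).1 iter_addr_0.
  rewrite -[Ex _ _ *+ _]mulr_natl mulrA.
  by rewrite mulVf ?mul1r// gt_eqF.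
have cv d0 (T0 : measurableType d0) (P0 : probability T0 R) (Z0 : T0 -> U -> R) :
    jmeas Z0 -> (forall o t, `|Z0 o t| <= M) ->
    (forall k, Ex P0 (fun o => (\sum_(t <- ts k) sampling_error nu Z0 v o t) ^+ 2) <=
       (2 ^ k)%:R * c) ->
    {ae P0, forall o, mean T0 Z0 k o @[k --> \oo] --> Ex nu (fun t => Z0 o t * v t)}.
  move=> mZ0 Z0M hZ0.
  pose D k o := (2 ^ k)%:R^-1 * \sum_(t <- ts k) sampling_error nu Z0 v o t.
  have lD0 k : L2 P0 (fun o => \sum_(t <- ts k) sampling_error nu Z0 v o t).
    by apply: L2sum => t _; exact: L2_sampling_error Z0M.
  have lD k : L2 P0 (D k) by apply: L2Z.
  have ED k : Ex P0 (fun o => D k o ^+ 2) <= c * 2^-1 ^+ k.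
    rewrite /D; under eq_Ex do rewrite exprMn.
    rewrite ExZ ?(lD0 k).2// -(@ler_pM2l _ ((2 ^ k)%:R ^+ 2)) ?exprn_gt0//.
    rewrite mulrA -exprMn mulfV ?gt_eqF// expr1n mul1r (le_trans (hZ0 k))//.
    rewrite expr2 -mulrA ler_wpM2l ?(ltW (n0 k))//.
    have N0 : (2 ^ k)%:R != 0 :> R by rewrite gt_eqF.
    by rewrite mulrCA exprVn -natrX mulfV// mulr1.
  have sumD n : \sum_(i < n) Ex P0 (fun o => D i o ^+ 2) <= 2 * c.
    apply: (@le_trans _ _ (\sum_(i < n) c * 2^-1 ^+ i)); first exact: ler_sum.
    have -> : \sum_(i < n) c * 2^-1 ^+ i = 2 * c - 2 * c * 2^-1 ^+ n.
      elim: n => [|n IH]; first by rewrite big_ord0 expr0 mulr1 subrr.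
      by rewrite big_ord_recr /= IH exprS; field.
    rewrite gerBl; apply: mulr_ge0; first by rewrite mulr_ge0.
    by rewrite exprn_ge0// invr_ge0.
  apply: filterS (ae_cvg0_summable_nrm lD sumD) => o Do.
  apply/subr_cvg0; rewrite (_ : (fun k => _) = D ^~ o)//.
  by apply/funext => k; exact: meanE.
apply: (transfers_lim (F := mean T (process g f xi)) (F' := mean T' (process g f xi'))).
- exact: measurable_process_integral iidxi mg lv.
- exact: measurable_process_integral iidxi' mg lv.
- move=> k; apply: transfersM; first exact: transfers_cst.
  elim: (ts k) => [|t s IH].
    have nil0 (T0 : Type) (h : T0 -> U -> R) :
        (fun o => \sum_(t <- [::]) h o t) = fun=> 0.
      by apply/funext => o; rewrite big_nil.
    by rewrite !nil0; exact: transfers_cst.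
  have cons0 (T0 : Type) (h : T0 -> U -> R) :
      (fun o => \sum_(t <- t :: s) h o t) =
      fun o => h o t + \sum_(t <- s) h o t.
    by apply/funext => o; rewrite big_cons.
  rewrite !cons0; apply: transfersD => //; apply: transfersM.
    exact: (transfers_process iidxi iidxi' f t mg).
  exact: transfers_cst.
- apply: (cv _ _ _ _ mZ (fun o t => gM _)) => k; apply: le_trans _ (hts k).2.
  by rewrite lerDl; apply: Ex_ge0 => o; exact: sqr_ge0.
apply: (cv _ _ _ _ mZ' (fun o t => gM _)) => k; apply: le_trans _ (hts k).2.
by rewrite lerDr; apply: Ex_ge0 => o; exact: sqr_ge0.
Qed.

(** Clipping the functional reduces to the bounded case, by dominated convergence
    in time. *)
Lemma transfers_integral_process (g : (nat -> E) -> R) f (v : U -> R) :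
  measurable_functional g -> L2 nu v ->
  {ae P, forall o, L1 nu (fun t => process g f xi o t * v t)} ->
  {ae P', forall o, L1 nu (fun t => process g f xi' o t * v t)} ->
  transfers P xi P' xi' (fun o => Ex nu (fun t => process g f xi o t * v t))
    (fun o => Ex nu (fun t => process g f xi' o t * v t)).
Proof.
move=> mg lv l l'.
have cv d0 (T0 : measurableType d0) (P0 : probability T0 R) (xi0 : I -> T0 -> U -> E) :
    iid_paths P0 xi0 ->
    {ae P0, forall o, L1 nu (fun t => process g f xi0 o t * v t)} ->
    {ae P0, forall o, Ex nu (fun t => process (clip n%:R \o g) f xi0 o t * v t)
      @[n --> \oo] --> Ex nu (fun t => process g f xi0 o t * v t)}.
  move=> iid0; apply: filterS => o lo.
  apply: (Ex_dominated_cvg (H := fun t => `|process g f xi0 o t * v t|)).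
  - move=> n; apply: measurable_funM; last exact: L2_meas lv.
    apply: (jmeas_snd o (Z := process (clip n%:R \o g) f xi0)).
    exact: (jmeas_process iid0 f (measurable_functional_clip n%:R mg)).
  - exact: L1_meas lo.
  - exact: L1_abs.
  - by move=> t; apply: cvgMl; exact: clip_cvg.
  - by move=> n t; rewrite !normrM ler_wpM2r//; exact: clip_le_abs.
apply: (transfers_lim
  (F := fun n o => Ex nu (fun t => process (clip n%:R \o g) f xi o t * v t))
  (F' := fun n o => Ex nu (fun t => process (clip n%:R \o g) f xi' o t * v t))).
- exact: measurable_process_integral iidxi mg lv.
- exact: measurable_process_integral iidxi' mg lv.
- move=> n; apply: (@transfers_bounded_integral _ _ _ n%:R) => //.
    exact: measurable_functional_clip.
  by move=> x; apply: clip_le; exact: ler0n.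
- exact: cv.
exact: cv.
Qed.

End transfer_of_time_integrals.

(** * Independence through a product space *)

Section splitting.
Context {R : realType}.
Context {dU : measure_display} {U : measurableType dU}.
Context {dE : measure_display} {E : measurableType dE}.
Context {I : choiceType}.
Context {d} {T : measurableType d} (P : probability T R) (xi : I -> T -> U -> E).
Hypothesis iidxi : iid_paths P xi.

Local Notation PP := (P \x P)%E.

(** Reading the paths indexed by [J] on a first copy of the sample space and the
    other ones on a second copy leaves the law of the family unchanged; this
    turns independence into Fubini's theorem. *)
Definition split_paths (J : pred I) (i : I) (o : T * T) : U -> E :=
  if J i then xi i o.1 else xi i o.2.

Lemma split_preimage J i A : split_paths J i @^-1` A =
  (if J i then xi i @^-1` A else setT) `*` (if J i then setT else xi i @^-1` A).
Proof.
rewrite /split_paths; case: ifP => Ji; apply/seteqP; split => -[x1 x2] /=.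
- by [].
- by case.
- by [].
by case.
Qed.

Lemma split_paths_marginal J i A : total_cylinder A ->
  PP (split_paths J i @^-1` A) = P (xi i @^-1` A).
Proof.
move=> cA; have mA j : measurable (xi j @^-1` A) by exact: (measurable_path_event iidxi j cA).
rewrite split_preimage; case: ifP => Ji; rewrite product_measure1E//.
  by rewrite -[RHS]mule1; congr (_ * _)%E; exact: probability_setT.
by rewrite -[RHS]mul1e; congr (_ * _)%E; exact: probability_setT.
Qed.

Lemma iid_split_paths J : iid_paths PP (split_paths J).
Proof.
have [mxi lxi pxi] := iidxi.
split.
- move=> i; rewrite /split_paths; case: (J i).
    rewrite (_ : (fun x => _) =
      (fun x : T * U => xi i x.1 x.2) \o (fun x : T * T * U => (x.1.1, x.2)))//.
    apply: (measurableT_comp (mxi i)); apply: measurable_fun_pair => //.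
    exact: (measurableT_comp measurable_fst).
  rewrite (_ : (fun x => _) =
    (fun x : T * U => xi i x.1 x.2) \o (fun x : T * T * U => (x.1.2, x.2)))//.
  apply: (measurableT_comp (mxi i)); apply: measurable_fun_pair => //.
  exact: (measurableT_comp measurable_snd).
- move=> i j A cA; rewrite [LHS](split_paths_marginal J i cA).
  by rewrite [RHS](split_paths_marginal J j cA); exact: lxi.
move=> S A cA.
pose A1 j := if J j then A j else setT.
pose A2 j := if J j then setT else A j.
have cA1 j : total_cylinder (A1 j).
  by rewrite /A1; case: ifP => // _; rewrite total_cylinderE; exact: measurableT.
have cA2 j : total_cylinder (A2 j).
  by rewrite /A2; case: ifP => // _; rewrite total_cylinderE; exact: measurableT.
have -> : \bigcap_(j in [set` S]) split_paths J j @^-1` A j =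
   (\bigcap_(j in [set` S]) xi j @^-1` A1 j) `*`
   (\bigcap_(j in [set` S]) xi j @^-1` A2 j).
  apply/seteqP; split => -[x1 x2] /=.
    move=> h; split => j jS; have := h j jS; rewrite /split_paths /A1 /A2 /=;
    by case: ifP.
  move=> [h1 h2] j jS; have := h1 j jS; have := h2 j jS.
  by rewrite /split_paths /A1 /A2 /=; case: ifP.
have mS B : (forall j, total_cylinder (B j)) ->
    measurable (\bigcap_(j in [set` S]) xi j @^-1` B j).
  move=> cB; apply: fin_bigcap_measurable => // j _.
  exact: (measurable_path_event iidxi j (cB j)).
rewrite [LHS]product_measure1E; [|exact: mS|exact: mS].
rewrite [X in (X * _)%E](pxi S A1 cA1) [X in (_ * X)%E](pxi S A2 cA2).
rewrite -big_split/=; apply: eq_bigr => j _.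
rewrite [RHS](split_paths_marginal J j (cA j)) /A1 /A2; case: ifP => _.
  by rewrite preimage_setT -[RHS]mule1; congr (_ * _)%E; exact: probability_setT.
by rewrite preimage_setT -[RHS]mul1e; congr (_ * _)%E; exact: probability_setT.
Qed.

Lemma split_same_marginals J i A : total_cylinder A ->
  P (xi i @^-1` A) = PP (split_paths J i @^-1` A).
Proof. by move=> cA; rewrite [RHS](split_paths_marginal J i cA). Qed.

(** [F] is almost surely a functional of the paths indexed by [J]. *)
Definition lives_in (J : pred I) (F : T -> R) : Prop :=
  transfers P xi PP (split_paths J) F (F \o fst).

Definition lives_out (J : pred I) (F : T -> R) : Prop :=
  transfers P xi PP (split_paths J) F (F \o snd).

Lemma Ex_product_space F G : L1 P F -> L1 P G ->
  Ex PP (fun o => F o.1 * G o.2) = Ex P F * Ex P G.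
Proof.
move=> iF iG.
have mF := L1_meas iF; have mG := L1_meas iG.
have mFG : measurable_fun setT (fun o : T * T => (F o.1 * G o.2)%:E).
  apply/measurable_EFinP; apply: measurable_funM.
    exact: (measurableT_comp mF measurable_fst).
  exact: (measurableT_comp mG measurable_snd).
have inner x : (\int[P]_y (F x * G y)%:E = (F x * Ex P G)%:E)%E.
  by rewrite -ExZ// -L1_integralE//; exact: L1Z.
have innerabs x : (\int[P]_y `|(F x * G y)%:E| =
    (`|F x| * Ex P (fun o => `|G o|))%:E)%E.
  rewrite -ExZ//; last exact: L1_abs.
  rewrite -L1_integralE//; last by apply: L1Z; exact: L1_abs.
  by apply: eq_integral => y _ /=; rewrite normrM.
have iFG : PP.-integrable setT (fun o : T * T => (F o.1 * G o.2)%:E).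
  apply/(@integrable12ltyP _ _ _ _ _ P P _ mFG) => /=.
  under eq_integral do rewrite innerabs.
  have lF : L1 P (fun x => `|F x| * Ex P (fun o => `|G o|)).
    rewrite (@eq_L1 _ _ _ P _ (fun x => Ex P (fun o => `|G o|) * `|F x|)).
      by apply: L1Z; exact: L1_abs.
    by move=> o; rewrite mulrC.
  by rewrite L1_integralE// ltry.
rewrite /Ex /Rintegral -(integral12_prod_meas1 iFG) /=.
under eq_integral do rewrite /fubini_F /= inner.
have lF : L1 P (fun x => F x * Ex P G).
  rewrite (@eq_L1 _ _ _ P _ (fun x => Ex P G * F x)); first exact: L1Z.
  by move=> o; rewrite mulrC.
rewrite L1_integralE//= -[RHS]mulrC -ExZ//.
by apply: eq_Ex => o; rewrite mulrC.
Qed.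

Lemma independent_Ex J F G : lives_in J F -> lives_out J G -> L1 P F -> L1 P G ->
  Ex P (fun o => F o * G o) = Ex P F * Ex P G.
Proof.
move=> lF lG iF iG.
have t := transfersM lF lG.
rewrite (transfers_Ex iidxi (iid_split_paths J) (split_same_marginals J) t).
exact: Ex_product_space.
Qed.

End splitting.

(** * Scores and fourth moments *)

Section ae_L2.
Context {R : realType} {d} {T : measurableType d} (P : probability T R).

Lemma ae_L1_le (F G : T -> R) : measurable_fun setT F -> L1 P G ->
  {ae P, forall o, `|F o| <= G o} -> L1 P F /\ Ex P (fun o => `|F o|) <= Ex P G.
Proof.
move=> mF lG FG; have mG := L1_meas lG.
have mF' : measurable_fun setT (fun o => `|F o|) by exact: measurableT_comp.
have [|l le] := @ge0_L1_le _ _ _ P (fun o => `|F o|) (Ex P (fun o => `|G o|)) mF' (fun o => normr_ge0 _).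
  rewrite -(L1_integralE (L1_abs lG)).
  apply: ae_ge0_le_integral => //.
  - exact/measurable_EFinP.
  - by apply/measurable_EFinP; exact: measurableT_comp.
  by apply: filterS FG => o h _; rewrite lee_fin (le_trans h)// ler_norm.
split.
  by apply: (L1_dom mF l) => o.
apply: le_trans le _.
have G0 : {ae P, forall o, 0 <= G o} by apply: filterS FG => o; exact: le_trans.
rewrite le_eqVlt; apply/orP; left; apply/eqP.
rewrite /Ex /Rintegral; congr fine; apply: ae_eq_integral => //.
- by apply/measurable_EFinP; exact: measurableT_comp.
- exact/measurable_EFinP.
by apply: filterS G0 => o h _ /=; rewrite ger0_norm.
Qed.

Lemma ae_eq_Ex (F G : T -> R) : measurable_fun setT F -> measurable_fun setT G ->
  {ae P, forall o, F o = G o} -> Ex P F = Ex P G.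
Proof.
move=> mF mG FG; rewrite /Ex /Rintegral; congr fine; apply: ae_eq_integral => //.
- exact/measurable_EFinP.
- exact/measurable_EFinP.
by apply: filterS FG => o h _ /=; rewrite h.
Qed.

Lemma ae_eq_nrm (F G : T -> R) : measurable_fun setT F -> measurable_fun setT G ->
  {ae P, forall o, F o = G o} -> nrm P F = nrm P G.
Proof.
move=> mF mG FG; rewrite /nrm; congr Num.sqrt; apply: ae_eq_Ex.
- exact: measurable_funX.
- exact: measurable_funX.
by apply: filterS FG => o ->.
Qed.

End ae_L2.

Section fourth_moments.
Context {R : realType}.
Context {dU : measure_display} {U : measurableType dU} (nu : probability U R).
Context {d : measure_display} {T : measurableType d} (P : probability T R).
Implicit Types Z X Y : T -> U -> R.

Definition fourth_moment Z : \bar R := (\int[P]_o \int[nu]_t (Z o t ^+ 4)%:E)%E.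

(** The bound is a fourth power so that [c] scales like a norm. *)
Definition fourth_le Z (c : R) : Prop :=
  [/\ jmeas Z, 0 <= c & (fourth_moment Z <= (c ^+ 4)%:E)%E].

Definition inn Z (v : U -> R) (o : T) : R := Ex nu (fun t => Z o t * v t).

Definition energy Z (o : T) : R := Ex nu (fun t => Z o t ^+ 2).

Lemma sqr_sqr (x : R) : (x ^+ 2) ^+ 2 = x ^+ 4.
Proof. by rewrite -exprM. Qed.

Lemma fourth_ge0 (x : R) : 0 <= x ^+ 4.
Proof. by rewrite -sqr_sqr sqr_ge0. Qed.

Lemma jmeasX Z n : jmeas Z -> jmeas (fun o t => Z o t ^+ n).
Proof. by move=> mZ; exact: measurable_funX. Qed.

Lemma jmeasM Z X : jmeas Z -> jmeas X -> jmeas (fun o t => Z o t * X o t).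
Proof. by move=> mZ mX; exact: measurable_funM. Qed.

Lemma jmeasB Z X : jmeas Z -> jmeas X -> jmeas (fun o t => Z o t - X o t).
Proof. by move=> mZ mX; exact: measurable_funB. Qed.

Lemma measurable_inn Z v : jmeas Z -> measurable_fun setT v ->
  measurable_fun setT (inn Z v).
Proof.
move=> mZ mv; apply: (measurable_tint nu (Z := fun o t => Z o t * v t)).
by apply: jmeasM => //; exact: jmeas_time.
Qed.

Lemma fourth_le_ae Z c : fourth_le Z c ->
  {ae P, forall o, L2 nu (Z o) /\ L1 nu (fun t => Z o t ^+ 4)}.
Proof.
move=> [mZ c0 Zc].
have m4 : measurable_fun setT (fun o => \int[nu]_t (Z o t ^+ 4)%:E)%E.
  apply: (measurable_fun_fubini_tonelli_F (fun x : T * U => (Z x.1 x.2 ^+ 4)%:E)).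
    by apply/measurable_EFinP; exact: jmeasX.
  by move=> x; rewrite lee_fin fourth_ge0.
have p4 o : (0 <= \int[nu]_t (Z o t ^+ 4)%:E)%E.
  by apply: integral_ge0 => t _; rewrite lee_fin fourth_ge0.
have i4 : P.-integrable setT (fun o => \int[nu]_t (Z o t ^+ 4)%:E)%E.
  apply/integrableP; split => //.
  under eq_integral => o _ do rewrite gee0_abs//.
  exact: le_lt_trans Zc (ltry _).
apply: filterS (integrable_ae measurableT i4) => o /(_ Logic.I) fin.
have mo := jmeas_snd o mZ.
have l4 : L1 nu (fun t => Z o t ^+ 4).
  apply: ge0_L1; first exact: measurable_funX.
    by move=> t; exact: fourth_ge0.
  by move: fin; rewrite fin_numE => /andP[_]; rewrite ltey.
split => //; split => //; have : L2 nu (fun t => Z o t ^+ 2).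
  split; first exact: measurable_funX.
  by rewrite (eq_L1 nu (fun t => sqr_sqr (Z o t))).
exact: L2_L1.
Qed.

(** Jensen's inequality in time. *)
Lemma energy_nrm Z c : fourth_le Z c ->
  L2 P (energy Z) /\ nrm P (energy Z) <= c ^+ 2.
Proof.
move=> fZ; have [mZ c0 Zc] := fZ.
have mE : measurable_fun setT (energy Z).
  by apply: (measurable_tint nu (Z := fun o t => Z o t ^+ 2)); exact: jmeasX.
have [l le] : L1 P (fun o => energy Z o ^+ 2) /\ Ex P (fun o => energy Z o ^+ 2) <= c ^+ 4.
  apply: ge0_L1_le; [exact: measurable_funX|by move=> o; exact: sqr_ge0|].
  apply: le_trans Zc; apply: ae_ge0_le_integral => //.
  - by move=> o _; rewrite lee_fin sqr_ge0.
  - by apply/measurable_EFinP; exact: measurable_funX.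
  - by move=> o _; apply: integral_ge0 => t _; rewrite lee_fin fourth_ge0.
  - apply: (measurable_fun_fubini_tonelli_F (fun x : T * U => (Z x.1 x.2 ^+ 4)%:E)).
      by apply/measurable_EFinP; exact: jmeasX.
    by move=> x; rewrite lee_fin fourth_ge0.
  apply: filterS (fourth_le_ae fZ) => o [lo l4] _.
  rewrite L1_integralE// lee_fin.
  have l2 : L2 nu (fun t => Z o t ^+ 2).
    split; first by apply: measurable_funX; case: lo.
    by rewrite (eq_L1 nu (fun t => sqr_sqr (Z o t))).
  have := cauchy_schwarz_Ex l2 (L2cst nu 1).
  rewrite (eq_Ex nu (G := fun t => Z o t ^+ 2)); last by move=> t; rewrite mulr1.
  have -> : nrm nu (fun=> 1) = 1.
    by rewrite /nrm; under eq_Ex do rewrite expr1n; rewrite Excst sqrtr1.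
  rewrite mulr1 => /sqr_le_norm /le_trans; apply; rewrite nrm_sqr.
  by rewrite (eq_Ex nu (fun t => sqr_sqr (Z o t))).
split; first by split.
by apply: nrm_le; [exact: sqr_ge0|rewrite sqr_sqr].
Qed.

Lemma inn_sqr_le Z v o : L2 nu (Z o) -> L2 nu v ->
  inn Z v o ^+ 2 <= energy Z o * nrm nu v ^+ 2.
Proof.
move=> lZ lv; have := cauchy_schwarz_Ex lZ lv => /sqr_le_norm.
by rewrite exprMn (nrm_sqr nu (Z o)).
Qed.

(** Two Cauchy-Schwarz inequalities, in time and then over the sample space,
    are the reason for which fourth moments are the natural hypothesis. *)
Lemma inn_mul_nrm X Y v w c e : fourth_le X c -> fourth_le Y e ->
  L2 nu v -> L2 nu w ->
  L2 P (fun o => inn X v o * inn Y w o) /\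
  nrm P (fun o => inn X v o * inn Y w o) <= c * e * (nrm nu v * nrm nu w).
Proof.
move=> fX fY lv lw.
have [mX c0 _] := fX; have [mY e0 _] := fY.
have [lEX nX] := energy_nrm fX; have [lEY nY] := energy_nrm fY.
have mI : measurable_fun setT (fun o => inn X v o * inn Y w o).
  by apply: measurable_funM; [exact: measurable_inn mX (L2_meas lv)|
    exact: measurable_inn mY (L2_meas lw)].
pose k := (nrm nu v * nrm nu w) ^+ 2.
have lG := L1Z k (L2M lEX lEY).
have [|l le] := @ae_L1_le _ _ _ P (fun o => (inn X v o * inn Y w o) ^+ 2) _
    (measurable_funX 2 mI) lG.
  apply: filterS2 (fourth_le_ae fX) (fourth_le_ae fY) => o [lX _] [lY _].
  rewrite ger0_norm ?sqr_ge0// exprMn.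
  have hX := inn_sqr_le lX lv; have hY := inn_sqr_le lY lw.
  rewrite (_ : k * _ = (energy X o * nrm nu v ^+ 2) * (energy Y o * nrm nu w ^+ 2)).
    by apply: ler_pM => //; exact: sqr_ge0.
  by rewrite /k; ring.
split; first by split.
apply: nrm_le; first by rewrite !mulr_ge0// nrm_ge0.
under eq_Ex => o do rewrite -[_ ^+ 2]ger0_norm ?sqr_ge0//.
apply: le_trans le _; rewrite ExZ; last exact: L2M.
rewrite exprMn mulrC ler_wpM2r ?sqr_ge0//.
apply: le_trans (ler_norm _) _; apply: le_trans (cauchy_schwarz_Ex lEX lEY) _.
by rewrite exprMn ler_pM ?nrm_ge0.
Qed.

Lemma innB X Y v o : L2 nu (X o) -> L2 nu (Y o) -> L2 nu v ->
  inn (fun o t => X o t - Y o t) v o = inn X v o - inn Y v o.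
Proof.
move=> lX lY lv; rewrite /inn -ExB; [|exact: L2M|exact: L2M].
by apply: eq_Ex => t; rewrite mulrBl.
Qed.

(** The common form of the entries of gamma: [v] tests the regressor, [w] the
    noise, and [u] is the part of a row of the regression operator that is left
    out by the first basis functions. *)
Definition score (X Y : T -> U -> R) (v w u : U -> R) (o : T) : R :=
  inn X v o * inn Y w o + inn X v o * inn X u o.

Lemma score_L2 X Y v w u c : fourth_le X c -> fourth_le Y c ->
  L2 nu v -> L2 nu w -> L2 nu u -> L2 P (score X Y v w u).
Proof.
move=> fX fY lv lw lu; apply: L2D.
  by case: (inn_mul_nrm fX fY lv lw).
by case: (inn_mul_nrm fX fX lv lu).
Qed.

(** The factors of each product are replaced one at a time. *)
Lemma score_diff_nrm X Y X' Y' v w u c al be :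
  fourth_le X c -> fourth_le Y c -> fourth_le X' c -> fourth_le Y' c ->
  fourth_le (fun o t => X o t - X' o t) al ->
  fourth_le (fun o t => Y o t - Y' o t) be ->
  L2 nu v -> L2 nu w -> L2 nu u ->
  nrm P (fun o => score X Y v w u o - score X' Y' v w u o) <=
  c * (nrm nu v * nrm nu w + 2 * (nrm nu v * nrm nu u)) * (al + be).
Proof.
move=> fX fY fX' fY' fdX fdY lv lw lu.
have [mX c0 _] := fX; have [mY _ _] := fY; have [mX' _ _] := fX'; have [mY' _ _] := fY'.
have [mdX al0 _] := fdX; have [mdY be0 _] := fdY.
have [l1 n1] := inn_mul_nrm fdX fY lv lw.
have [l2 n2] := inn_mul_nrm fX' fdY lv lw.
have [l3 n3] := inn_mul_nrm fdX fX lv lu.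
have [l4 n4] := inn_mul_nrm fX' fdX lv lu.
have lS := score_L2 fX fY lv lw lu; have lS' := score_L2 fX' fY' lv lw lu.
have l12 := L2D l1 l2; have l34 := L2D l3 l4; have l14 := L2D l12 l34.
rewrite (@ae_eq_nrm _ _ _ P _ _ (L2_meas (L2B lS lS')) (L2_meas l14)).
  apply: le_trans (nrmD l12 l34) _.
  apply: le_trans (lerD (nrmD l1 l2) (nrmD l3 l4)) _.
  apply: le_trans (lerD (lerD n1 n2) (lerD n3 n4)) _.
  have v0 := nrm_ge0 nu v; have w0 := nrm_ge0 nu w; have u0 := nrm_ge0 nu u.
  rewrite -subr_ge0 (_ : _ - _ = c * be * (2 * (nrm nu v * nrm nu u))); last by ring.
  by rewrite !mulr_ge0.
apply: filterS3 (fourth_le_ae fX) (fourth_le_ae fX')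
  (filterI (fourth_le_ae fY) (fourth_le_ae fY')) => o [lX _] [lX' _] [[lY _] [lY' _]].
rewrite !innB// /score; ring.
Qed.

End fourth_moments.

(** * Laws of scores *)

Section score_laws.
Context {R : realType}.
Context {dU : measure_display} {U : measurableType dU} (nu : probability U R).
Context {dE : measure_display} {E : measurableType dE}.

Lemma iid_reindex {I I' : choiceType} {d} {T : measurableType d}
    (P : probability T R) (xi : I -> T -> U -> E) (s : I' -> I) :
  injective s -> iid_paths P xi -> iid_paths P (fun i => xi (s i)).
Proof.
move=> s_inj [mxi lxi pxi]; split => [i|i j A cA|J A cA]; first exact: mxi.
  exact: lxi.
pose A' i := [set p | forall j, s j = i -> A j p].
have A'E j : A' (s j) = A j.
  apply/seteqP; split => p /=; first exact.
  by move=> Ap k /s_inj ->.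
have cA' i : total_cylinder (A' i).
  have [[j ji]|no] := pselect (exists j, s j = i).
    by rewrite -ji A'E; exact: cA.
  rewrite (_ : A' i = setT); first by rewrite total_cylinderE; exact: measurableT.
  by apply/seteqP; split => // p _ j ji; exfalso; apply: no; exists j.
have -> : \bigcap_(j in [set` J]) xi (s j) @^-1` A j =
    \bigcap_(i in [set` (s @` J)%fset]) xi i @^-1` A' i.
  apply/seteqP; split => o h.
    by move=> i /= /imfsetP[j /= jJ ->]; rewrite /preimage/= A'E; exact: h.
  move=> j jJ; have := h (s j); rewrite /preimage /= A'E; apply.
  by apply/imfsetP; exists j.
rewrite pxi// big_imfset /=; last by move=> i j _ _; exact: s_inj.
by apply: eq_bigr => j _; rewrite A'E.
Qed.

Lemma same_marginals_reindex {I I1 : choiceType} {d} {T : measurableType d}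
    (P : probability T R) (xi : I -> T -> U -> E) (s s' : I1 -> I) :
  iid_paths P xi -> forall i A, total_cylinder A ->
  P (xi (s i) @^-1` A) = P (xi (s' i) @^-1` A).
Proof. by move=> [_ l _] i A cA; exact: l. Qed.

(** Once the integrals are exchanged, only the law of the process at a fixed time
    matters. *)
Lemma fourth_moment_transfer {I : choiceType}
    {d} {T : measurableType d} (P : probability T R) (xi : I -> T -> U -> E)
    {d'} {T' : measurableType d'} (P' : probability T' R) (xi' : I -> T' -> U -> E)
    (g : (nat -> E) -> R) f :
  iid_paths P xi -> iid_paths P' xi' ->
  (forall i A, total_cylinder A -> P (xi i @^-1` A) = P' (xi' i @^-1` A)) ->
  measurable_functional g ->
  fourth_moment nu P (process g f xi) = fourth_moment nu P' (process g f xi').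
Proof.
move=> iid iid' marg mg; rewrite /fourth_moment.
have j4 d0 (T0 : measurableType d0) (P0 : probability T0 R) (xi0 : I -> T0 -> U -> E) :
    iid_paths P0 xi0 -> jmeas (fun o t => process g f xi0 o t ^+ 4).
  by move=> iid0; apply: jmeasX; exact: (jmeas_process iid0 f mg).
rewrite -(tonelli nu P (j4 _ _ _ _ iid)); last by move=> *; exact: fourth_ge0.
rewrite -(tonelli nu P' (j4 _ _ _ _ iid')); last by move=> *; exact: fourth_ge0.
apply: eq_integral => t _.
apply: (transfers_integral iid iid' marg).
apply: (transfers_comp (g := fun x => x ^+ 4)); first exact: exprn_measurable.
exact: (transfers_process iid iid' f t mg).
Qed.

Variables (a b : (nat -> E) -> R).
Hypotheses (ma : measurable_functional a) (mb : measurable_functional b).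

(** Since [f] selects the innovations that are read, coupling, time shifts and
    exchanges of innovations are all changes of [f]. *)
Definition gam {I : Type} {d} {T : measurableType d} (xi : I -> T -> U -> E)
    (v w u : U -> R) (f : nat -> I) : T -> R :=
  score nu (process a f xi) (process b f xi) v w u.

Lemma transfers_score {I : choiceType}
    {d} {T : measurableType d} (P : probability T R) (xi : I -> T -> U -> E)
    {d'} {T' : measurableType d'} (P' : probability T' R) (xi' : I -> T' -> U -> E)
    f v w u c :
  iid_paths P xi -> iid_paths P' xi' ->
  (forall i A, total_cylinder A -> P (xi i @^-1` A) = P' (xi' i @^-1` A)) ->
  fourth_le nu P (process a f xi) c -> fourth_le nu P (process b f xi) c ->
  L2 nu v -> L2 nu w -> L2 nu u ->
  transfers P xi P' xi' (gam xi v w u f) (gam xi' v w u f).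
Proof.
move=> iid iid' marg fa fb lv lw lu.
have tr g h : measurable_functional g -> fourth_le nu P (process g f xi) c ->
    L2 nu h -> transfers P xi P' xi' (inn nu (process g f xi) h)
      (inn nu (process g f xi') h).
  move=> mg fg lh.
  have fg' : fourth_le nu P' (process g f xi') c.
    have [_ c0 le] := fg; split => //; first exact: (jmeas_process iid' f mg).
    by rewrite -(fourth_moment_transfer f iid iid' marg mg).
  apply: (@transfers_integral_process _ _ _ nu _ _ _ _ _ P xi iid _ _ P' xi' iid' g f h mg lh).
    by apply: filterS (fourth_le_ae fg) => o [lo _]; exact: L2M.
  by apply: filterS (fourth_le_ae fg') => o [lo _]; exact: L2M.
by apply: transfersD; apply: transfersM; apply: tr.
Qed.

Section base.
Context {I : choiceType} {d} {T : measurableType d} (P : probability T R).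
Variable xi : I -> T -> U -> E.
Hypothesis iidxi : iid_paths P xi.
Variables (c : R) (f0 : nat -> I).
Hypotheses (f0_inj : injective f0).
Hypotheses (fa : fourth_le nu P (process a f0 xi) c)
  (fb : fourth_le nu P (process b f0 xi) c).

Lemma fourth_le_inj g f : measurable_functional g ->
  fourth_le nu P (process g f0 xi) c -> injective f ->
  fourth_le nu P (process g f xi) c.
Proof.
move=> mg [_ c0 le] finj; split; [exact: (jmeas_process iidxi f mg)|exact: c0|].
have e : fourth_moment nu P (process g f xi) = fourth_moment nu P (process g f0 xi).
  exact: (@fourth_moment_transfer _ _ _ P (fun i => xi (f i)) _ _ P
    (fun i => xi (f0 i)) g id (iid_reindex finj iidxi) (iid_reindex f0_inj iidxi)
    (same_marginals_reindex f f0 iidxi) mg).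
by rewrite e.
Qed.

Variables (v w u : U -> R).
Hypotheses (lv : L2 nu v) (lw : L2 nu w) (lu : L2 nu u).

Local Notation G := (gam xi v w u).

Lemma L2_gam f : injective f -> L2 P (G f).
Proof.
move=> fi; exact: (score_L2 (fourth_le_inj ma fa fi) (fourth_le_inj mb fb fi) lv lw lu).
Qed.

(** An injective index map selects independent innovations with the common
    marginal law, whichever they are. *)
Lemma transfers_gam_inj f f' : injective f -> injective f' ->
  transfers P (fun i => xi (f i)) P (fun i => xi (f' i)) (G f) (G f').
Proof.
move=> fi fi'.
exact: (@transfers_score _ _ _ P (fun i => xi (f i)) _ _ P (fun i => xi (f' i)) id v w u c
  (iid_reindex fi iidxi) (iid_reindex fi' iidxi) (same_marginals_reindex f f' iidxi)
  (fourth_le_inj ma fa fi) (fourth_le_inj mb fb fi) lv lw lu).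
Qed.

Lemma transfers_gam_reindex (s : I -> I) f : injective s -> injective f ->
  transfers P xi P (fun i => xi (s i)) (G f) (G (s \o f)).
Proof.
move=> si fi.
exact: (@transfers_score _ _ _ P xi _ _ P (fun i => xi (s i)) f v w u c
  iidxi (iid_reindex si iidxi) (same_marginals_reindex id s iidxi)
  (fourth_le_inj ma fa fi) (fourth_le_inj mb fb fi) lv lw lu).
Qed.

Lemma gam_lives_in (J : pred I) f : injective f -> (forall j, J (f j)) ->
  lives_in P xi J (G f).
Proof.
move=> fi Jf; rewrite /lives_in.
rewrite (_ : _ \o fst = gam (split_paths xi J) v w u f).
  exact: (@transfers_score _ _ _ P xi _ _ (P \x P)%E (split_paths xi J) f v w u c
    iidxi (iid_split_paths iidxi J) (split_same_marginals iidxi J)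
    (fourth_le_inj ma fa fi) (fourth_le_inj mb fb fi) lv lw lu).
have pE g o : process g f xi (o : T * T).1 = process g f (split_paths xi J) o.
  apply/funext => t; rewrite /process; congr g; apply/funext => j.
  by rewrite /split_paths Jf.
by apply/funext => o; rewrite /gam /score /inn /= !pE.
Qed.

Lemma gam_lives_out (J : pred I) f : injective f -> (forall j, ~~ J (f j)) ->
  lives_out P xi J (G f).
Proof.
move=> fi Jf; rewrite /lives_out.
rewrite (_ : _ \o snd = gam (split_paths xi J) v w u f).
  exact: (@transfers_score _ _ _ P xi _ _ (P \x P)%E (split_paths xi J) f v w u c
    iidxi (iid_split_paths iidxi J) (split_same_marginals iidxi J)
    (fourth_le_inj ma fa fi) (fourth_le_inj mb fb fi) lv lw lu).
have pE g o : process g f xi (o : T * T).2 = process g f (split_paths xi J) o.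
  apply/funext => t; rewrite /process; congr g; apply/funext => j.
  by rewrite /split_paths (negbTE (Jf j)).
by apply/funext => o; rewrite /gam /score /inn /= !pE.
Qed.

End base.
End score_laws.

(** * Innovations, coupling and stationarity *)

Section index_maps.

Definition innovation : choiceType := (int + int * int * int)%type.

(** The innovations that the functionals read at time [n], and below those that
    they read there in the coupling of order [k]. *)
Definition ix (n : int) (j : nat) : innovation := inl (n - j%:Z).

Definition ixc (k : nat) (n : int) (j : nat) : innovation :=
  if (j < k)%N then inl (n - j%:Z) else inr (k%:Z, n, n - j%:Z).

Definition shift (s : int) (i : innovation) : innovation :=
  match i with
  | inl n => inl (n + s)
  | inr (k, n, l) => inr (k, n + s, l + s)
  end.

(** The exchange of the innovations at times at most [n - m] with their copies is
    an involution under which the score at time [n] becomes its coupled version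
    of order [m]. *)
Definition swap_old (m : nat) (n : int) (i : innovation) : innovation :=
  match i with
  | inl x => if x <= n - m%:Z then inr (m%:Z, n, x) else inl x
  | inr (k, n', x) =>
      if [&& k == m%:Z, n' == n & x <= n - m%:Z] then inl x else inr (k, n', x)
  end.

(** Innovations and copies available at time [n], where a copy counts as
    available from the time of the variable that it serves. *)
Definition past (n : int) (i : innovation) : bool :=
  match i with
  | inl x => x <= n
  | inr (k, n', x) => n' <= n
  end.

Lemma ix_inj n : injective (ix n).
Proof. by move=> i j [] /eqP; rewrite (inj_eq (addrI n)) eqr_opp => /eqP[]. Qed.

Lemma ixc_inj k n : injective (ixc k n).
Proof.
move=> i j; rewrite /ixc; case: ifP => _; case: ifP => _ //.
  by move=> [] /eqP; rewrite (inj_eq (addrI n)) eqr_opp => /eqP[].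
by move=> [] /eqP; rewrite (inj_eq (addrI n)) eqr_opp => /eqP[].
Qed.

Lemma shift_inj s : injective (shift s).
Proof.
move=> [n|[[k n] l]] [n'|[[k' n'] l']] //=.
  by move=> [] /addIr ->.
by move=> [] -> /addIr -> /addIr ->.
Qed.

Lemma swap_oldK m n : involutive (swap_old m n).
Proof.
move=> [x|[[k n'] x]] /=.
  by have [h|h] := boolP (x <= n - m%:Z); rewrite /= ?eqxx ?h// (negbTE h).
have [/and3P[/eqP -> /eqP -> h]|h] := boolP [&& _, _ & _]; rewrite /= ?h//.
by rewrite (negbTE h).
Qed.

Lemma shift_ix s n : shift s \o ix n = ix (n + s).
Proof. by apply/funext => j; rewrite /ix /= addrAC. Qed.

Lemma shift_ixc s k n : shift s \o ixc k n = ixc k (n + s).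
Proof. by apply/funext => j; rewrite /ixc /=; case: ifP => _ /=; rewrite addrAC. Qed.

Lemma swap_old_ix m n : swap_old m n \o ix n = ixc m n.
Proof.
apply/funext => j; rewrite /ix /ixc /= lerD2l lerN2 lez_nat.
by case: leqP.
Qed.

Lemma swap_old_ixc h m n : (h < m)%N -> swap_old m n \o ixc h n = ixc h n.
Proof.
move=> hm; apply/funext => j; rewrite /ixc /=; case: ifP => jh /=.
  by rewrite lerD2l lerN2 lez_nat leqNgt (ltn_trans jh hm).
by rewrite eqz_nat (ltn_eqF hm).
Qed.

Lemma past_ix n n' j : n' <= n -> past n (ix n' j).
Proof. by move=> nn; rewrite /= lerBlDr (le_trans nn)// lerDl. Qed.

Lemma past_ixc k n n' j : n' <= n -> past n (ixc k n' j).
Proof. by move=> nn; rewrite /ixc; case: ifP => _ //=; rewrite lerBlDr (le_trans nn)// lerDl. Qed.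

Lemma not_past_ixc k n n' j : (0 < k)%N -> n + k%:Z <= n' -> ~~ past n (ixc k n' j).
Proof. by move=> k0 nn; rewrite /ixc; case: ifP => jk /=; rewrite -ltNge; lia. Qed.

End index_maps.

Section score_sequences.
Context {R : realType}.
Context {dU : measure_display} {U : measurableType dU} (nu : probability U R).
Context {dE : measure_display} {E : measurableType dE}.
Variables (a b : (nat -> E) -> R).
Hypotheses (ma : measurable_functional a) (mb : measurable_functional b).
Context {d} {T : measurableType d} (P : probability T R).
Variable xi : innovation -> T -> U -> E.
Hypothesis iidxi : iid_paths P xi.
Variables (c : R).
Hypotheses (fa : fourth_le nu P (process a (ix 0) xi) c)
  (fb : fourth_le nu P (process b (ix 0) xi) c).

Section one_score.
Variables (v w u : U -> R).
Hypotheses (lv : L2 nu v) (lw : L2 nu w) (lu : L2 nu u).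
Local Notation G := (gam nu a b xi v w u).
Hypothesis G0 : Ex P (G (ix 0)) = 0.

Lemma L2_score f : injective f -> L2 P (G f).
Proof. by apply: (L2_gam ma mb iidxi (@ix_inj 0) fa fb). Qed.

Lemma Ex_score f : injective f -> Ex P (G f) = 0.
Proof.
move=> fi; rewrite -G0.
exact: (transfers_Ex (iid_reindex fi iidxi) (iid_reindex (@ix_inj 0) iidxi)
  (same_marginals_reindex f (ix 0) iidxi)
  (transfers_gam_inj ma mb iidxi (@ix_inj 0) fa fb lv lw lu fi (@ix_inj 0))).
Qed.

Definition coupling_error (k : nat) : R :=
  nrm P (fun o => G (ix 0) o - G (ixc k 0) o).

Lemma coupling_error_at k n :
  nrm P (fun o => G (ix n) o - G (ixc k n) o) = coupling_error k.
Proof.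
rewrite /coupling_error.
have t f : injective f -> transfers P xi P (fun i => xi (shift n i)) (G f) (G (shift n \o f)).
  exact: (transfers_gam_reindex ma mb iidxi (@ix_inj 0) fa fb lv lw lu (@shift_inj n)).
have := transfersB (t _ (@ix_inj 0)) (t _ (@ixc_inj k 0)).
rewrite shift_ix shift_ixc add0r => /(transfers_nrm iidxi
  (iid_reindex (@shift_inj n) iidxi) (same_marginals_reindex id (shift n) iidxi)).
by move=> <-.
Qed.

(** Exchanging the old innovations with the copies of order [m] turns the original
    score into the coupled one of order [m] and leaves the one of order [h] alone. *)
Lemma coupling_error_between h m n : (h < m)%N ->
  nrm P (fun o => G (ixc m n) o - G (ixc h n) o) = coupling_error h.
Proof.
move=> hm; rewrite -(coupling_error_at h n).
have si : injective (swap_old m n) := inv_inj (@swap_oldK m n).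
have t f : injective f -> transfers P xi P (fun i => xi (swap_old m n i)) (G f)
    (G (swap_old m n \o f)).
  exact: (transfers_gam_reindex ma mb iidxi (@ix_inj 0) fa fb lv lw lu si).
have := transfersB (t _ (@ix_inj n)) (t _ (@ixc_inj h n)).
rewrite swap_old_ix (swap_old_ixc n hm) => /(transfers_nrm iidxi
  (iid_reindex si iidxi) (same_marginals_reindex id (swap_old m n) iidxi)).
by move=> <-.
Qed.

Lemma score_past f n : injective f -> (forall j, past n (f j)) ->
  lives_in P xi (past n) (G f).
Proof. by apply: (gam_lives_in ma mb iidxi (@ix_inj 0) fa fb). Qed.

Lemma coupled_score_out k n n' : (0 < k)%N -> n + k%:Z <= n' ->
  lives_out P xi (past n) (G (ixc k n')).
Proof.
move=> k0 nn; apply: (gam_lives_out ma mb iidxi (@ix_inj 0) fa fb lv lw lu).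
  exact: ixc_inj.
by move=> j; exact: not_past_ixc.
Qed.

(** The coupled score at a later time ignores everything that the earlier
    variable depends upon. *)
Lemma past_uncorrelated (F : T -> R) k n n' : lives_in P xi (past n) F ->
  L2 P F -> (0 < k)%N -> n + k%:Z <= n' ->
  Ex P (fun o => F o * G (ixc k n') o) = 0.
Proof.
move=> inF lF k0 nn.
rewrite (independent_Ex iidxi inF (coupled_score_out k0 nn)).
- by rewrite Ex_score ?mulr0//; exact: ixc_inj.
- exact: L2_L1.
by apply: L2_L1; apply: L2_score; exact: ixc_inj.
Qed.

(** Subtracting the coupled score of order [h], which is uncorrelated with [F],
    leaves only the coupling error. *)
Lemma past_cov_score (F : T -> R) n h : lives_in P xi (past n) F -> L2 P F ->
  (0 < h)%N ->
  `|Ex P (fun o => F o * G (ix (n + h%:Z)) o)| <= nrm P F * coupling_error h.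
Proof.
move=> inF lF h0; set n' := n + h%:Z.
have l1 := L2_score (@ix_inj n'); have l2 := L2_score (@ixc_inj h n').
rewrite -(coupling_error_at h n').
have <- : Ex P (fun o => F o * (G (ix n') o - G (ixc h n') o)) =
    Ex P (fun o => F o * G (ix n') o).
  under eq_Ex do rewrite mulrBr.
  rewrite ExB; [|exact: L2M|exact: L2M].
  by rewrite (past_uncorrelated inF lF h0 (lexx n')) subr0.
by apply: cauchy_schwarz_Ex => //; exact: L2B.
Qed.

(** The coupled score is uncorrelated with [F] from lag [m] on; at smaller lags it
    is compared with the coupled score of order [h]. *)
Lemma past_cov_coupled (F : T -> R) n h m : lives_in P xi (past n) F -> L2 P F ->
  (0 < h)%N -> (0 < m)%N ->
  `|Ex P (fun o => F o * G (ixc m (n + h%:Z)) o)| <= nrm P F * coupling_error h.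
Proof.
move=> inF lF h0 m0; set n' := n + h%:Z.
have [mh|hm] := leqP m h.
  rewrite (past_uncorrelated inF lF m0); last by rewrite /n' lerD2l lez_nat.
  by rewrite normr0 mulr_ge0// nrm_ge0.
have l1 := L2_score (@ixc_inj m n'); have l2 := L2_score (@ixc_inj h n').
rewrite -(coupling_error_between n' hm).
have <- : Ex P (fun o => F o * (G (ixc m n') o - G (ixc h n') o)) =
    Ex P (fun o => F o * G (ixc m n') o).
  under eq_Ex do rewrite mulrBr.
  rewrite ExB; [|exact: L2M|exact: L2M].
  by rewrite (past_uncorrelated inF lF h0 (lexx n')) subr0.
by apply: cauchy_schwarz_Ex => //; exact: L2B.
Qed.

Definition time_of (l : nat) : int := l.+1%:Z.

Lemma time_ofD l j : (l <= j)%N -> time_of j = time_of l + (j - l)%:Z.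
Proof. by rewrite /time_of; lia. Qed.

Lemma cov_gap_sym (x : nat -> T -> R) (q : nat -> R) :
  (forall l j, (l <= j)%N -> `|Ex P (fun o => x l o * x j o)| <= q (j - l)%N) ->
  forall l j, `|Ex P (fun o => x l o * x j o)| <= q (gap l j).
Proof.
move=> xq l j; have [lj|jl] := leqP l j.
  by rewrite (_ : gap l j = (j - l)%N); [exact: xq|rewrite /gap; lia].
under eq_Ex do rewrite mulrC.
by rewrite (_ : gap l j = (l - j)%N); [exact: xq (ltnW jl)|rewrite /gap; lia].
Qed.

Variable S : R.
Hypothesis errS : forall n, \sum_(1 <= k < n) coupling_error k <= S.

Let err_ge0 k : 0 <= coupling_error k. Proof. exact: nrm_ge0. Qed.

Let S0 : 0 <= S. Proof. by have := errS 0; rewrite big_geq. Qed.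

Lemma sum_coupling_error_le (q0 q1 : R) h : 0 <= q0 -> 0 <= q1 ->
  \sum_(i < h) (if i == 0 :> nat then q0 else q1 * coupling_error i) <= q0 + q1 * S.
Proof.
move=> q00 q10; case: h => [|h].
  by rewrite big_ord0 addr_ge0// mulr_ge0.
rewrite big_ord_recl /= lerD2l.
apply: (@le_trans _ _ (q1 * \sum_(1 <= k < h.+1) coupling_error k)); last first.
  by apply: ler_wpM2l => //; exact: errS.
by rewrite big_add1 /= big_mkord mulr_sumr.
Qed.

Lemma score_quasi_orthogonal : quasi_orthogonal P (fun l => G (ix (time_of l)))
  (Num.sqrt (2 * (nrm P (G (ix 0)) ^+ 2 + nrm P (G (ix 0)) * S))).
Proof.
set q := nrm P (G (ix 0)).
have q0 : 0 <= q by exact: nrm_ge0.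
have qn n : nrm P (G (ix n)) = q.
  rewrite /q; symmetry; apply: (transfers_nrm (iid_reindex (@ix_inj 0) iidxi)
    (iid_reindex (@ix_inj n) iidxi) (same_marginals_reindex (ix 0) (ix n) iidxi)).
  by apply: (transfers_gam_inj ma mb iidxi (@ix_inj 0) fa fb lv lw lu);
    exact: ix_inj.
apply: (@quasi_orthogonal_gap _ _ _ P _ (fun h => if h == 0%N then q ^+ 2 else q * coupling_error h)).
- exact: sqrtr_ge0.
- by move=> h; case: ifP => _; [exact: sqr_ge0|exact: mulr_ge0].
- have C0 : 0 <= 2 * (q ^+ 2 + q * S).
    by apply: mulr_ge0 => //; apply: addr_ge0; [exact: sqr_ge0|exact: mulr_ge0].
  move=> h; rewrite (sqr_sqrtr C0) [leRHS]mulrC mulKf ?pnatr_eq0//.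
  by apply: sum_coupling_error_le => //; exact: sqr_ge0.
- by move=> l; apply: L2_score; exact: ix_inj.
apply: (@cov_gap_sym _ (fun h => if h == 0%N then q ^+ 2 else q * coupling_error h)) => l j lj /=.
case: eqP => [jl|/eqP jl].
  have -> : j = l by lia.
  by rewrite ger0_norm -?nrm_sqr ?qn// sqr_ge0.
rewrite (time_ofD lj) -(qn (time_of l)); apply: past_cov_score; last by lia.
  by apply: score_past; [exact: ix_inj|move=> i; exact: past_ix].
by apply: L2_score; exact: ix_inj.
Qed.

(** The constant tends to 0 with the coupling error of order [m]. *)
Lemma coupling_quasi_orthogonal m : (0 < m)%N ->
  quasi_orthogonal P (fun l o => G (ix (time_of l)) o - G (ixc m (time_of l)) o)
    (Num.sqrt (2 * (coupling_error m ^+ 2 + 2 * coupling_error m * S))).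
Proof.
move=> m0; set q := coupling_error m.
have q0 : 0 <= q by exact: nrm_ge0.
have l1 n := L2_score (@ix_inj n); have l2 n := L2_score (@ixc_inj m n).
have lD n : L2 P (fun o => G (ix n) o - G (ixc m n) o) by exact: L2B.
apply: (@quasi_orthogonal_gap _ _ _ P _ (fun h => if h == 0%N then q ^+ 2 else 2 * q * coupling_error h)).
- exact: sqrtr_ge0.
- move=> h; case: ifP => _; first exact: sqr_ge0.
  by apply: mulr_ge0; [exact: mulr_ge0|exact: err_ge0].
- have q2 : 0 <= 2 * q by exact: mulr_ge0.
  have C0 : 0 <= 2 * (q ^+ 2 + 2 * q * S).
    by apply: mulr_ge0 => //; apply: addr_ge0; [exact: sqr_ge0|exact: mulr_ge0].
  move=> h; rewrite (sqr_sqrtr C0) [leRHS]mulrC mulKf ?pnatr_eq0//.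
  by apply: sum_coupling_error_le => //; exact: sqr_ge0.
- by move=> l; exact: lD.
apply: (@cov_gap_sym _ (fun h => if h == 0%N then q ^+ 2 else 2 * q * coupling_error h)) => l j lj /=.
case: eqP => [jl|/eqP jl].
  have -> : j = l by lia.
  rewrite ger0_norm; last by apply: Ex_ge0 => o; rewrite -expr2 sqr_ge0.
  by rewrite -[q](coupling_error_at m (time_of l)) nrm_sqr.
rewrite (time_ofD lj).
set F := fun o => G (ix (time_of l)) o - G (ixc m (time_of l)) o.
have lF : L2 P F by exact: lD.
have inF : lives_in P xi (past (time_of l)) F.
  apply: transfersB; apply: score_past.
  - exact: ix_inj.
  - by move=> i; exact: past_ix.
  - exact: ixc_inj.
  by move=> i; exact: past_ixc.
have jl0 : (0 < j - l)%N by lia.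
rewrite (@eq_Ex _ _ _ P _ (fun o => F o * G (ix (time_of l + (j - l)%:Z)) o -
   F o * G (ixc m (time_of l + (j - l)%:Z)) o)); last by move=> o; rewrite mulrBr.
rewrite ExB; [|exact: L2M|exact: L2M].
apply: le_trans (ler_normB _ _) _.
have nF : nrm P F = q := coupling_error_at m (time_of l).
have := past_cov_score inF lF jl0; have := past_cov_coupled inF lF jl0 m0.
rewrite nF => h1 h2; apply: le_trans (lerD h2 h1) _.
by rewrite -mulr2n -mulrA mulr_natl.
Qed.

Lemma coupling_error_cvg0 : coupling_error k @[k --> \oo] --> 0.
Proof.
apply: cvg_series_cvg_0; apply: nondecreasing_is_cvgn.
  by apply/nondecreasing_seqP => n; rewrite /series/= big_nat_recr//= lerDl.
exists (coupling_error 0 + S) => _ [n _ <-]; rewrite /series /=.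
case: n => [|n]; first by rewrite big_geq// addr_ge0.
by rewrite big_nat_recl//= lerD2l; have := errS n.+1; rewrite big_add1.
Qed.

End one_score.
End score_sequences.

(** * Approximation by bounded sequences of finite range *)

Lemma clip_sub_le {R : realType} (M x : R) : 0 <= M -> `|x - clip M x| <= `|x|.
Proof.
move=> M0; have := ler_norm x; have := ler_norm (- x).
rewrite normrN => h1 h2; rewrite ler_norml /clip maxEle minEle.
case: (leP x M) => xM; case: (leP (- M) _) => h; apply/andP; split; lra.
Qed.

Lemma clip_residue_cvg0 {R : realType} {d} {T : measurableType d} (P : probability T R)
    (F : T -> R) : L2 P F ->
  nrm P (fun o => F o - clip n%:R (F o)) @[n --> \oo] --> 0.
Proof.
move=> [mF iF].
have mc n : measurable_fun setT (fun o => F o - clip n%:R (F o)).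
  by apply: measurable_funB => //; exact: (measurableT_comp (measurable_clip _) mF).
have h : Ex P (fun o => (F o - clip n%:R (F o)) ^+ 2) @[n --> \oo] --> Ex P (fun=> 0).
  apply: (Ex_dominated_cvg (H := fun o => F o ^+ 2)) => //.
  - by move=> n; exact: measurable_funX.
  - move=> o; have c1 : (F o - clip n%:R (F o)) @[n --> \oo] --> F o - F o.
      by apply: cvgB; [exact: cvg_cst|exact: clip_cvg].
    rewrite subrr in c1; have c2 := cvgM c1 c1; rewrite mulr0 in c2.
    have e : (fun n : nat => (F o - clip n%:R (F o)) ^+ 2) =
      (fun n : nat => (F o - clip n%:R (F o)) * (F o - clip n%:R (F o))).
      by apply/funext => n; rewrite expr2.
    by rewrite e; exact: c2.
  move=> n o; rewrite ger0_norm ?sqr_ge0// -(sqr_normr (F o)).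
  by apply: sqr_le_norm; exact: clip_sub_le.
have := cvg_comp _ _ h (@sqrt_continuous R _).
by rewrite Excst sqrtr0.
Qed.

Section approximation.
Context {R : realType}.
Context {dU : measure_display} {U : measurableType dU} (nu : probability U R).
Context {dE : measure_display} {E : measurableType dE}.
Variables (a b : (nat -> E) -> R).
Hypotheses (ma : measurable_functional a) (mb : measurable_functional b).
Context {d} {T : measurableType d} (P : probability T R).
Variable xi : innovation -> T -> U -> E.
Hypothesis iidxi : iid_paths P xi.
Variables (c : R).
Hypotheses (fa : fourth_le nu P (process a (ix 0) xi) c)
  (fb : fourth_le nu P (process b (ix 0) xi) c).
(* An entry of the estimator pairs two scores, which are indexed by booleans. *)
Variables (v w u : bool -> U -> R).
Hypotheses (lv : forall e, L2 nu (v e)) (lw : forall e, L2 nu (w e))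
  (lu : forall e, L2 nu (u e)).
Local Notation G := (fun e => gam nu a b xi (v e) (w e) (u e)).
Hypothesis G0 : forall e, Ex P (G e (ix 0)) = 0.

Section one_order.
Variable m : nat.
Hypothesis m0 : (0 < m)%N.

Let y e l := G e (ixc m (time_of l)).

Let Ly e n : L2 P (G e (ixc m n)).
Proof. by apply: (L2_score ma mb iidxi fa fb (lv e) (lw e) (lu e)); exact: ixc_inj. Qed.

(** Clipping destroys the vanishing mean, which is restored by subtracting this
    constant; it is independent of the time because the law of the score is. *)
Definition clip_mean (M : R) e : R := Ex P (fun o => clip M (G e (ixc m 0) o)).

Definition clipped (M : R) e l o : R := clip M (G e (ixc m (time_of l)) o) - clip_mean M e.

Let mcl (M q : R) : measurable_fun setT (fun x : R => clip M x - q).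
Proof. by apply: measurable_funB; [exact: measurable_clip|exact: measurable_cst]. Qed.

Let mres (M q : R) : measurable_fun setT (fun x : R => x - (clip M x - q)).
Proof. by apply: measurable_funB => //; exact: measurable_id. Qed.

Let same_law e n : transfers P (fun i => xi (ixc m n i)) P (fun i => xi (ixc m 0 i))
  (G e (ixc m n)) (G e (ixc m 0)).
Proof.
exact: (transfers_gam_inj ma mb iidxi (@ix_inj 0) fa fb (lv e) (lw e) (lu e)
  (@ixc_inj m n) (@ixc_inj m 0)).
Qed.

Let law_Ex F F' n : transfers P (fun i => xi (ixc m n i)) P (fun i => xi (ixc m 0 i)) F F' ->
  Ex P F = Ex P F'.
Proof.
exact: (transfers_Ex (iid_reindex (@ixc_inj m n) iidxi) (iid_reindex (@ixc_inj m 0) iidxi)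
  (same_marginals_reindex (ixc m n) (ixc m 0) iidxi)).
Qed.

Let L1clip M e n : 0 <= M -> L1 P (fun o => clip M (G e (ixc m n) o)).
Proof.
move=> M0; apply: (@L1_bounded _ _ _ P _ M).
  exact: (measurableT_comp (measurable_clip M) (L2_meas (Ly e n))).
by move=> o; exact: clip_le.
Qed.

Lemma Ex_clipped M e l : 0 <= M -> Ex P (clipped M e l) = 0.
Proof.
move=> M0; rewrite /clipped ExB; [|exact: L1clip|exact: L1cst].
rewrite Excst /clip_mean; apply/eqP; rewrite subr_eq0; apply/eqP.
by apply: law_Ex; apply: transfers_comp (same_law e _); exact: measurable_clip.
Qed.

Definition clip_residue M e : R :=
  nrm P (fun o => G e (ixc m 0) o - (clip M (G e (ixc m 0) o) - clip_mean M e)).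

Lemma clip_residue_at M e l :
  nrm P (fun o => y e l o - clipped M e l o) = clip_residue M e.
Proof.
apply: (transfers_nrm (iid_reindex (@ixc_inj m (time_of l)) iidxi)
  (iid_reindex (@ixc_inj m 0) iidxi)
  (same_marginals_reindex (ixc m (time_of l)) (ixc m 0) iidxi)).
exact: (transfers_comp (mres M (clip_mean M e)) (same_law e (time_of l))).
Qed.

(** Recentring costs at most the clipping error, since the score itself is
    centred. *)
Lemma clip_residue_le M e : 0 <= M -> clip_residue M e <=
  2 * nrm P (fun o => G e (ixc m 0) o - clip M (G e (ixc m 0) o)).
Proof.
move=> M0; set F := fun o => _ - _.
have lF : L2 P F.
  apply: L2B => //; apply: (@L2_bounded _ _ _ P _ M).
    exact: (measurableT_comp (measurable_clip M) (L2_meas (Ly e 0))).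
  by move=> o; exact: clip_le.
have cF : `|clip_mean M e| <= nrm P F.
  have -> : clip_mean M e = - Ex P F.
    rewrite /F ExB; [|exact: L2_L1|exact: L1clip].
    by rewrite (Ex_score ma mb iidxi fa fb (lv e) (lw e) (lu e) (G0 e) (@ixc_inj m 0)) sub0r opprK.
  by rewrite normrN (le_trans (Ex_abs (L2_L1 lF)))// Ex_abs_le_nrm.
rewrite /clip_residue.
rewrite (@eq_nrm _ _ _ P _ (fun o => F o + clip_mean M e)); last first.
  by move=> o; rewrite /F; ring.
apply: le_trans (nrmD lF (L2cst P _)) _; rewrite mulr_natl mulr2n lerD2l.
apply: le_trans cF; rewrite /nrm Excst sqrtr_sqr.
by [].
Qed.

Lemma clipped_past M e l n : (time_of l <= n)%R -> lives_in P xi (past n) (clipped M e l).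
Proof.
move=> ln; apply: (transfers_comp (mcl M (clip_mean M e))).
apply: (score_past ma mb iidxi fa fb (lv e) (lw e) (lu e)); first exact: ixc_inj.
by move=> j; exact: past_ixc.
Qed.

Lemma clipped_out M e l n : (n + m%:Z <= time_of l)%R ->
  lives_out P xi (past n) (clipped M e l).
Proof.
move=> ln; apply: (transfers_comp (mcl M (clip_mean M e))).
exact: (coupled_score_out ma mb iidxi fa fb (lv e) (lw e) (lu e)).
Qed.

Lemma measurable_clipped M e l : measurable_fun setT (clipped M e l).
Proof. exact: (measurableT_comp (mcl M (clip_mean M e)) (L2_meas (Ly e _))). Qed.

Lemma clipped_le M e l o : 0 <= M -> `|clipped M e l o| <= 2 * M.
Proof.
move=> M0; apply: le_trans (ler_normB _ _) _.
rewrite mulr_natl mulr2n; apply: lerD; first exact: clip_le.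
apply: le_trans (Ex_abs (L1clip e 0 M0)) _; rewrite -[leRHS](Excst P).
by apply: Ex_le; [exact: L1_abs (L1clip e 0 M0)|exact: L1cst|move=> x; exact: clip_le].
Qed.

(** Products of coupled scores of order [m] are independent of products of those
    that come at least [m] steps later. *)
Lemma finite_range_clipped M : 0 <= M -> finite_range P m (2 * M) (clipped M).
Proof.
move=> M0.
have mz := measurable_clipped M; have zM e l o := clipped_le e l o M0.
have M20 : 0 <= 2 * M by exact: mulr_ge0.
have lz e l : L2 P (clipped M e l) := L2_bounded P (mz e l) (zM e l).
have lzz e l e' l' : L2 P (fun o => clipped M e l o * clipped M e' l' o).
  apply: (@L2_bounded _ _ _ P _ (2 * M * (2 * M))); first exact: measurable_funM.
  by move=> o; rewrite normrM ler_pM.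
have tl l n : (l <= n)%N -> time_of l <= time_of n by rewrite /time_of; lia.
have tm n l : (n + m <= l)%N -> time_of n + m%:Z <= time_of l by rewrite /time_of; lia.
split => //.
- move=> e e' l l' ll.
  rewrite (independent_Ex iidxi (clipped_past M e (lexx (time_of l)))
    (clipped_out M e' (tm _ _ ll)) (L2_L1 (lz e l)) (L2_L1 (lz e' l'))).
  by rewrite (Ex_clipped e l M0); exact: mul0r.
- move=> b1 b2 b3 b4 l1 l2 l3 l4 h1 h2 h3.
  pose n := (l4 - m)%N.
  have p e l : (l + m <= l4)%N -> lives_in P xi (past (time_of n)) (clipped M e l).
    by move=> h; apply: clipped_past; apply: tl; rewrite /n; lia.
  have h4 : (n + m <= l4)%N by rewrite /n; lia.
  have in3 := transfersM (transfersM (p b1 l1 h1) (p b2 l2 h2)) (p b3 l3 h3).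
  have l12 := lzz b1 l1 b2 l2.
  under eq_Ex do rewrite mulrA.
  rewrite (independent_Ex iidxi in3 (clipped_out M b4 (tm _ _ h4)) (L2M l12 (lz b3 l3))
    (L2_L1 (lz b4 l4))).
  by rewrite (Ex_clipped b4 l4 M0) mulr0.
move=> b1 b2 b3 b4 l1 l2 l3 l4 h13 h14 h23 h24.
pose n := maxn l1 l2.
have in2 : lives_in P xi (past (time_of n)) (fun o => clipped M b1 l1 o * clipped M b2 l2 o).
  by apply: transfersM; apply: clipped_past; apply: tl; rewrite /n; lia.
have out2 : lives_out P xi (past (time_of n)) (fun o => clipped M b3 l3 o * clipped M b4 l4 o).
  by apply: transfersM; apply: clipped_out; apply: tm; rewrite /n; lia.
exact: (independent_Ex iidxi in2 out2 (L2_L1 (lzz _ _ _ _)) (L2_L1 (lzz _ _ _ _))).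
Qed.

Lemma clipped_quasi_orthogonal M e : 0 <= M ->
  quasi_orthogonal P (fun l o => y e l o - clipped M e l o)
    (Num.sqrt (2 * m%:R) * clip_residue M e).
Proof.
move=> M0; set rho := clip_residue M e.
have rho0 : 0 <= rho by exact: nrm_ge0.
have lz l : L2 P (clipped M e l) :=
  L2_bounded P (measurable_clipped M e l) (fun o => clipped_le e l o M0).
have lE l : L2 P (fun o => y e l o - clipped M e l o) := L2B (Ly e _) (lz l).
have E0 l : Ex P (fun o => y e l o - clipped M e l o) = 0.
  rewrite (ExB (L2_L1 (Ly e _)) (L2_L1 (lz l))).
  rewrite (Ex_clipped e l M0) subr0.
  exact: (Ex_score ma mb iidxi fa fb (lv e) (lw e) (lu e) (G0 e) (@ixc_inj m _)).
apply: (@quasi_orthogonal_gap _ _ _ P _ (fun h => ((h < m)%N)%:R * rho ^+ 2)).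
- by apply: mulr_ge0; [exact: sqrtr_ge0|exact: rho0].
- by move=> h; apply: mulr_ge0; [exact: ler0n|exact: sqr_ge0].
- move=> h; rewrite -mulr_suml exprMn (@sqr_sqrtr _ (2 * m%:R)) ?mulr_ge0//.
  have -> : 2 * m%:R * rho ^+ 2 / 2 = m%:R * rho ^+ 2 by field.
  apply: ler_wpM2r; first exact: sqr_ge0.
  by rewrite -natr_sum sum_ord_ltn ler_nat geq_minr.
- exact: lE.
apply: (@cov_gap_sym _ _ _ P _ (fun h => ((h < m)%N)%:R * rho ^+ 2)) => l j lj /=.
have [_|mlj] := ltnP.
  have rE i : nrm P (fun o => y e i o - clipped M e i o) = rho := clip_residue_at M e i.
  rewrite mul1r expr2; apply: le_trans (cauchy_schwarz_Ex (lE l) (lE j)) _.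
  by rewrite !rE.
have inl : lives_in P xi (past (time_of l)) (fun o => y e l o - clipped M e l o).
  apply: (transfers_comp (mres M (clip_mean M e))).
  apply: (score_past ma mb iidxi fa fb (lv e) (lw e) (lu e)); first exact: ixc_inj.
  by move=> i; exact: past_ixc.
have outj : lives_out P xi (past (time_of l)) (fun o => y e j o - clipped M e j o).
  apply: (transfers_comp (mres M (clip_mean M e))).
  apply: (coupled_score_out ma mb iidxi fa fb (lv e) (lw e) (lu e) m0).
  by rewrite /time_of; lia.
rewrite (independent_Ex iidxi inl outj (L2_L1 (lE l)) (L2_L1 (lE j))).
by rewrite E0 mul0r normr0 mul0r.
Qed.

End one_order.
Variable S : R.
Local Notation err e := (coupling_error nu a b P xi (v e) (w e) (u e)).
Hypothesis errS : forall e n, \sum_(1 <= k < n) err e k <= S.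

Let Lx e n : L2 P (G e (ix n)).
Proof. by apply: (L2_score ma mb iidxi fa fb (lv e) (lw e) (lu e)); exact: ix_inj. Qed.

(** First couple, then clip: the coupling order is chosen so that the first
    error is small, and the clipping level afterwards, since its error is
    multiplied by the range of dependence. *)
Lemma score_approximable eta : 0 < eta -> exists m D z,
  [/\ finite_range P m D z,
      quasi_orthogonal P (fun l o => G true (ix (time_of l)) o - z true l o) eta &
      quasi_orthogonal P (fun l o => G false (ix (time_of l)) o - z false l o) eta].
Proof.
move=> eta0; have eta2 : 0 < eta / 2 by rewrite divr_gt0.
have S0 : 0 <= S by have := errS true 0; rewrite big_geq.
(* The constant of quasi-orthogonality for the coupling of order [k]. *)
pose rate (e : bool) k := Num.sqrt (2 * (err e k ^+ 2 + 2 * err e k * S)).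
have rate0 e : rate e k @[k --> \oo] --> 0.
  have h := coupling_error_cvg0 (errS e).
  have h2 : (fun k => 2 * (err e k * err e k + 2 * S * err e k)) @ \oo -->
      (2 * (0 * 0 + 2 * S * 0) : R).
    apply: cvgM; first exact: cvg_cst.
    by apply: cvgD; [exact: cvgM|apply: cvgM; [exact: cvg_cst|exact: h]].
  rewrite !(mulr0, addr0) in h2.
  have := cvg_comp _ _ h2 (@sqrt_continuous R _); rewrite sqrtr0.
  rewrite (_ : _ \o _ = rate e)//.
  by apply/funext => k; rewrite /rate /=; congr Num.sqrt; ring.
have [m m0 mr] : exists2 m, (0 < m)%N & forall e, rate e m <= eta / 2.
  have near0 e : \forall k \near \oo, rate e k <= eta / 2.
    exact: (cvgr_le 0 (rate0 e)).
  have [N _ hN] := filterI (near0 true) (near0 false).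
  exists N.+1 => //; have [h1 h2] := hN N.+1 (leqnSn N).
  by case; [exact: h1|exact: h2].
have res0 e : Num.sqrt (2 * m%:R) * clip_residue m n%:R e
    @[n --> \oo] --> 0.
  have h := clip_residue_cvg0 (L2_score ma mb iidxi fa fb (lv e) (lw e) (lu e) (@ixc_inj m 0)).
  have h2 : (fun n => Num.sqrt (2 * m%:R) * (2 * nrm P (fun o =>
      G e (ixc m 0) o - clip n%:R (G e (ixc m 0) o)))) @ \oo -->
      (Num.sqrt (2 * m%:R) * (2 * 0) : R).
    by apply: cvgM; [exact: cvg_cst|apply: cvgM; [exact: cvg_cst|exact: h]].
  rewrite !mulr0 in h2.
  apply: (squeeze_cvgr _ (cvg_cst 0) h2); apply: nearW => n; apply/andP; split.
    by apply: mulr_ge0; [exact: sqrtr_ge0|exact: nrm_ge0].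
  apply: ler_wpM2l; first exact: sqrtr_ge0.
  exact: (clip_residue_le m e (ler0n R n)).
have [M M0 Mr] : exists2 M : R, 0 <= M & forall e,
    Num.sqrt (2 * m%:R) * clip_residue m M e <= eta / 2.
  have near0 e : \forall n \near \oo,
      Num.sqrt (2 * m%:R) * clip_residue m n%:R e <= eta / 2.
    exact: (cvgr_le 0 (res0 e)).
  have [N _ hN] := filterI (near0 true) (near0 false).
  exists N%:R; first exact: ler0n.
  by have [h1 h2] := hN N (leqnn N); case; [exact: h1|exact: h2].
have approx e : quasi_orthogonal P (fun l o => G e (ix (time_of l)) o -
    clipped m M e l o) eta.
  have q1 := coupling_quasi_orthogonal ma mb iidxi fa fb (lv e) (lw e) (lu e) (G0 e) (errS e) m0.
  have q2 := clipped_quasi_orthogonal m0 e M0.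
  have := quasi_orthogonalD q1 q2.
  move=> /(quasi_orthogonal_le (D := eta)) q3.
  apply: (quasi_orthogonal_ext _ (q3 _)); first by move=> l o; ring.
  by rewrite [leRHS]splitr; apply: lerD; [exact: mr|exact: Mr].
exists m, (2 * M), (clipped m M); split; [|exact: approx|exact: approx].
exact: (finite_range_clipped m0 M0).
Qed.

Lemma cross_cov_stationary e e' n n' :
  Ex P (fun o => G e (ix n) o * G e' (ix (n + n')) o) =
  Ex P (fun o => G e (ix 0) o * G e' (ix n') o).
Proof.
have t e0 f : injective f -> transfers P xi P (fun i => xi (shift n i)) (G e0 f)
    (G e0 (shift n \o f)).
  exact: (transfers_gam_reindex ma mb iidxi (@ix_inj 0) fa fb (lv e0) (lw e0) (lu e0) (@shift_inj n)).
have := transfersM (t e _ (@ix_inj 0)) (t e' _ (@ix_inj n')).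
rewrite !shift_ix add0r [n' + n]addrC => tt; symmetry.
exact: (transfers_Ex iidxi (iid_reindex (@shift_inj n) iidxi)
  (same_marginals_reindex id (shift n) iidxi) tt).
Qed.

Lemma cross_cov_summable e e' n : \sum_(h < n) `|Ex P (fun o => G e (ix 0) o * G e' (ix h%:Z) o)|
  <= nrm P (G e (ix 0)) * nrm P (G e' (ix 0)) + nrm P (G e (ix 0)) * S.
Proof.
have q0 := nrm_ge0 P (G e (ix 0)); have q1 := nrm_ge0 P (G e' (ix 0)).
apply: le_trans (sum_coupling_error_le (errS e') n (mulr_ge0 q0 q1) q0).
apply: ler_sum => h _; case: eqP => [->|/eqP h0].
  exact: cauchy_schwarz_Ex (Lx e 0) (Lx e' 0).
rewrite -[h%:Z]add0r.
apply: (past_cov_score ma mb iidxi fa fb (lv e') (lw e') (lu e') (G0 e') _ (Lx e 0)); last by lia.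
apply: (score_past ma mb iidxi fa fb (lv e) (lw e) (lu e)); first exact: ix_inj.
by move=> j; exact: past_ix.
Qed.

End approximation.

(** * The unit interval *)

Section unit_interval.
Context {R : realType}.
Local Notation mu := (@lebesgue_measure R).
Local Notation I01 := (`[(0 : R), 1]%classic).

Definition unit_prob : probability (measurableTypeR R) R := uniform_prob (@ltr01 R).
Local Notation nu := unit_prob.

(** Reading a path at the clamped time makes it a function on the whole line
    that is jointly measurable as soon as the path is so on [0, 1]. *)
Definition clamp (t : R) : R := Num.max 0 (Num.min t 1).

Lemma clamp_in t : clamp t \in `[0, 1].
Proof.
by rewrite in_itv /= /clamp le_max lexx /= ge_max ler01 /= ge_min lexx orbT.
Qed.

Lemma clamp_id t : t \in `[0, 1] -> clamp t = t.
Proof.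
by rewrite in_itv /= => /andP[t0 t1]; rewrite /clamp (min_idPl t1) (max_idPr t0).
Qed.

Lemma measurable_clamp : measurable_fun setT (clamp : measurableTypeR R -> measurableTypeR R).
Proof.
apply: measurable_maxr; first exact: measurable_cst.
by apply: measurable_minr; [exact: measurable_id|exact: measurable_cst].
Qed.

Lemma measurable_comp_clamp d (E : measurableType d) (f : R -> E) :
  measurable_fun (I01 : set (measurableTypeR R)) f ->
  measurable_fun setT (fun t : measurableTypeR R => f (clamp t)).
Proof.
move=> mf; apply: (measurable_comp (F := I01) (f := f)) => //.
- by move=> _ [t _ <-]; exact: clamp_in.
exact: measurable_clamp.
Qed.

Lemma ge0_integral_unit (f : R -> \bar R) :
  measurable_fun setT (f : measurableTypeR R -> \bar R) -> (forall t, 0 <= f t)%E ->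
  (\int[nu]_t f t = \int[mu]_(t in I01) f t)%E.
Proof.
by move=> mf f0; rewrite [LHS]integral_uniform// subr0 invr1 mul1e.
Qed.

Lemma integral_clamp (f : R -> \bar R) :
  (\int[mu]_(t in I01) f (clamp t) = \int[mu]_(t in I01) f t)%E.
Proof. by apply: eq_integral => t; rewrite inE /= => t01; rewrite clamp_id. Qed.

Lemma Ex_unit (f : R -> R) :
  measurable_fun setT (f : measurableTypeR R -> R) ->
  Ex nu f = \int[mu]_(t in I01) f t.
Proof.
move=> mf; rewrite /Ex /Rintegral; congr fine.
have mE : measurable_fun setT (fun t : measurableTypeR R => (f t)%:E).
  exact/measurable_EFinP.
rewrite integralE [RHS]integralE; congr (_ - _)%E.
  by apply: ge0_integral_unit => //; exact: measurable_funepos.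
by apply: ge0_integral_unit => //; exact: measurable_funeneg.
Qed.

Lemma inner_Ex (f g : R -> R) :
  measurable_fun setT (fun t : measurableTypeR R => f (clamp t)) ->
  measurable_fun setT (fun t : measurableTypeR R => g (clamp t)) ->
  inner f g = Ex nu (fun t => f (clamp t) * g (clamp t)).
Proof.
move=> mf mg; rewrite Ex_unit; last exact: measurable_funM.
by apply: eq_Rintegral => t; rewrite inE /= => t01; rewrite clamp_id.
Qed.

Lemma inL2_L2 (f : R -> R) : inL2 f -> L2 nu (fun t => f (clamp t)).
Proof.
move=> [mf f2]; have mc := measurable_comp_clamp mf; split => //.
apply: ge0_L1; [exact: measurable_funX|by move=> t; exact: sqr_ge0|].
rewrite ge0_integral_unit.
- by rewrite (integral_clamp (fun t => (f t ^+ 2)%:E)).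
- by apply/measurable_EFinP; exact: measurable_funX.
by move=> t; rewrite lee_fin sqr_ge0.
Qed.

Lemma ae_unit (Q : R -> Prop) :
  {ae mu, forall t : R, t \in `[0, 1] -> Q t} -> {ae nu, forall t : measurableTypeR R, Q (clamp t)}.
Proof.
move=> [A [mA A0 hA]].
exists (A `|` ~` I01); split.
- by apply: measurableU => //; apply: measurableC; exact: measurable_itv.
- have nA : nu A = 0%E.
    exact: (null_content_dominatesP _ _).1 (dominates_uniform_prob (@ltr01 R)) _ mA A0.
  have nI : nu (~` I01) = 0%E.
    rewrite -[LHS]/(uniform_prob (@ltr01 R) (~` I01)) /uniform_prob integral_uniform_pdf.
    by rewrite setICl integral_set0.
  apply: null_set_setU => //.
  by apply: measurableC; exact: measurable_itv.
move=> t /= nQ; have [t01|t01] := boolP (t \in `[0, 1]); last by right => /=; apply/negP.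
by left; apply: hA => /= h; apply: nQ; rewrite clamp_id//; exact: h.
Qed.

(** A basis function is orthogonal to any L2-convergent series of the other
    ones. *)
Lemma orthogonal_limit (v : nat -> R -> R) (psi : nat -> R) (u : R -> R) p j :
  orthonormal_basis v -> inL2 u ->
  cvgL2 (fun n s => \sum_(p <= r < n) psi r * v r s) u -> (j < p)%N ->
  inner (v j) u = 0.
Proof.
move=> [vL2 von _] uL2 cu jp.
have lv r := inL2_L2 (vL2 r); have lu := inL2_L2 uL2.
pose s n t := \sum_(p <= r < n) psi r * v r (clamp t).
have ls n : L2 nu (s n) by apply: L2sum => r _; exact: L2Z.
have vs n : Ex nu (fun t => v j (clamp t) * s n t) = 0.
  rewrite (@eq_Ex _ _ _ nu _ (fun t => \sum_(p <= r < n) psi r * (v j (clamp t) * v r (clamp t)))).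
    rewrite Exsum; last by move=> r _; apply: L1Z; exact: L2M.
    rewrite big_nat big1// => r /andP[pr _]; rewrite ExZ; last exact: L2M.
    rewrite -(inner_Ex (L2_meas (lv j)) (L2_meas (lv r))) von.
    by rewrite (ltn_eqF (leq_trans jp pr)) mulr0.
  by move=> t; rewrite mulr_sumr; apply: eq_bigr => r _; rewrite mulrCA.
have d0 : nrm nu (fun t => s n t - u (clamp t)) @[n --> \oo] --> 0.
  have e n : (\int[mu]_(t in I01) ((\sum_(p <= r < n) psi r * v r t - u t) ^+ 2)%:E =
      (nrm nu (fun t => (s n t - u (clamp t))) ^+ 2)%:E)%E.
    have lsu := L2B (ls n) lu.
    rewrite nrm_sqr -(L1_integralE lsu.2) ge0_integral_unit.
    - by rewrite -(integral_clamp (fun t => ((\sum_(p <= r < n) psi r * v r t - u t) ^+ 2)%:E)).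
    - by apply/measurable_EFinP; apply: L1_meas; exact: lsu.2.
    by move=> t; rewrite lee_fin sqr_ge0.
  move: cu; rewrite /cvgL2; under eq_fun do rewrite e.
  move=> /fine_cvg h.
  pose q n := nrm nu (fun t => s n t - u (clamp t)).
  have h2 : (fun n => q n ^+ 2) @ \oo --> (0 : R) by exact: h.
  have qE : q = Num.sqrt \o (fun n => q n ^+ 2).
    by apply/funext => n /=; rewrite sqrtr_sqr ger0_norm// nrm_ge0.
  have := cvg_comp _ _ h2 (@sqrt_continuous R _).
  by rewrite sqrtr0 -qE.
rewrite (inner_Ex (L2_meas (lv j)) (L2_meas lu)).
have bd n : `|Ex nu (fun t => v j (clamp t) * u (clamp t))| <=
    nrm nu (fun t => v j (clamp t)) * nrm nu (fun t => s n t - u (clamp t)).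
  apply: le_trans (cauchy_schwarz_Ex (lv j) (L2B (ls n) lu)).
  rewrite -normrN (_ : - Ex _ _ = Ex nu (fun t => v j (clamp t) * (s n t - u (clamp t))))//.
  transitivity (Ex nu (fun t => v j (clamp t) * s n t - v j (clamp t) * u (clamp t))).
    by rewrite (ExB (L2M (lv j) (ls n)) (L2M (lv j) lu)) vs sub0r.
  by apply: eq_Ex => t; rewrite mulrBr.
apply/eqP; rewrite -normr_eq0 eq_le normr_ge0 andbT.
have c : nrm nu (fun t => v j (clamp t)) * nrm nu (fun t => s n t - u (clamp t))
    @[n --> \oo] --> nrm nu (fun t => v j (clamp t)) * 0.
  by apply: cvgM; [exact: cvg_cst|exact: d0].
rewrite mulr0 in c; apply: (cvgr_to_ge c); apply: nearW => n; exact: bd.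
Qed.

End unit_interval.

(** * Covariances of time integrals *)

Section exchange_of_integrals.
Context {R : realType}.
Context {dU : measure_display} {U : measurableType dU} (nu : probability U R).
Context {d : measure_display} {T : measurableType d} (P : probability T R).
Implicit Types Z X Y : T -> U -> R.

Lemma jmeas_swap Z : jmeas Z -> jmeas (fun t o => Z o t).
Proof.
move=> mZ; apply: (measurableT_comp mZ (g := fun x : U * T => (x.2, x.1))).
by apply: measurable_fun_pair; [exact: measurable_snd|exact: measurable_fst].
Qed.

Lemma Ex_swap Z : L1 (P \x nu)%E (fun x => Z x.1 x.2) ->
  Ex P (fun o => Ex nu (Z o)) = Ex nu (fun t => Ex P (Z ^~ t)).
Proof.
move=> lZ; have mZ : jmeas Z := L1_meas lZ.
have side d1 d2 (T1 : measurableType d1) (T2 : measurableType d2)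
    (m1 : probability T1 R) (m2 : probability T2 R) (H : T1 -> T2 -> R) (i : \bar R) :
    jmeas H ->
    {ae m1, forall x, m2.-integrable setT (fun y => (H x y)%:E)} ->
    measurable_fun setT (fun x => \int[m2]_y (H x y)%:E)%E ->
    (\int[m1]_x \int[m2]_y (H x y)%:E = i)%E -> Ex m1 (fun x => Ex m2 (H x)) = fine i.
  move=> mH aeH mF <-; rewrite [LHS]/Ex /Rintegral; congr fine.
  apply: ae_eq_integral => //.
    by apply/measurable_EFinP; exact: measurable_tint.
  by apply: filterS aeH => x lx _; rewrite (L1_integralE lx).
rewrite (side _ _ _ _ P nu Z _ mZ (ae_integrable1 lZ) (measurable_fubini_F lZ)
  (integral12_prod_meas1 lZ)).
rewrite (side _ _ _ _ nu P (fun t o => Z o t) _ (jmeas_swap mZ) (ae_integrable2 lZ)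
  (measurable_fubini_G lZ) (integral21_prod_meas1 lZ)).
by [].
Qed.

Lemma L1_product (F : T -> R) (G : U -> R) : L1 P F -> L1 nu G ->
  L1 (P \x nu)%E (fun x => F x.1 * G x.2).
Proof.
move=> iF iG.
have mF := L1_meas iF; have mG := L1_meas iG.
have mFG : measurable_fun setT (fun o : T * U => (F o.1 * G o.2)%:E).
  apply/measurable_EFinP; apply: measurable_funM.
    exact: (measurableT_comp mF measurable_fst).
  exact: (measurableT_comp mG measurable_snd).
have innerabs x : (\int[nu]_y `|(F x * G y)%:E| =
    (`|F x| * Ex nu (fun o => `|G o|))%:E)%E.
  rewrite -ExZ; last exact: L1_abs.
  rewrite -L1_integralE; last by apply: L1Z; exact: L1_abs.
  by apply: eq_integral => y _ /=; rewrite normrM.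
apply/(@integrable12ltyP _ _ _ _ _ P nu _ mFG) => /=.
under eq_integral do rewrite innerabs.
have lF : L1 P (fun x => `|F x| * Ex nu (fun o => `|G o|)).
  rewrite (@eq_L1 _ _ _ P _ (fun x => Ex nu (fun o => `|G o|) * `|F x|)).
    by apply: L1Z; exact: L1_abs.
  by move=> o; rewrite mulrC.
by rewrite (L1_integralE lF) ltry.
Qed.

Lemma L1_fourth Z c : fourth_le nu P Z c -> L1 (P \x nu)%E (fun x => Z x.1 x.2 ^+ 4).
Proof.
move=> [mZ c0 Zc]; have m4 := jmeasX 4 mZ.
apply: ge0_L1 => //; first by move=> x; exact: fourth_ge0.
rewrite fubini_tonelli1.
- exact: le_lt_trans Zc (ltry _).
- exact/measurable_EFinP.
by move=> x; rewrite lee_fin fourth_ge0.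
Qed.

Lemma L1_weighted Z c (F : T -> R) (v : U -> R) : fourth_le nu P Z c ->
  L2 P F -> L2 nu v -> L1 (P \x nu)%E (fun x => F x.1 * Z x.1 x.2 * v x.2).
Proof.
move=> fZ lF lv; have [mZ _ _] := fZ.
have l1 := L1_product lF.2 lv.2; have l2 := L1_fourth fZ.
apply: (L1_dom _ (L1D (L1D l1 (L1cst _ 1)) l2)).
  apply: measurable_funM; last exact: (jmeas_time (L2_meas lv)).
  by apply: measurable_funM => //; exact: (jmeas_space (L2_meas lF)).
move=> x; rewrite mulrAC; apply: le_trans (mulr_le_sqr _ _) _.
rewrite exprMn -addrA lerD2l -sqr_sqr.
have := sqr_ge0 (Z x.1 x.2); have := sqr_ge0 (Z x.1 x.2 ^+ 2 - 1); nra.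
Qed.

Lemma L2_inn Z c v : fourth_le nu P Z c -> L2 nu v -> L2 P (inn nu Z v).
Proof.
move=> fZ lv; have [mZ c0 _] := fZ.
have mI := measurable_inn nu mZ (L2_meas lv).
split => //; have [lE _] := energy_nrm fZ.
have [|l _] := @ae_L1_le _ _ _ P (fun o => inn nu Z v o ^+ 2) _
    (measurable_funX 2 mI) (L1Z (nrm nu v ^+ 2) (L2_L1 lE)).
  apply: filterS (fourth_le_ae fZ) => o [lo _].
  by rewrite ger0_norm ?sqr_ge0// mulrC; exact: inn_sqr_le.
exact: l.
Qed.

Lemma Ex_mul_inn Z c (F : T -> R) v : fourth_le nu P Z c -> L2 P F -> L2 nu v ->
  Ex P (fun o => F o * inn nu Z v o) =
  Ex nu (fun t => v t * Ex P (fun o => F o * Z o t)).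
Proof.
move=> fZ lF lv; have [mZ _ _] := fZ.
have l := L1_weighted fZ lF lv.
have mFZ : jmeas (fun o t => F o * Z o t).
  by apply: jmeasM => //; exact: jmeas_space (L2_meas lF).
have lae : {ae P, forall o, L2 nu (Z o) /\ L1 nu (fun t => Z o t ^+ 4)} := fourth_le_ae fZ.
transitivity (Ex P (fun o => Ex nu (fun t => F o * Z o t * v t))).
  apply: ae_eq_Ex.
  - apply: measurable_funM; first exact: L2_meas lF.
    exact: (measurable_inn nu mZ (L2_meas lv)).
  - apply: (measurable_tint nu (Z := fun o t => F o * Z o t * v t)).
    by apply: jmeasM => //; exact: jmeas_time (L2_meas lv).
  apply: filterS lae => o [lo _]; rewrite /inn -ExZ; last exact: L2M.
  by apply: eq_Ex => t; rewrite mulrA.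
rewrite (Ex_swap l); apply: ae_eq_Ex.
- apply: (measurable_tint P (Z := fun t o => F o * Z o t * v t)).
  apply: (jmeas_swap (Z := fun o t => F o * Z o t * v t)).
  by apply: jmeasM => //; exact: jmeas_time (L2_meas lv).
- apply: measurable_funM; first exact: L2_meas lv.
  by apply: (measurable_tint P (Z := fun t o => F o * Z o t)); exact: jmeas_swap.
have := ae_integrable2 (L1_weighted fZ lF (L2cst nu 1)).
apply: filterS => t lt.
have {}lt : L1 P (fun o => F o * Z o t).
  by rewrite (@eq_L1 _ _ _ P _ (fun o => F o * Z o t * 1)) // => o; rewrite mulr1.
by rewrite -ExZ//; apply: eq_Ex => o; rewrite mulrC.
Qed.

Lemma fourth_le_ae_time Z c : fourth_le nu P Z c ->
  {ae nu, forall t, L2 P (Z ^~ t)}.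
Proof.
move=> [mZ c0 Zc].
have fZ : fourth_le P nu (fun t o => Z o t) c.
  split; [exact: jmeas_swap|by []|].
  rewrite /fourth_moment (tonelli nu P (jmeasX 4 mZ))//.
  by move=> o t; exact: fourth_ge0.
by apply: filterS (fourth_le_ae fZ) => t [].
Qed.

(** Two applications of Fubini's theorem express the covariance of two linear
    statistics by the covariance kernel acting on the first test function. *)
Lemma Ex_inn_inn X Y c v w (g : U -> R) : fourth_le nu P X c -> fourth_le nu P Y c ->
  L2 nu v -> L2 nu w -> measurable_fun setT g ->
  {ae nu, forall s, Ex nu (fun t => v t * Ex P (fun o => Y o s * X o t)) = g s} ->
  Ex P (fun o => inn nu X v o * inn nu Y w o) = Ex nu (fun s => w s * g s).
Proof.
move=> fX fY lv lw mg hg; have lI := L2_inn fX lv.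
have [mY _ _] := fY.
rewrite (Ex_mul_inn fY lI lw); apply: ae_eq_Ex.
- apply: measurable_funM; first exact: L2_meas lw.
  apply: (measurable_tint P (Z := fun s o => inn nu X v o * Y o s)).
  apply: (jmeas_swap (Z := fun o s => inn nu X v o * Y o s)).
  by apply: jmeasM => //; exact: jmeas_space (L2_meas lI).
- by apply: measurable_funM => //; exact: L2_meas lw.
apply: filterS2 hg (fourth_le_ae_time fY) => s <- lYs; congr (_ * _).
by rewrite -(Ex_mul_inn fX lYs lv); apply: eq_Ex => o; rewrite mulrC.
Qed.

End exchange_of_integrals.

(** * Sums over lags and norms of matrices *)

Lemma mem_int_range (a b x : int) : (x \in int_range a b) = (a <= x <= b).
Proof.
rewrite /int_range; case: ifP => ab; last first.
  by rewrite in_nil; apply/esym/negP => /andP[h1 h2]; lia.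
apply/mapP/idP => [[k]|/andP[ax xb]].
  by rewrite mem_iota => /andP[_ h] ->; lia.
exists `|x - a|%N; last by lia.
by rewrite mem_iota; lia.
Qed.

Lemma int_range_uniq (a b : int) : uniq (int_range a b).
Proof.
rewrite /int_range; case: ifP => // _; rewrite map_inj_uniq ?iota_uniq// => i j.
by move=> /addrI [].
Qed.

(** A pair of observation times is determined by its lag and its first member. *)
Lemma sum_over_lags {V : nmodType} (N : nat) (f : int -> int -> V) : (0 < N)%N ->
  \sum_(k <- int_range (- (N%:Z - 1)) (N%:Z - 1))
    \sum_(l <- int_range (Num.max 1 (1 - k)) (Num.min N%:Z (N%:Z - k))) f k l =
  \sum_(l < N) \sum_(j < N) f (time_of j - time_of l) (time_of l).
Proof.
move=> N0.
transitivity (\sum_(p <- [seq (k, l) | k <- int_range (- (N%:Z - 1)) (N%:Z - 1),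
    l <- int_range (Num.max 1 (1 - k)) (Num.min N%:Z (N%:Z - k))]) f p.1 p.2).
  by rewrite big_allpairs_dep.
transitivity (\sum_(p <- [seq (time_of j - time_of l, time_of l) | l <- iota 0 N,
    j <- iota 0 N]) f p.1 p.2); last first.
  rewrite big_allpairs_dep -[iota 0 N]/(iota 0 N) -{1}[N]subn0 -/(index_iota 0 N) big_mkord.
  by apply: eq_bigr => l _; rewrite -{1}[N]subn0 -/(index_iota 0 N) big_mkord.
apply: perm_big; apply: uniq_perm.
- apply: allpairs_uniq_dep; first exact: int_range_uniq.
    by move=> k _; exact: int_range_uniq.
  by move=> [k l] [k' l'] _ _ /= [-> ->].
- apply: allpairs_uniq_dep; first exact: iota_uniq.
    by move=> k _; exact: iota_uniq.
  move=> [k l] [k' l'] _ _ e; have := congr1 fst e; have := congr1 snd e.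
  rewrite /= /time_of => h2 h1; congr existT; lia.
move=> [k l]; apply/allpairsPdep/allpairsPdep => -[x [y [h1 h2 [-> ->]]]].
  move: h1 h2; rewrite !mem_int_range ge_max le_min => /andP[h1 h2] /andP[/andP[h3 h4] /andP[h5 h6]].
  exists `|(y - 1)%R|%N, `|(y + x - 1)%R|%N; rewrite !mem_iota /time_of.
  by split; [apply/andP; split; lia|apply/andP; split; lia|congr (_, _); lia].
move: h1 h2; rewrite !mem_iota => h1 h2.
exists (time_of y - time_of x), (time_of x); rewrite !mem_int_range ge_max le_min /time_of.
split => //; by [lia|congr (_, _); lia].
Qed.

Lemma cvg_matrix {R : realType} m n (M : nat -> 'M[R]_(m, n)) (L : 'M[R]_(m, n)) :
  (forall i j, M N i j @[N --> \oo] --> L i j) -> M @ \oo --> L.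
Proof.
move=> h; apply/cvgrPdist_lt => e e0.
have : \forall N \near \oo, forall i, forall j, `|L i j - M N i j| < e.
  apply: filter_forall => i; apply: filter_forall => j.
  by have /cvgrPdist_lt /(_ _ e0) := h i j.
apply: filterS => N hN; rewrite /Num.Def.normr /= mx_normrE; apply/bigmax_ltP; split => // -[i j] _ /=.
by rewrite !mxE.
Qed.

Lemma mx_norm_gt {R : realType} m n (M : 'M[R]_(m, n)) (e : R) : 0 <= e ->
  (e < `|M|) = [exists i, [exists j, e < `|M i j|]].
Proof.
move=> e0; apply/idP/existsP => [|[i /existsP[j h]]].
  rewrite ltNge => h; apply/existsP; apply: contraNT h => /existsPn no.
  rewrite /Num.Def.normr /= mx_normrE; apply/bigmax_leP; split => // -[i j] _ /=.
  by have := no i => /existsPn /(_ j); rewrite -leNgt.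
apply: lt_le_trans h _; rewrite /Num.Def.normr /= mx_normrE.
exact: (@le_bigmax _ _ _ 0 (fun x : 'I_m * 'I_n => `|M x.1 x.2|) (i, j)).
Qed.

Lemma markov_Ex {R : realType} {d} {T : measurableType d} (P : probability T R)
    (F : T -> R) e : 0 < e -> L1 P F ->
  (P [set o | (e < `|F o|)%R] <= (e^-1 * Ex P (fun o => `|F o|))%:E)%E.
Proof.
move=> e0 lF; have lA := L1_abs lF.
have mA : measurable [set o | (e < `|F o|)%R].
  have := L1_meas lA; move=> /(_ measurableT `]e, +oo[%classic).
  move=> /(_ (measurable_itv _)); rewrite setTI.
  by rewrite (_ : _ @^-1` _ = [set o | (e < `|F o|)%R])//; apply/seteqP; split => o /=;
    rewrite in_itv /= andbT.
have l1 : L1 P (\1_[set o | (e < `|F o|)%R]).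
  by apply: (@L1_bounded _ _ _ _ _ 1); [exact: measurable_indic|move=> o; rewrite indicE; case: (_ \in _); rewrite ?normr1 ?normr0].
rewrite -[X in P X]setIT -(@integral_indic _ _ _ P setT measurableT _ mA).
rewrite L1_integralE// lee_fin -ExZ//; apply: Ex_le => //; first exact: L1Z.
move=> o; rewrite indicE; case: (boolP (o \in _)) => [|_].
  by rewrite inE /= => h; rewrite mulrC ler_pdivlMr// mul1r ltW.
by rewrite mulr_ge0// invr_ge0 ltW.
Qed.

(** * The estimator for two scores *)

Lemma abs_bounded_series_cvg {R : realType} (r : nat -> R) (S : R) :
  (forall n, \sum_(h < n) `|r h| <= S) -> cvgn (fun n => \sum_(h < n) r h).
Proof.
move=> rS.
have -> : (fun n => \sum_(h < n) r h) = series r.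
  by apply/funext => n; rewrite seriesEnat /= big_mkord.
apply: normed_cvg; apply: nondecreasing_is_cvgn.
  by apply: nondecreasing_series => n _ _; exact: normr_ge0.
exists S => _ [n _ <-].
by have := rS n; rewrite -(big_mkord xpredT (fun h => `|r h|)).
Qed.

Lemma cvg_sum_from1 {R : realType} (r : nat -> R) (s : R) :
  \sum_(h < n) r h @[n --> \oo] --> s ->
  \sum_(1 <= h < n) r h @[n --> \oo] --> s - r 0.
Proof.
move=> rs; have h : (\sum_(h < n) r h) - r 0 @[n --> \oo] --> s - r 0.
  by apply: cvgB => //; exact: cvg_cst.
apply: cvg_trans h; apply: near_eq_cvg; exists 1 => // n /= n0.
by rewrite -(big_mkord xpredT) big_ltn// addrC addKr.
Qed.

Section two_scores.
Context {R : realType}.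
Context {dU : measure_display} {U : measurableType dU} (nu : probability U R).
Context {dE : measure_display} {E : measurableType dE}.
Variables (a b : (nat -> E) -> R).
Hypotheses (ma : measurable_functional a) (mb : measurable_functional b).
Context {d} {T : measurableType d} (P : probability T R).
Variable xi : innovation -> T -> U -> E.
Hypothesis iidxi : iid_paths P xi.
Variables (c : R).
Hypotheses (fa : fourth_le nu P (process a (ix 0) xi) c)
  (fb : fourth_le nu P (process b (ix 0) xi) c).
Variables (v w u : bool -> U -> R).
Hypotheses (lv : forall e, L2 nu (v e)) (lw : forall e, L2 nu (w e))
  (lu : forall e, L2 nu (u e)).
Local Notation G e := (gam nu a b xi (v e) (w e) (u e)).
Hypothesis G0 : forall e, Ex P (G e (ix 0)) = 0.
Variable S : R.
Hypothesis errS : forall e n,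
  \sum_(1 <= k < n) coupling_error nu a b P xi (v e) (w e) (u e) k <= S.

Let rp (h : nat) := Ex P (fun o => G true (ix 0) o * G false (ix h%:Z) o).
Let rn (h : nat) := Ex P (fun o => G true (ix h%:Z) o * G false (ix 0) o).

Let rnE h : rn h = Ex P (fun o => G false (ix 0) o * G true (ix h%:Z) o).
Proof. by apply: eq_Ex => o; rewrite mulrC. Qed.

Let q e := nrm P (G e (ix 0)).
Let Sr := q true * q false + q true * S + (q false * q true + q false * S).

Let S0 : 0 <= S.
Proof. by have := errS true 0; rewrite big_geq. Qed.

Let part_ge0 e e' : 0 <= q e * q e' + q e * S.
Proof. by rewrite addr_ge0// mulr_ge0// nrm_ge0. Qed.

Let rpS n : \sum_(h < n) `|rp h| <= Sr.
Proof.
have := cross_cov_summable ma mb iidxi fa fb lv lw lu G0 errS true false n.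
by move=> h; apply: le_trans h _; rewrite lerDl; exact: part_ge0.
Qed.

Let rnS n : \sum_(h < n) `|rn h| <= Sr.
Proof.
have := cross_cov_summable ma mb iidxi fa fb lv lw lu G0 errS false true n.
under eq_bigr do rewrite -rnE.
by move=> h; apply: le_trans h _; rewrite lerDr; exact: part_ge0.
Qed.

Lemma cvg_cross_cov_forward : \sum_(1 <= h < n) rp h @[n --> \oo] -->
  lim (\sum_(h < n) rp h @[n --> \oo]) - rp 0.
Proof. apply: cvg_sum_from1; exact: (abs_bounded_series_cvg rpS). Qed.

Lemma cvg_cross_cov_backward : \sum_(1 <= h < n) rn h @[n --> \oo] -->
  lim (\sum_(h < n) rn h @[n --> \oo]) - rn 0.
Proof. apply: cvg_sum_from1; exact: (abs_bounded_series_cvg rnS). Qed.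

Let x l := G true (ix (time_of l)).
Let y l := G false (ix (time_of l)).

Variables (K : R -> R) (Lam k0 M : R).
Hypotheses (Lam0 : 0 <= Lam) (k00 : 0 <= k0) (M0 : 0 <= M).
Hypothesis KLam : forall x y, `|K x - K y| <= Lam * `|x - y|.
Hypothesis Kk0 : forall x, `|K x| <= k0.
Hypothesis KM : forall x, M < `|x| -> K x = 0.
Hypothesis K1 : K 0 = 1.
Variable B : nat -> R.
Hypothesis B_oo : B N @[N --> \oo] --> +oo.
Hypothesis BN0 : B N / N%:R @[N --> \oo] --> 0.

Lemma two_scores_estimator e : 0 < e -> \forall N \near \oo,
  Ex P (fun o => `|N%:R^-1 * lag_form K B N x y o -
    (rp 0 + limn (fun n => \sum_(1 <= h < n) rp h) + limn (fun n => \sum_(1 <= h < n) rn h))|) <= e.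
Proof.
have qx := score_quasi_orthogonal ma mb iidxi fa fb (lv true) (lw true) (lu true) (G0 true) (errS true).
have qy := score_quasi_orthogonal ma mb iidxi fa fb (lv false) (lw false) (lu false) (G0 false) (errS false).
set Cx := Num.sqrt _ in qx; set Cy := Num.sqrt _ in qy.
have qx' : quasi_orthogonal P x (Cx + Cy).
  by apply: (quasi_orthogonal_le _ qx); rewrite lerDl; exact: sqrtr_ge0.
have qy' : quasi_orthogonal P y (Cx + Cy).
  by apply: (quasi_orthogonal_le _ qy); rewrite lerDr; exact: sqrtr_ge0.
(* Lag 0 already appears among the forward covariances. *)
pose rn' (h : nat) := if h == 0%N then 0 else rn h.
have rn'S n : \sum_(h < n) `|rn' h| <= Sr.
  apply: le_trans (rnS n); apply: ler_sum => h _; rewrite /rn'.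
  by case: ifP => // _; rewrite normr0.
have fwd l j : (l <= j)%N -> Ex P (fun o => x l o * y j o) = rp (j - l).
  move=> lj; rewrite /x /y (time_ofD lj).
  exact: (cross_cov_stationary ma mb iidxi fa fb lv lw lu true false).
have bwd l j : (j < l)%N -> Ex P (fun o => x l o * y j o) = rn' (l - j)%N.
  move=> jl; rewrite /rn' subn_eq0 leqNgt jl /= rnE /x /y (time_ofD (ltnW jl)).
  rewrite -(cross_cov_stationary ma mb iidxi fa fb lv lw lu false true (time_of j)).
  by apply: eq_Ex => o; rewrite mulrC.
have app := score_approximable ma mb iidxi fa fb lv lw lu G0 errS.
have cp := abs_bounded_series_cvg rpS.
have cn := abs_bounded_series_cvg rn'S.
have cp1 := cvg_lim (@Rhausdorff R) cvg_cross_cov_forward.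
have cn1 : limn (fun n => \sum_(1 <= h < n) rn h) = limn (fun n => \sum_(h < n) rn' h).
  rewrite -[RHS](subr0 _); apply: (cvg_lim (@Rhausdorff R)).
  rewrite -{2}[0]/(rn' 0).
  under eq_fun => n.
    rewrite (eq_big_nat _ _ (F2 := rn')); last by move=> h /andP[h0 _]; rewrite /rn' gtn_eqF.
    over.
  exact: cvg_sum_from1.
have := lag_estimator_L1 Lam0 k00 M0 KLam Kk0 KM K1 B_oo BN0 qx' qy' fwd bwd erefl rpS rn'S cp cn app.
rewrite -/x -/y => main e0; have := main _ e0.
by rewrite cp1 cn1 (addrC (rp 0)) subrK.
Qed.

End two_scores.

(** * Random functions on the unit interval *)

Section unit_interval_paths.
Context {R : realType} {dE : measure_display} {E : measurableType dE}.
Context {d} {T : measurableType d} (P : probability T R).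
Local Notation mu := (@lebesgue_measure R).
Local Notation UT := (measurableTypeR R).

(** Composition with the clamp pulls evaluations back to evaluations at times in
    the unit interval, which is where laws are prescribed. *)
Lemma cylinder_clamp (A : set (UT -> E)) : total_cylinder A ->
  cylinder `[(0 : R), 1] [set f : R -> E | A (fun t : UT => f (clamp t))].
Proof.
apply: (@smallest_sub _ (sigma_algebra setT) _
  [set A | cylinder `[(0 : R), 1] [set f : R -> E | A (fun t : UT => f (clamp t))]]); last first.
  move=> _ [t _ [B mB ->]] /=; apply: sub_gen_smallest.
  by exists (clamp t); [exact: clamp_in|exists B].
have [c0 cC cU] : sigma_algebra setT (cylinder (E := E) `[(0 : R), 1]).
  exact: smallest_sigma_algebra.
split => /=.
- exact: c0.
- by move=> C hC; exact: (cC _ hC).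
- by move=> F hF; exact: (cU _ hF).
Qed.

Lemma iid_paths_clamp {I : choiceType} (xi : I -> T -> R -> E) :
  iid_random_functions P xi ->
  iid_paths P (fun i o (t : UT) => xi i o (clamp t)).
Proof.
move=> [mxi laws ind]; split.
- move=> i.
  apply: (@measurable_comp _ _ _ _ _ _ ([set: T] `*` `[(0 : R)%R, 1%R] : set (T * UT))
    (fun x => xi i x.1 x.2) _ (fun x : T * UT => (x.1, clamp x.2))).
  + by apply: measurableX => //; exact: measurable_itv.
  + by move=> _ [x _ <-]; split => //; exact: clamp_in.
  + exact: mxi.
  + apply/measurable_fun_pairP; split; first exact: measurable_fst.
    exact: (measurableT_comp measurable_clamp measurable_snd).
- by move=> i j A /cylinder_clamp cA; exact: (laws i j _ cA).
- move=> J A cA.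
  by apply: (ind J (fun j => [set f | A j (fun t => f (clamp t))])) => j _; exact: cylinder_clamp.
Qed.

Lemma fourth_moment_clamp (Z : T -> R -> R) : jmeas (fun o (t : UT) => Z o (clamp t)) ->
  fourth_moment unit_prob P (fun o t => Z o (clamp t)) =
  (\int[P]_o \int[mu]_(t in `[(0 : R)%R, 1%R]) ((Z o t) ^+ 4)%:E)%E.
Proof.
move=> mZ; apply: eq_integral => o _; rewrite ge0_integral_unit.
- by rewrite (integral_clamp (fun t => (Z o t ^+ 4)%:E)).
- by apply/measurable_EFinP; apply: measurable_funX; exact: (jmeas_snd o mZ).
- by move=> t; rewrite lee_fin exprn_even_ge0.
Qed.

Lemma fourth_moment_clamp_time (Z : T -> R -> R) : jmeas (fun o (t : UT) => Z o (clamp t)) ->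
  fourth_moment unit_prob P (fun o t => Z o (clamp t)) =
  (\int[mu]_(t in `[(0 : R)%R, 1%R]) 'E_P[fun o => (Z o t ^+ 4)%R])%E.
Proof.
move=> mZ; rewrite /fourth_moment -tonelli; last 2 first.
- exact: (jmeasX 4 mZ).
- by move=> o t; rewrite exprn_even_ge0.
rewrite ge0_integral_unit.
- rewrite (integral_clamp (fun t => \int[P]_o (Z o t ^+ 4)%:E))%E.
  by apply: eq_integral => t _; rewrite unlock.
- apply: measurable_moment; first exact: (jmeasX 4 mZ).
  by move=> o t; rewrite exprn_even_ge0.
- by move=> t; apply: integral_ge0 => o _; rewrite lee_fin exprn_even_ge0.
Qed.

(** Adding 1 to a finite moment gives a number that is at most its own fourth
    power. *)
Lemma fourth_le_lty (Z : T -> UT -> R) : jmeas Z ->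
  (fourth_moment unit_prob P Z < +oo)%E -> exists2 c, 0 <= c & forall c', c <= c' -> fourth_le unit_prob P Z c'.
Proof.
have f0 : (0 <= fourth_moment unit_prob P Z)%E.
  by apply: integral_ge0 => o _; apply: integral_ge0 => t _; rewrite lee_fin exprn_even_ge0.
move=> mZ Zoo; exists (1 + fine (fourth_moment unit_prob P Z)).
  by rewrite addr_ge0// fine_ge0.
move=> c' cc'; have c1 : 1 <= c' by apply: le_trans cc'; rewrite lerDl fine_ge0.
split; [exact: mZ|exact: le_trans ler01 c1|].
rewrite -(fineK (_ : fourth_moment _ _ _ \is a fin_num)) ?ge0_fin_numE// lee_fin; apply: (@le_trans _ _ c').
  by apply: le_trans cc'; rewrite lerDr.
by rewrite -{1}(expr1 c'); apply: ler_weXn2l.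
Qed.

End unit_interval_paths.

(** An infinite moment would have an infinite fourth root, so that the moments
    are fourth powers of real numbers. *)
Lemma summable_fourth_roots {R : realType} (m : nat -> \bar R) :
  (forall k, 0 <= m k)%E -> (\sum_(1 <= k <oo) (m k) `^ (4^-1)%R < +oo)%E ->
  exists (al : nat -> R) (S : R), [/\ forall k, 0 <= al k,
    forall k, (0 < k)%N -> m k = (al k ^+ 4)%:E &
    forall n, \sum_(1 <= k < n) al k <= S].
Proof.
move=> m0 moo; pose r k := ((m k) `^ (4^-1)%R)%E.
have r0 k : (0 <= r k)%E by exact: poweR_ge0.
have part n : (\sum_(1 <= k < n) r k <= \sum_(1 <= k <oo) r k)%E.
  by apply: nneseries_lim_ge => k _ _; exact: r0.
have rfin k : (0 < k)%N -> r k \is a fin_num.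
  move=> k0; rewrite ge0_fin_numE//; apply: le_lt_trans moo.
  apply: le_trans (part k.+1); rewrite big_nat_recr//=.
  by rewrite leeDr// sume_ge0.
exists (fun k => fine (r k)), (fine (\sum_(1 <= k <oo) r k)%E); split.
- by move=> k; rewrite fine_ge0.
- move=> k k0; have := rfin k k0; rewrite /r; move: (m0 k); case: (m k) => [x| |]//.
    rewrite lee_fin => x0 _ /=; congr EFin.
    by rewrite -powR_mulrn ?powR_ge0// -powRrM mulVf ?pnatr_eq0// powRr1.
  by rewrite poweRyr// invr_eq0 pnatr_eq0.
- move=> n; rewrite -lee_fin fineK; last first.
    by rewrite ge0_fin_numE//; apply: nneseries_ge0.
  rewrite -sumEFin big_nat; apply: le_trans (part n); rewrite [leRHS]big_nat.
  apply: lee_sum => k /andP[k0 _]; rewrite fineK//; exact: rfin.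
Qed.

(** * The Bernoulli shift model *)

(** Markov's inequality for the sum of the absolute values of the entries, which
    dominates the norm. *)
Lemma cvg_in_probability_L1 {R : realType} {d} {T : measurableType d} (P : probability T R)
    m n (M : nat -> T -> 'M[R]_(m, n)) (L : 'M[R]_(m, n)) :
  (forall i j e, 0 < e -> \forall N \near \oo,
     L1 P (fun o => M N o i j - L i j) /\ Ex P (fun o => `|M N o i j - L i j|) <= e) ->
  cvg_in_probability P M L.
Proof.
move=> h e e0.
have bound eta : 0 < eta -> \forall N \near \oo,
    measurable [set o | e < `|M N o - L|] /\ (P [set o | (e < `|M N o - L|)%R] <= eta%:E)%E.
  move=> eta0; pose s := eta * e / (m * n).+1%:R.
  have s0 : 0 < s by rewrite divr_gt0// mulr_gt0.
  have : \forall N \near \oo, forall i, forall j,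
      L1 P (fun o => M N o i j - L i j) /\ Ex P (fun o => `|M N o i j - L i j|) <= s.
    by apply: filter_forall => i; apply: filter_forall => j; exact: h.
  apply: filterS => N hN.
  have l1 i j : L1 P (fun o => `|M N o i j - L i j|) by apply: L1_abs; case: (hN i j).
  have mA : measurable [set o | e < `|M N o - L|].
    rewrite (_ : [set o | _] = \bigcup_(ij in [set: 'I_m * 'I_n])
        [set o | e < `|M N o ij.1 ij.2 - L ij.1 ij.2|]).
      apply: fin_bigcup_measurable => // -[i j] _ /=.
      rewrite (_ : [set o | _] = setT `&` (fun o => `|M N o i j - L i j|) @^-1` `]e, +oo[%classic).
        by apply: (L1_meas (l1 i j)) => //; exact: measurable_itv.
      by rewrite setTI; apply/seteqP; split => o /=; rewrite in_itv /= andbT.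
    apply/seteqP; split => o /=; rewrite mx_norm_gt ?(ltW e0)//.
      by move=> /existsP[i /existsP[j]]; rewrite !mxE => eij; exists (i, j).
    by move=> [[i j] _ /= eij]; apply/existsP; exists i; apply/existsP; exists j; rewrite !mxE.
  split; first exact: mA.
  pose F o := \sum_i \sum_j `|M N o i j - L i j|.
  have lF : L1 P F by apply: L1sum => i _; apply: L1sum => j _; exact: l1.
  have F0 o : 0 <= F o by apply: sumr_ge0 => i _; apply: sumr_ge0.
  have AF : [set o | e < `|M N o - L|] `<=` [set o | e < `|F o|].
    move=> o /=; rewrite mx_norm_gt ?(ltW e0)// => /existsP[i /existsP[j]]; rewrite !mxE => eij.
    apply: lt_le_trans eij _; rewrite (ger0_norm (F0 o)) /F (bigD1 i)//= (bigD1 j)//=.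
    by rewrite -addrA lerDl addr_ge0// sumr_ge0// => k _; apply: sumr_ge0.
  have mF : measurable [set o | e < `|F o|].
    rewrite (_ : [set o | _] = setT `&` F @^-1` `]e, +oo[%classic).
      by apply: (L1_meas lF) => //; exact: measurable_itv.
    by rewrite setTI; apply/seteqP; split => o /=; rewrite in_itv /= andbT ger0_norm.
  apply: (@le_trans _ _ (P [set o | (e < `|F o|)%R])).
    by apply: le_measure; rewrite ?inE.
  apply: le_trans (markov_Ex e0 lF) _; rewrite lee_fin.
  rewrite (@eq_Ex _ _ _ P _ F); last by move=> o; rewrite ger0_norm.
  rewrite ler_pdivrMl//.
  rewrite Exsum; last by move=> i _; apply: L1sum => j _; exact: l1.
  apply: (@le_trans _ _ (\sum_(i < m) \sum_(j < n) s)).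
    apply: ler_sum => i _; rewrite Exsum; last by move=> j _; exact: l1.
    by apply: ler_sum => j _; case: (hN i j).
  rewrite !sumr_const !card_ord -mulrnA (mulrC e) -(@divfK _ (m * n).+1%:R _ (eta * e)) ?pnatr_eq0//.
  by rewrite -/s -[leLHS]mulr_natr ler_wpM2l ?(ltW s0)// ler_nat mulnC.
apply/fine_cvgP; split.
  by apply: filterS (bound 1 ltr01) => N [mA _]; exact: fin_num_measure.
apply/cvgr0Pnorm_le => eta eta0; apply: filterS (bound _ eta0) => N [mA le] /=.
rewrite ger0_norm ?fine_ge0//.
by rewrite -lee_fin fineK//; exact: fin_num_measure.
Qed.

Section bernoulli_model.
Context {R : realType} {d} {T : measurableType d} (P : probability T R).
Context {dE : measure_display} {E : measurableType dE}.
Local Notation mu := (@lebesgue_measure R).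
Local Notation UT := (measurableTypeR R).
Local Notation nu := (@unit_prob R).
Variables (eta : int -> T -> R -> E) (etac : int -> int -> int -> T -> R -> E).

Definition clamped_paths (i : innovation) (o : T) (t : UT) : E :=
  with_copies eta etac i o (clamp t).
Local Notation xi := clamped_paths.

Lemma coupled_clamp (a : (nat -> E) -> R) k n o (t : UT) :
  coupled a eta etac k n o (clamp t) = process a (ixc k n) xi o t.
Proof.
rewrite /process /clamped_paths /coupled; congr a; apply/funext => j.
by rewrite /ixc; case: ifP.
Qed.

Hypothesis hiid : iid_random_functions P (with_copies eta etac).
Let iidxi : iid_paths P xi := iid_paths_clamp hiid.

Section one_functional.
Variable a : (nat -> E) -> R.
Hypothesis ma : measurable_functional a.
Variable X : int -> T -> R -> R.
Hypothesis hX : forall n o (t : R), t \in `[0, 1] -> X n o t = bernoulli_shift a eta n o t.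

Lemma process_clamp n o : process a (ix n) xi o = fun t : UT => X n o (clamp t).
Proof. by apply/funext => t; rewrite hX ?clamp_in. Qed.

Lemma jmeas_clamp n : jmeas (fun o (t : UT) => X n o (clamp t)).
Proof.
have := jmeas_process iidxi (ix n) ma; rewrite /jmeas.
by under eq_fun do rewrite process_clamp.
Qed.

Lemma fourth_le_clamp :
  (\int[mu]_(t in `[(0 : R)%R, 1%R]) 'E_P[fun o => (X 0 o t ^+ 4)%R] < +oo)%E ->
  exists2 c, 0 <= c & forall c', c <= c' -> fourth_le nu P (process a (ix 0) xi) c'.
Proof.
move=> X4; apply: fourth_le_lty; first exact: (jmeas_process iidxi (ix 0) ma).
have -> : process a (ix 0) xi = fun o t => X 0 o (clamp t).
  by apply/funext => o; exact: process_clamp.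
by rewrite (fourth_moment_clamp_time P (jmeas_clamp 0)).
Qed.

Lemma coupling_fourth_le :
  (\sum_(1 <= k <oo) (\int[P]_o \int[mu]_(t in `[(0 : R)%R, 1%R])
     ((X 0 o t - coupled a eta etac k 0 o t) ^+ 4)%R%:E) `^ (4^-1)%R < +oo)%E ->
  exists (al : nat -> R) (S : R), (forall n, \sum_(1 <= k < n) al k <= S) /\
    forall k, (0 < k)%N -> fourth_le nu P
      (fun o t => process a (ix 0) xi o t - process a (ixc k 0) xi o t) (al k).
Proof.
pose m k := (\int[P]_o \int[mu]_(t in `[(0 : R)%R, 1%R])
     ((X 0 o t - coupled a eta etac k 0 o t) ^+ 4)%R%:E)%E.
move=> moo; have m0 k : (0 <= m k)%E.
  by apply: integral_ge0 => o _; apply: integral_ge0 => t _; rewrite lee_fin exprn_even_ge0.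
have [al [S [al0 mal alS]]] := summable_fourth_roots m0 moo.
exists al, S; split; first exact: alS.
move=> k k0.
have jm := jmeasB (jmeas_process iidxi (ix 0) ma) (jmeas_process iidxi (ixc k 0) ma).
split; [exact: jm|exact: al0|].
pose Z o (t : R) := X 0 o t - coupled a eta etac k 0 o t.
have ZE : (fun o (t : UT) => process a (ix 0) xi o t - process a (ixc k 0) xi o t) =
    (fun o t => Z o (clamp t)).
  by apply/funext => o; apply/funext => t; rewrite process_clamp /Z coupled_clamp.
rewrite ZE in jm *.
by rewrite (fourth_moment_clamp P jm) -(mal _ k0).
Qed.

End one_functional.

Variables (a b : (nat -> E) -> R).
Hypotheses (ma : measurable_functional a) (mb : measurable_functional b).
Variables (X eps : int -> T -> R -> R).
Hypothesis hX : forall n o (t : R), t \in `[0, 1] -> X n o t = bernoulli_shift a eta n o t.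
Hypothesis heps : forall n o (t : R), t \in `[0, 1] ->
  eps n o t = bernoulli_shift b eta n o t.
Variable c : R.
Hypotheses (fa : fourth_le nu P (process a (ix 0) xi) c)
  (fb : fourth_le nu P (process b (ix 0) xi) c).

Lemma coupling_error_sum (al be : nat -> R) (Sa Sb : R) v w u :
  (forall k, (0 < k)%N -> fourth_le nu P
      (fun o t => process a (ix 0) xi o t - process a (ixc k 0) xi o t) (al k)) ->
  (forall k, (0 < k)%N -> fourth_le nu P
      (fun o t => process b (ix 0) xi o t - process b (ixc k 0) xi o t) (be k)) ->
  (forall n, \sum_(1 <= k < n) al k <= Sa) -> (forall n, \sum_(1 <= k < n) be k <= Sb) ->
  L2 nu v -> L2 nu w -> L2 nu u -> forall n,
  \sum_(1 <= k < n) coupling_error nu a b P xi v w u k <=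
  c * (nrm nu v * nrm nu w + 2 * (nrm nu v * nrm nu u)) * (Sa + Sb).
Proof.
move=> fal fbe alS beS lv lw lu n; set C := c * _.
have C0 : 0 <= C.
  have [_ c0 _] := fa.
  by apply: mulr_ge0 => //; rewrite addr_ge0// ?mulr_ge0// ?nrm_ge0.
apply: (@le_trans _ _ (\sum_(1 <= k < n) C * (al k + be k))).
  apply: ler_sum_nat => k /andP[k0 _].
  exact: (score_diff_nrm fa fb (fourth_le_inj iidxi (@ix_inj 0) ma fa (@ixc_inj k 0))
    (fourth_le_inj iidxi (@ix_inj 0) mb fb (@ixc_inj k 0)) (fal k k0) (fbe k k0) lv lw lu).
by rewrite -mulr_sumr big_split /= ler_wpM2l// lerD.
Qed.

Section moments.
Hypothesis hEX : forall n (t : R), t \in `[0, 1] -> ('E_P[fun o => X n o t] = 0)%E.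
Hypothesis hXeps : forall n (t s : R), t \in `[0, 1] -> s \in `[0, 1] ->
  ('E_P[fun o => (X n o t * eps n o s)%R] = 0)%E.

Lemma cov_kernelE t s : t \in `[(0:R), 1] -> s \in `[(0:R), 1] ->
  cov_kernel P (X 0) t s = Ex P (fun o => X 0 o t * X 0 o s).
Proof.
move=> t01 s01; rewrite /cov_kernel unlock !hEX//= unlock; congr fine.
apply: eq_integral => o _; congr EFin; rewrite -[LHS]/((X 0 o t - 0) * (X 0 o s - 0)).
by rewrite !subr0.
Qed.

(** The first product is centred because the regressor and the noise are
    uncorrelated, the second one because [v] is an eigenfunction of the covariance
    operator and is orthogonal to [u]. *)
Lemma Ex_score0 (lambda : R) (v w u : R -> R) :
  inL2 v -> inL2 w -> inL2 u -> inner v u = 0 ->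
  {ae mu, forall t, t \in `[0, 1] ->
    \int[mu]_(s in `[0, 1]) (cov_kernel P (X 0) t s * v s) = lambda * v t} ->
  Ex P (gam nu a b xi (fun t => v (clamp t)) (fun t => w (clamp t))
    (fun t => u (clamp t)) (ix 0)) = 0.
Proof.
move=> /inL2_L2 lv /inL2_L2 lw /inL2_L2 lu vu eig.
have [lvw _] := inn_mul_nrm fa fb lv lw; have [lvu _] := inn_mul_nrm fa fa lv lu.
rewrite [LHS]ExD; [|exact: L2_L1|exact: L2_L1].
have jX := jmeas_clamp ma hX 0.
have -> : Ex P (fun o => inn nu (process a (ix 0) xi) (fun t => v (clamp t)) o *
    inn nu (process b (ix 0) xi) (fun t => w (clamp t)) o) = 0.
  rewrite (Ex_inn_inn (g := fun _ : UT => 0) fa fb lv lw); first last.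
  - apply: aeW => s /=; rewrite -[RHS](Excst nu 0); apply: eq_Ex => t.
    rewrite -[RHS](mulr0 (v (clamp t))); congr (_ * _).
    have := hXeps 0 (clamp_in t) (clamp_in s); rewrite unlock => /(congr1 fine) /= <-.
    congr fine; apply: eq_integral => o _.
    by rewrite (process_clamp hX) (process_clamp heps) mulrC.
  - exact: measurable_cst.
  by rewrite -[RHS](Excst nu 0); apply: eq_Ex => t; rewrite mulr0.
rewrite add0r (Ex_inn_inn (g := fun s : UT => lambda * v (clamp s)) fa fa lv lu).
- have -> : Ex nu (fun s => u (clamp s) * (lambda * v (clamp s))) =
      lambda * Ex nu (fun s => v (clamp s) * u (clamp s)).
    rewrite -ExZ; last exact: L2M.
    by apply: eq_Ex => s; ring.
  by rewrite -(inner_Ex (L2_meas lv) (L2_meas lu)) vu mulr0.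
- by apply: measurable_funM; [exact: measurable_cst|exact: L2_meas lv].
have := ae_unit eig; apply: filterS => s hs.
rewrite -hs Ex_unit.
  apply: eq_Rintegral => t; rewrite inE /= => t01; rewrite (clamp_id t01) mulrC.
  rewrite (cov_kernelE (clamp_in s) t01); congr (_ * _); apply: eq_Ex => o.
  by rewrite !(process_clamp hX) (clamp_id t01).
apply: measurable_funM; first exact: L2_meas lv.
apply: (measurable_tint P (Z := fun (t : UT) o => process a (ix 0) xi o s * process a (ix 0) xi o t)).
apply: (jmeas_swap (Z := fun o (t : UT) => process a (ix 0) xi o s * process a (ix 0) xi o t)).
have jp := jmeas_process iidxi (ix 0) ma.
by apply: jmeasM => //; apply: jmeas_space; exact: (jmeas_fst s jp).
Qed.

End moments.

Variables (v w u : nat -> R -> R).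
Hypotheses (v2 : forall i, inL2 (v i)) (w2 : forall i, inL2 (w i)) (u2 : forall i, inL2 (u i)).

Lemma gamma_entry_gam l o i j : gamma_entry X eps v w u l o i j =
  gam nu a b xi (fun t => v j (clamp t)) (fun t => w i (clamp t))
    (fun t => u i (clamp t)) (ix l) o.
Proof.
rewrite /gamma_entry /gam /score /inn (process_clamp hX) (process_clamp heps).
have mX := jmeas_snd o (jmeas_clamp ma hX l); have me := jmeas_snd o (jmeas_clamp mb heps l).
have mm f : inL2 f -> measurable_fun setT (fun t : UT => f (clamp t)).
  by move=> /inL2_L2; exact: L2_meas.
by rewrite !inner_Ex//; exact: mm.
Qed.

End bernoulli_model.

(** * The long-run covariance matrix *)

Lemma lipschitz_kernel_bounds {R : realType} (K : R -> R) :
  [lipschitz K x | x in setT] -> (exists M, forall x, K x != 0 -> `|x| <= M) ->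
  exists Lam k0 M, [/\ [/\ 0 <= Lam, 0 <= k0 & 0 <= M],
    forall x y, `|K x - K y| <= Lam * `|x - y|,
    forall x, `|K x| <= k0 & forall x, M < `|x| -> K x = 0].
Proof.
move=> [L0 [_ hL]] [M0 hM].
pose Lam : R := `|L0| + 1; pose M : R := `|M0|.
have M00 : 0 <= M by exact: normr_ge0.
have Lam0 : 0 <= Lam by rewrite addr_ge0.
have KLam x y : `|K x - K y| <= Lam * `|x - y|.
  by apply: (hL Lam _ (x, y)) => //=; rewrite ltr_pwDr// ler_norm.
have KM x : M < `|x| -> K x = 0.
  move=> Mx; apply: contraTeq Mx => /hM xM; rewrite -leNgt.
  exact: le_trans xM (ler_norm _).
exists Lam, (Lam * M + `|K 0|), M; split=> //.
  by split; [|rewrite addr_ge0// mulr_ge0|].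
move=> x; have [Mx|xM] := ltP M `|x|; first by rewrite KM// normr0 addr_ge0// mulr_ge0.
rewrite -[K x](subrK (K 0)); apply: le_trans (ler_normD _ _) _; rewrite lerD2r.
by apply: le_trans (KLam x 0) _; rewrite subr0 ler_wpM2l.
Qed.

Section estimator_entries.
Context {R : realType} {d} {T : measurableType d} (P : probability T R).
Variables (p q : nat) (X eps : int -> T -> R -> R) (v w u : nat -> R -> R).
Local Notation entry l e := (fun o => gamma_entry X eps v w u l o (e %/ p) (e %% p)).

Lemma gamma_mul k l o (e e' : 'I_(p * q)) :
  (gamma p q X eps v w u k o *m (gamma p q X eps v w u l o)^T) e e' =
  entry k e o * entry l e' o.
Proof. by rewrite mxE big_ord1 !mxE. Qed.

Lemma gamma_covE k l (e e' : 'I_(p * q)) :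
  gamma_cov P p q X eps v w u k l e e' = Ex P (fun o => entry k e o * entry l e' o).
Proof.
rewrite !mxE unlock; congr fine; apply: eq_integral => o _.
by rewrite gamma_mul.
Qed.

Lemma kernel_estimatorE K B N o (e e' : 'I_(p * q)) : (0 < N)%N ->
  kernel_estimator p q X eps v w u K B N o e e' =
  N%:R^-1 * lag_form K B N (fun l => entry (time_of l) e) (fun l => entry (time_of l) e') o.
Proof.
move=> N0; rewrite /kernel_estimator summxE.
pose f (k l : int) := K (k%:~R / B N) * (entry l e o * entry (l + k) e' o).
transitivity (N%:R^-1 * \sum_(k <- int_range (- (N%:Z - 1)) (N%:Z - 1))
    \sum_(l <- int_range (Num.max 1 (1 - k)) (Num.min N%:Z (N%:Z - k))) f k l).
  rewrite mulr_sumr; apply: eq_bigr => k _; rewrite mxE /phi mxE summxE mulrCA; congr (_ * _).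
  by rewrite mulr_sumr; apply: eq_bigr => l _; rewrite gamma_mul.
rewrite sum_over_lags//; congr (_ * _); apply: eq_bigr => l _; apply: eq_bigr => j _.
rewrite /f subrKC /lag_weight; congr (K (_ / _) * _).
by rewrite /time_of rmorphB /= !intS !rmorphD /= opprD addrACA subrr add0r.
Qed.

End estimator_entries.

Theorem theorem3p1 (R : realType) (d : measure_display) (T : measurableType d)
    (P : probability T R) (p q : nat) (hp : (1 <= p)%N) (hq : (1 <= q)%N)
    (X Y eps : int -> T -> R -> R) (Psi : R -> R -> R)
    (hY : forall n, jointly_measurable (Y n))
    (hPsi : measurable_on_square Psi)
    (hPsi2 : (kernel_integral (fun s t => (Psi s t ^+ 2)%R) < +oo)%E)
    (hmodel : forall n, {ae P, forall o,
       {ae @lebesgue_measure R, forall t : R, t \in `[0, 1] ->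
         Y n o t =
         \int[@lebesgue_measure R]_(s in `[0, 1]) (Psi s t * X n o s)
         + eps n o t}})
    (m : nat) (eta : int -> T -> R -> m.-tuple R)
    (etac : int -> int -> int -> T -> R -> m.-tuple R)
    (hiid : iid_random_functions P (with_copies eta etac))
    (a b : (nat -> m.-tuple R) -> R)
    (ha : forall A : set R, measurable A -> cylinder setT (a @^-1` A))
    (hb : forall A : set R, measurable A -> cylinder setT (b @^-1` A))
    (hX : forall n o (t : R), t \in `[0, 1] -> X n o t = bernoulli_shift a eta n o t)
    (heps : forall n o (t : R), t \in `[0, 1] ->
       eps n o t = bernoulli_shift b eta n o t)
    (hEX : forall n (t : R), t \in `[0, 1] -> ('E_P[fun o => X n o t] = 0)%E)
    (hEeps : forall n (t : R), t \in `[0, 1] -> ('E_P[fun o => eps n o t] = 0)%E)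
    (hX4 : forall n, (\int[@lebesgue_measure R]_(t in `[(0 : R)%R, 1%R])
       'E_P[fun o => (X n o t ^+ 4)%R] < +oo)%E)
    (heps4 : forall n, (\int[@lebesgue_measure R]_(t in `[(0 : R)%R, 1%R])
       'E_P[fun o => (eps n o t ^+ 4)%R] < +oo)%E)
    (hXeps : forall n (t s : R), t \in `[0, 1] -> s \in `[0, 1] ->
       ('E_P[fun o => (X n o t * eps n o s)%R] = 0)%E)
    (hXk : forall n, (\sum_(1 <= k <oo)
       (\int[P]_o \int[@lebesgue_measure R]_(t in `[(0 : R)%R, 1%R])
          ((X n o t - coupled a eta etac k n o t) ^+ 4)%R%:E) `^ (4^-1)%R
       < +oo)%E)
    (hepsk : forall n, (\sum_(1 <= k <oo)
       (\int[P]_o \int[@lebesgue_measure R]_(t in `[(0 : R)%R, 1%R])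
          ((eps n o t - coupled b eta etac k n o t) ^+ 4)%R%:E) `^ (4^-1)%R
       < +oo)%E)
    (hPsi4 : (kernel_integral (fun s t => (Psi s t ^+ 4)%R) < +oo)%E)
    (lambda tau : nat -> R) (v w : nat -> R -> R)
    (hv : forall n, eigensystem (cov_kernel P (X n)) lambda v)
    (hw : forall n, eigensystem (cov_kernel P (Y n)) tau w)
    (psi : nat -> nat -> R) (hpsi : kernel_expansion Psi v w psi)
    (u : nat -> R -> R) (hu : forall i, inL2 (u i))
    (hu_sum : forall i,
       cvgL2 (fun n s => \sum_(p <= r < n) psi i r * v r s) (u i))
    (K : R -> R) (hK0 : K 0 = 1) (hKsym : forall x, K (- x) = K x)
    (hKlip : [lipschitz K x | x in setT])
    (hKsupp : exists M : R, forall x, K x != 0 -> `|x| <= M)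
    (hKhat_lip : exists L : R, forall x y,
       Normc.normc (fourier K x - fourier K y) <= L * `|x - y|)
    (hKhat_int : (@lebesgue_measure R).-integrable setT
       (fun x => (Normc.normc (fourier K x))%:E))
    (B : nat -> R) (hB : B N @[N --> \oo] --> +oo)
    (hBN : B N / N%:R @[N --> \oo] --> 0) :
  (* the two series defining Sigma converge *)
  [/\ cvgn (fun n => \sum_(1 <= l < n) gamma_cov P p q X eps v w u 0 l%:Z),
      cvgn (fun n => \sum_(1 <= l < n) gamma_cov P p q X eps v w u l%:Z 0)
    & cvg_in_probability P (kernel_estimator p q X eps v w u K B)
        (long_run_cov P p q X eps v w u)].
Proof.
have [Lam [k0 [M [[Lam0 k00 M0] KLam Kk0 KM]]]] := lipschitz_kernel_bounds hKlip hKsupp.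
have [_ vbasis veig] := hv 0; have [v2 _ _] := vbasis.
have [_ [w2 _ _] _] := hw 0.
pose nu := @unit_prob R; pose xi := clamped_paths eta etac.
have iidxi : iid_paths P xi := iid_paths_clamp hiid.
have [ca ca0 fa'] := fourth_le_clamp hiid ha hX (hX4 0).
have [cb cb0 fb'] := fourth_le_clamp hiid hb heps (heps4 0).
have fa : fourth_le nu P (process a (ix 0) xi) (ca + cb) by apply: fa'; rewrite lerDl.
have fb : fourth_le nu P (process b (ix 0) xi) (ca + cb) by apply: fb'; rewrite lerDr.
have [al [Sa [alS fal]]] := coupling_fourth_le hiid ha hX (hXk 0).
have [be [Sb [beS fbe]]] := coupling_fourth_le hiid hb heps (hepsk 0).
pose cl (f : R -> R) (t : measurableTypeR R) := f (clamp t).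
pose G (e : 'I_(p * q)) := gam nu a b xi (cl (v (e %% p)%N)) (cl (w (e %/ p)%N)) (cl (u (e %/ p)%N)).
have lv (e : 'I_(p * q)) : L2 nu (cl (v (e %% p)%N)) by exact: inL2_L2.
have lw (e : 'I_(p * q)) : L2 nu (cl (w (e %/ p)%N)) by exact: inL2_L2.
have lu (e : 'I_(p * q)) : L2 nu (cl (u (e %/ p)%N)) by exact: inL2_L2.
have GE n e : G e (ix n) = (fun o => gamma_entry X eps v w u n o (e %/ p) (e %% p)).
  by apply/funext => o; rewrite (gamma_entry_gam hiid ha hb hX heps v2 w2 hu).
have G0 e : Ex P (G e (ix 0)) = 0.
  apply: (Ex_score0 hiid ha hX heps fa fb hEX hXeps (v2 _) (w2 _) (hu _) _ (veig _)).
  by apply: (orthogonal_limit vbasis (hu _) (hu_sum _)); rewrite ltn_mod.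
have [S errS] : exists S, forall (e : 'I_(p * q)) n, \sum_(1 <= k < n) coupling_error nu a b P xi
    (cl (v (e %% p)%N)) (cl (w (e %/ p)%N)) (cl (u (e %/ p)%N)) k <= S.
  pose Ce (e : 'I_(p * q)) := (ca + cb) * (nrm nu (cl (v (e %% p)%N)) * nrm nu (cl (w (e %/ p)%N)) +
    2 * (nrm nu (cl (v (e %% p)%N)) * nrm nu (cl (u (e %/ p)%N)))) * (Sa + Sb).
  have he e n := coupling_error_sum hiid ha hb fa fb fal fbe alS beS (lv e) (lw e) (lu e) n.
  (* One bound for the finitely many entries. *)
  exists (\sum_e Ce e) => e n; apply: le_trans (he e n) _.
  rewrite -/(Ce e) (bigD1 e)//= lerDl; apply: sumr_ge0 => e' _.
  by have := he e' 0; rewrite big_geq.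
pose x e l := G e (ix (time_of l)).
pose rp e e' h := gamma_cov P p q X eps v w u 0 h%:Z e e'.
pose rn e e' h := gamma_cov P p q X eps v w u h%:Z 0 e e'.
have rpE e e' : rp e e' = fun h => Ex P (fun o => G e (ix 0) o * G e' (ix h%:Z) o).
  by apply/funext => h; rewrite /rp gamma_covE !GE.
have rnE e e' : rn e e' = fun h => Ex P (fun o => G e (ix h%:Z) o * G e' (ix 0) o).
  by apply/funext => h; rewrite /rn gamma_covE !GE.
have lvb e e' (s : bool) := lv (if s then e else e').
have lwb e e' (s : bool) := lw (if s then e else e').
have lub e e' (s : bool) := lu (if s then e else e').
have G0b e e' (s : bool) := G0 (if s then e else e').
have errSb e e' (s : bool) := errS (if s then e else e').
have fwd e e' := cvg_cross_cov_forward ha hb iidxi fa fb (lvb e e') (lwb e e') (lub e e') (G0b e e') (errSb e e').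
have bwd e e' := cvg_cross_cov_backward ha hb iidxi fa fb (lvb e e') (lwb e e') (lub e e') (G0b e e') (errSb e e').
have est e e' := two_scores_estimator ha hb iidxi fa fb (lvb e e') (lwb e e') (lub e e') (G0b e e') (errSb e e')
  Lam0 k00 M0 KLam Kk0 KM hK0 hB hBN.
rewrite /= in fwd bwd est.
have {}fwd e e' : cvgn (fun n => \sum_(1 <= h < n) rp e e' h).
  by rewrite rpE; apply: cvgP (fwd e e').
have {}bwd e e' : cvgn (fun n => \sum_(1 <= h < n) rn e e' h).
  by rewrite rnE; apply: cvgP (bwd e e').
have {}est e e' t : 0 < t -> \forall N \near \oo,
    Ex P (fun o => `|N%:R^-1 * lag_form K B N (x e) (x e') o -
      (rp e e' 0 + limn (fun n => \sum_(1 <= h < n) rp e e' h) +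
       limn (fun n => \sum_(1 <= h < n) rn e e' h))|) <= t.
  by rewrite rpE rnE; exact: (est e e').
have cp : (fun n => \sum_(1 <= l < n) gamma_cov P p q X eps v w u 0 l%:Z) @ \oo -->
    \matrix_(e, e') limn (fun n => \sum_(1 <= h < n) rp e e' h).
  by apply: cvg_matrix => e e'; rewrite mxE; under eq_fun do rewrite summxE; exact: fwd.
have cn : (fun n => \sum_(1 <= l < n) gamma_cov P p q X eps v w u l%:Z 0) @ \oo -->
    \matrix_(e, e') limn (fun n => \sum_(1 <= h < n) rn e e' h).
  by apply: cvg_matrix => e e'; rewrite mxE; under eq_fun do rewrite summxE; exact: bwd.
have lx e l : L2 P (x e l).
  exact: (L2_gam ha hb iidxi (@ix_inj 0) fa fb (lv e) (lw e) (lu e) (@ix_inj (time_of l))).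
have xE e : x e = (fun l o => gamma_entry X eps v w u (time_of l) o (e %/ p) (e %% p)).
  by apply/funext => l; rewrite -GE.
split; [exact: cvgP cp|exact: cvgP cn|].
apply: cvg_in_probability_L1 => e e' t t0.
have LE : long_run_cov P p q X eps v w u e e' =
    rp e e' 0 + limn (fun n => \sum_(1 <= h < n) rp e e' h) +
    limn (fun n => \sum_(1 <= h < n) rn e e' h).
  rewrite /long_run_cov (cvg_lim (@norm_hausdorff _ _) cp) (cvg_lim (@norm_hausdorff _ _) cn).
  have addE (A C : 'M[R]_(p * q)) : (A + C) e e' = A e e' + C e e' by rewrite mxE.
  by rewrite !addE; congr (_ + _ + _); rewrite mxE.
have KE N o : (0 < N)%N -> kernel_estimator p q X eps v w u K B N o e e' =
    N%:R^-1 * lag_form K B N (x e) (x e') o.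
  by move=> N0; rewrite !xE; exact: kernel_estimatorE.
have [N1 _ hN] := est e e' t t0.
exists (maxn N1 1) => // N /=; rewrite geq_max => /andP[N1N N0].
have FE : (fun o => kernel_estimator p q X eps v w u K B N o e e' -
    long_run_cov P p q X eps v w u e e') =
    fun o => N%:R^-1 * lag_form K B N (x e) (x e') o - (rp e e' 0 +
      limn (fun n => \sum_(1 <= h < n) rp e e' h) + limn (fun n => \sum_(1 <= h < n) rn e e' h)).
  by apply/funext => o; rewrite LE KE.
split.
  rewrite FE; apply: L1B; last exact: L1cst.
  by apply: L1Z; exact: (L1_lag_form _ _ _ (lx e) (lx e')).
apply: le_trans (hN N N1N); rewrite (@eq_Ex _ _ _ P _ (fun o => `|N%:R^-1 * lag_form K B N (x e) (x e') o -
  (rp e e' 0 + limn (fun n => \sum_(1 <= h < n) rp e e' h) + limn (fun n => \sum_(1 <= h < n) rn e e' h))|))//.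
by move=> o; have := congr1 (fun F => `|F o|) FE.
Qed.
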